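(* Let $\mathbf{k}$ be a field of characteristic zero, $P=(x\partial_x-r_1)\cdots(x\partial_x-r_k)$ with $r_1,\dots,r_k\in\mathbf{k}$, and $Q=\sum_{i\ge1}Q_it^i$ with $Q_i\in\mathbf{k}(\!(x)\!)[\partial_x]$. Let $l$, $k_i$ and $\lambda_{i,j}\in t^{1/L}\bar{\mathbf{k}}[[t^{1/L}]]$ ($1\le i\le l$, $1\le j\le k_i$) be the numbers and exponents attached to $P+Q$ as defined in the context. Then $$\varepsilon^k\exp\Big(T_\varepsilon\big(\mathrm{Coef}_{x^\varepsilon}(\log(1+P^{-1}Q)(x^\varepsilon))\big)\Big)=\prod_{i=1}^l\prod_{j=1}^{k_i}(\varepsilon-\lambda_{i,j}),$$ where $\log$ is understood as a power series, so that the argument of $T_\varepsilon$ is a power series in $t$, and $T_\varepsilon$ is applied to each coefficient of this power series. In particular, the left-hand side is a monic polynomial in $\varepsilon$ of degree $k$.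
   Context: $\bar{\mathbf{k}}$ is an algebraic closure of $\mathbf{k}$, and $\varepsilon$ is a formal parameter. Differential operators act on formal expressions $x^{\varepsilon+m}$, $m\in\mathbb{Z}$, by $x\cdot x^{\varepsilon+m}=x^{\varepsilon+m+1}$, $\partial_xx^{\varepsilon+m}=(\varepsilon+m)x^{\varepsilon+m-1}$, and $P^{-1}x^{\varepsilon+m}=\prod_{i=1}^k(\varepsilon+m-r_i)^{-1}x^{\varepsilon+m}$; thus $\log(1+P^{-1}Q)$ acts on $x^\varepsilon$, producing an element of $x^\varepsilon\mathbf{k}(\varepsilon)(\!(x)\!)[[t]]$, and $\mathrm{Coef}_{x^\varepsilon}$ is the coefficient of $x^\varepsilon$ (in $\mathbf{k}(\varepsilon)[[t]]$). $T_\varepsilon:\mathbf{k}(\varepsilon)\to\varepsilon^{-1}\mathbf{k}[\varepsilon^{-1}]$ is the restriction to $\mathbf{k}(\varepsilon)$ of the $\bar{\mathbf{k}}$-linear operator on $\bar{\mathbf{k}}(\varepsilon)$ defined via partial fractions by $T_\varepsilon(\varepsilon^i)=0$ for $i\ge0$ and $T_\varepsilon((\varepsilon-c)^{-j})=\varepsilon^{-j}$ for $j>0$, $c\in\bar{\mathbf{k}}$. Exponents: say $r_i\sim r_j$ iff $r_i-r_j\in\mathbb{Z}$, and let $s_1,\dots,s_l$ be the smallest representatives of the classes of $\{r_1,\dots,r_k\}$ (so $s_i-s_j\notin\mathbb{Z}$ for $i\neq j$, and each $r_i=s_j+m$ for some $j$ and integer $m\ge0$). Let $k_i$ be the number of indices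 $m$ with $r_m-s_i\in\mathbb{Z}$, so $k_1+\dots+k_l=k$. With formal symbols $x^{s}$, $\log x$ and the usual differentiation rules, the space $M_i$ of solutions of $(P+Q)f=0$ with $f\in x^{s_i}\mathbf{k}(\!(x)\!)[\log x][[t]]$ is a free $\mathbf{k}[[t]]$-module of rank $k_i$, and for some $L\ge1$, after extension of scalars to $\bar{\mathbf{k}}(\!(t^{1/L})\!)$, it has a basis $f_{i,1},\dots,f_{i,k_i}$ of the form $f_{i,j}=x^{s_i+\lambda_{i,j}}g_{i,j}$ with $\lambda_{i,j}\in t^{1/L}\bar{\mathbf{k}}[[t^{1/L}]]$ and $g_{i,j}\in\bar{\mathbf{k}}(\!(x)\!)[[t^{1/L}]][\log x]$ of degree $<k_i$ in $\log x$, where $x^{s_i+\lambda_{i,j}}=x^{s_i}\sum_{m\ge0}\lambda_{i,j}^m(\log x)^m/m!$. The $\lambda_{i,j}$ are these exponents; equivalently, $\lambda_{i,1},\dots,\lambda_{i,k_i}$ are the eigenvalues, with multiplicity, of the derivation $D_{\log}$ on $M_i$ ($D_{\log}$ kills $x^{s}$, $x$ and $t$, and $D_{\log}(\log x)=1$). *)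

(* Defs.v *)
From HB Require Import structures.
From mathcomp Require Import all_boot all_order all_algebra.
From mathcomp Require Import boolp classical_sets functions fsbigop.

Set Implicit Arguments.
Unset Strict Implicit.
Unset Printing Implicit Defensive.

Import Order.TTheory GRing.Theory Num.Theory.

Local Open Scope ring_scope.

Record fps (R : Type) := Fps { fps_coef :> nat -> R }.

HB.instance Definition _ (R : Type) := gen_eqMixin (fps R).
HB.instance Definition _ (R : Type) := gen_choiceMixin (fps R).

Lemma fpsP (R : Type) (f g : fps R) : (forall n, f n = g n) <-> f = g.
Proof.
split=> [|-> //]; case: f => f; case: g => g /= fg.
by congr Fps; apply/funext.
Qed.

Section FpsZmod.
Variable R : zmodType.
Implicit Types f g h : fps R.

Definition fps_add f g := Fps (fun n => f n + g n).
Definition fps_opp f := Fps (fun n => - f n).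
Definition fps_zero : fps R := Fps (fun _ => 0).

Fact fps_addA : associative fps_add.
Proof. by move=> f g h; apply/fpsP => n /=; rewrite addrA. Qed.
Fact fps_addC : commutative fps_add.
Proof. by move=> f g; apply/fpsP => n /=; rewrite addrC. Qed.
Fact fps_add0 : left_id fps_zero fps_add.
Proof. by move=> f; apply/fpsP => n /=; rewrite add0r. Qed.
Fact fps_addN : left_inverse fps_zero fps_opp fps_add.
Proof. by move=> f; apply/fpsP => n /=; rewrite addNr. Qed.

HB.instance Definition _ :=
  GRing.isZmodule.Build (fps R) fps_addA fps_addC fps_add0 fps_addN.

Lemma fps_coefD f g n : (f + g) n = f n + g n. Proof. by []. Qed.
Lemma fps_coefN f n : (- f) n = - f n. Proof. by []. Qed.
Lemma fps_coef0 n : (0 : fps R) n = 0. Proof. by []. Qed.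

End FpsZmod.

Definition fps_map (R S : Type) (h : R -> S) (f : fps R) : fps S :=
  Fps (fun n => h (f n)).

Definition fpsC (R : zmodType) (c : R) : fps R :=
  Fps (fun n => if n is 0 then c else 0).

Section FpsRing.
Variable R : comNzRingType.
Implicit Types f g h : fps R.

Definition fps_mul f g := Fps (fun n => \sum_(i < n.+1) f i * g (n - i)%N).

Let trunc N f : {poly R} := \poly_(i < N.+1) f i.

Let truncE N f n : (n <= N)%N -> (trunc N f)`_n = f n.
Proof. by move=> nN; rewrite coef_poly ltnS nN. Qed.

Let trunc_mul N f g n :
  (n <= N)%N -> (trunc N f * trunc N g)`_n = fps_mul f g n.
Proof.
move=> nN; rewrite coefM; apply: eq_bigr => i _ /=.
rewrite !truncE ?(leq_trans (leq_subr _ _))//.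
by apply: leq_trans nN; rewrite -ltnS.
Qed.

Fact fps_mulC : commutative fps_mul.
Proof.
by move=> f g; apply/fpsP => n; rewrite -!(@trunc_mul n)// mulrC.
Qed.

Fact fps_mulA : associative fps_mul.
Proof.
move=> f g h; apply/fpsP => n.
transitivity ((trunc n f * (trunc n g * trunc n h))`_n).
  rewrite coefM; apply: eq_bigr => i _ /=.
  by rewrite truncE ?trunc_mul ?leq_subr// -ltnS.
rewrite mulrA coefM; apply: eq_bigr => i _ /=.
by rewrite truncE ?trunc_mul ?leq_subr// -ltnS.
Qed.

Fact fps_mul1 : left_id (fpsC 1) fps_mul.
Proof.
move=> f; apply/fpsP => n /=; rewrite big_ord_recl /= mul1r subn0.
by rewrite big1 ?addr0// => i _; rewrite mul0r.
Qed.

Fact fps_mulD : left_distributive fps_mul +%R.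
Proof.
move=> f g h; apply/fpsP => n /=; rewrite -big_split /=.
by apply: eq_bigr => i _; rewrite mulrDl.
Qed.

Fact fps_1neq0 : fpsC (1 : R) != 0.
Proof.
by apply/eqP => /fpsP /(_ 0) /= /eqP; rewrite oner_eq0.
Qed.

HB.instance Definition _ :=
  GRing.Zmodule_isComNzRing.Build (fps R)
    fps_mulA fps_mulC fps_mul1 fps_mulD fps_1neq0.

Lemma fps_coefM f g n : (f * g) n = \sum_(i < n.+1) f i * g (n - i)%N.
Proof. by []. Qed.
Lemma fps_coef1 n : (1 : fps R) n = (n == 0)%:R. Proof. by case: n. Qed.

End FpsRing.

(* [exp f] for [f] without constant term: the terms [f ^+ m / m!] with [m > n]
   do not contribute to the coefficient of index [n]. *)
Definition fps_exp (R : comUnitRingType) (f : fps R) : fps R :=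
  Fps (fun n => \sum_(m < n.+1) (f ^+ m) n / (m`!)%:R).

(* The substitution [t := u^L], from [R[[t]]] to [R[[u]]]. *)
Definition fps_ramify (R : zmodType) (L : nat) (f : fps R) : fps R :=
  Fps (fun n => if (L %| n)%N then f (n %/ L)%N else 0).

Record laurent (R : zmodType) := Laurent {
  laurent_coef :> int -> R;
  laurent_bounded : exists N : int, forall n, n < N -> laurent_coef n = 0 }.

HB.instance Definition _ (R : zmodType) := gen_eqMixin (laurent R).
HB.instance Definition _ (R : zmodType) := gen_choiceMixin (laurent R).

Lemma laurentP (R : zmodType) (f g : laurent R) :
  (forall n, f n = g n) <-> f = g.
Proof.
split=> [|-> //]; case: f => f Pf; case: g => g Pg /= fg.
have {}fg : f = g by apply/funext.
by case: g / fg Pg => Pg; congr Laurent; apply: Prop_irrelevance.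
Qed.

Section LaurentZmod.
Variable R : zmodType.
Implicit Types f g h : laurent R.

Lemma laurent_bounded2 f g :
  exists N : int, forall n, n < N -> f n = 0 /\ g n = 0.
Proof.
have [[N fN] [M gM]] := (laurent_bounded f, laurent_bounded g).
by exists (Num.min N M) => n; rewrite lt_min => /andP[/fN -> /gM ->].
Qed.

Fact laurent_add_bounded f g :
  exists N : int, forall n, n < N -> f n + g n = 0.
Proof.
have [N fgN] := laurent_bounded2 f g; exists N => n /fgN[-> ->].
exact: addr0.
Qed.
Definition laurent_add f g := Laurent (laurent_add_bounded f g).

Fact laurent_opp_bounded f : exists N : int, forall n, n < N -> - f n = 0.
Proof.
by have [N fN] := laurent_bounded f; exists N => n /fN ->; rewrite oppr0.
Qed.
Definition laurent_opp f := Laurent (laurent_opp_bounded f).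

Fact laurent_zero_bounded :
  exists N : int, forall n, n < N -> (fun=> 0) n = 0 :> R.
Proof. by exists 0. Qed.
Definition laurent_zero := Laurent laurent_zero_bounded.

Fact laurent_addA : associative laurent_add.
Proof. by move=> f g h; apply/laurentP => n /=; rewrite addrA. Qed.
Fact laurent_addC : commutative laurent_add.
Proof. by move=> f g; apply/laurentP => n /=; rewrite addrC. Qed.
Fact laurent_add0 : left_id laurent_zero laurent_add.
Proof. by move=> f; apply/laurentP => n /=; rewrite add0r. Qed.
Fact laurent_addN : left_inverse laurent_zero laurent_opp laurent_add.
Proof. by move=> f; apply/laurentP => n /=; rewrite addNr. Qed.

HB.instance Definition _ := GRing.isZmodule.Build (laurent R)
  laurent_addA laurent_addC laurent_add0 laurent_addN.

Lemma laurent_coefD f g n : (f + g) n = f n + g n. Proof. by []. Qed.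
Lemma laurent_coefN f n : (- f) n = - f n. Proof. by []. Qed.
Lemma laurent_coef0 n : (0 : laurent R) n = 0. Proof. by []. Qed.

Fact laurent_monom_bounded (c : R) (m : int) :
  exists N : int, forall n, n < N -> (if n == m then c else 0) = 0.
Proof. by exists m => n; case: ltgtP. Qed.
Definition laurent_monom (c : R) (m : int) :=
  Laurent (laurent_monom_bounded c m).
Definition laurentC (c : R) := laurent_monom c 0.

Fact laurent_of_fps_bounded (f : fps R) :
  exists N : int, forall n, n < N -> (if n is Posz m then f m else 0) = 0.
Proof. by exists 0; case. Qed.
Definition laurent_of_fps (f : fps R) := Laurent (laurent_of_fps_bounded f).

End LaurentZmod.

Section LaurentMap.
Variables (R S : zmodType) (h : {additive R -> S}).

Fact laurent_map_bounded (f : laurent R) :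
  exists N : int, forall n, n < N -> h (f n) = 0.
Proof.
by have [N fN] := laurent_bounded f; exists N => n /fN ->; rewrite raddf0.
Qed.
Definition laurent_map (f : laurent R) := Laurent (laurent_map_bounded f).

End LaurentMap.

Section LaurentRing.
Variable R : comNzRingType.
Implicit Types f g h : laurent R.
Local Open Scope classical_set_scope.

(* A sum with finitely many nonzero terms, by boundedness of [f] and [g]. *)
Let conv f g (n : int) : R := \sum_(m \in [set: int]) f m * g (n - m).

Let shift (a : int) f : fps R := Fps (fun n => f (a + n%:Z)).
Let below (a : int) f := forall n, n < a -> f n = 0.

Let convE a b f g k : below a f -> below b g ->
  conv f g (a + b + k%:Z) = (shift a f * shift b g) k.
Proof.
move=> fa gb; rewrite fps_coefM /conv.
rewrite (fsbigE [seq a + i%:Z | i <- iota 0 k.+1]) //; last first.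
- move=> m _ mk; have [/fa ->|am] := ltP m a; first by rewrite mul0r.
  rewrite [X in _ * X]gb ?mulr0//.
  have [i mi] : exists i : nat, m = a + i%:Z.
    exists `|m - a|%N; rewrite gez0_abs ?subr_ge0//.
    by rewrite addrCA subrr addr0.
  have ki : (k < i)%N.
    rewrite ltnNge; apply: contra mk => ik; apply/mapP.
    by exists i => //; rewrite mem_iota ltnS.
  rewrite mi; have -> : a + b + k%:Z - (a + i%:Z) = b + (k%:Z - i%:Z).
    by rewrite opprD addrACA [a + b - a]addrAC subrr add0r.
  by rewrite gtrDl subr_lt0 ltz_nat.
- by rewrite map_inj_uniq ?iota_uniq// => i j /addrI [].
rewrite big_map -[iota 0 _]/(index_iota 0 k.+1) big_mkord.
under eq_bigl do rewrite in_setT.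
apply: eq_bigr => i _ /=; congr (_ * g _).
rewrite opprD addrACA [a + b - a]addrAC subrr add0r.
by rewrite -(@subzn k i) -1?ltnS.
Qed.

Let conv_below a b f g : below a f -> below b g ->
  forall n, n < a + b -> conv f g n = 0.
Proof.
move=> fa gb n nab; apply: fsbig1 => m _.
have [/fa ->|am] := ltP m a; first by rewrite mul0r.
by rewrite [X in _ * X]gb ?mulr0// ltrBlDr (lt_le_trans nab)// addrC lerD2l.
Qed.

Fact laurent_mul_bounded f g :
  exists N : int, forall n, n < N -> conv f g n = 0.
Proof.
have [[N fN] [M gM]] := (laurent_bounded f, laurent_bounded g).
by exists (N + M); apply: conv_below.
Qed.
Definition laurent_mul f g := Laurent (laurent_mul_bounded f g).

Let below_mul a b f g :
  below a f -> below b g -> below (a + b) (laurent_mul f g).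
Proof. exact: conv_below. Qed.

Let shift_mul a b f g : below a f -> below b g ->
  shift (a + b) (laurent_mul f g) = shift a f * shift b g.
Proof. by move=> fa gb; apply/fpsP => n; rewrite -convE. Qed.

Let shift_inj a f g :
  below a f -> below a g -> shift a f = shift a g -> f = g.
Proof.
move=> fa ga /fpsP fg; apply/laurentP => n.
have [na|an] := ltP n a; first by rewrite fa ?ga.
have := fg `|n - a|%N; rewrite /= gez0_abs ?subr_ge0//.
by rewrite addrCA subrr addr0.
Qed.

Fact laurent_mulC : commutative laurent_mul.
Proof.
move=> f g; have [[a fa] [b gb]] := (laurent_bounded f, laurent_bounded g).
apply: (@shift_inj (a + b)); [exact: below_mul| |].
  by rewrite addrC; apply: below_mul.
by rewrite shift_mul// [a + b]addrC shift_mul// mulrC.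
Qed.

Fact laurent_mulA : associative laurent_mul.
Proof.
move=> f g h; have [a fa] := laurent_bounded f.
have [[b gb] [c hc]] := (laurent_bounded g, laurent_bounded h).
have ab := below_mul fa gb; have bc := below_mul gb hc.
apply: (@shift_inj (a + b + c)); last first.
- rewrite (shift_mul ab hc) (shift_mul fa gb) -addrA.
  by rewrite (shift_mul fa bc) (shift_mul gb hc) mulrA.
- exact: below_mul.
- by rewrite -addrA; apply: below_mul.
Qed.

Fact laurent_mulD : left_distributive laurent_mul +%R.
Proof.
move=> f g h; have [c hc] := laurent_bounded h.
have [a fga] := laurent_bounded2 f g.
have fa : below a f by move=> n /fga[].
have ga : below a g by move=> n /fga[].
have fg : below a (f + g) by move=> n /fga[/= -> ->]; rewrite addr0.
have fh := below_mul fa hc; have gh := below_mul ga hc.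
apply: (@shift_inj (a + c)); [exact: below_mul| |].
  by move=> n nac; rewrite laurent_coefD fh ?gh ?addr0.
have shD p q r : shift r (p + q) = shift r p + shift r q by exact/fpsP.
by rewrite shD !shift_mul// shD mulrDl.
Qed.

Fact laurent_mul1 : left_id (laurentC 1) laurent_mul.
Proof.
move=> f; have [a fa] := laurent_bounded f.
have l0 : below 0 (laurentC 1) by move=> n /=; case: ltgtP.
apply: (@shift_inj (0 + a)); [exact: below_mul|by rewrite add0r|].
rewrite shift_mul// add0r (_ : shift 0 _ = 1) ?mul1r//.
by apply/fpsP => -[|n].
Qed.

Fact laurent_1neq0 : laurentC (1 : R) != 0.
Proof. by apply/eqP => /laurentP /(_ 0) /= /eqP; rewrite oner_eq0. Qed.

HB.instance Definition _ := GRing.Zmodule_isComNzRing.Build (laurent R)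
  laurent_mulA laurent_mulC laurent_mul1 laurent_mulD laurent_1neq0.

Lemma laurent_coefM f g (n : int) :
  (f * g) n = \sum_(m \in [set: int]) f m * g (n - m).
Proof. by []. Qed.

End LaurentRing.

Fact laurentC_is_zmod_morphism (R : zmodType) :
  zmod_morphism (@laurentC R).
Proof. by move=> a b; apply/laurentP => n /=; case: ifP; rewrite ?subr0. Qed.
HB.instance Definition _ (R : zmodType) :=
  GRing.isZmodMorphism.Build R (laurent R) (@laurentC R)
    (@laurentC_is_zmod_morphism R).

(* Operators with coefficients in [F((x))] act on [x^sigma A((x))], whose
   elements are represented by their factor in [A((x))].  The additive map
   [theta] on [A] describes the action of [x d/dx] on [x^sigma A], so that
     [d/dx (x^(sigma + n) v) = x^(sigma + n - 1) (theta v + n v)]. *)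
Section DiffOp.
Variables (F : fieldType) (A : comNzRingType).
Variables (inj : {rmorphism F -> A}) (theta : {additive A -> A}).

Fact dx_bounded (f : laurent A) : exists N : int, forall n,
  n < N -> theta (f (n + 1)) + f (n + 1) *~ (n + 1) = 0.
Proof.
have [N fN] := laurent_bounded f; exists (N - 1) => n nN.
by rewrite fN ?raddf0 ?mul0rz ?addr0// -ltrBrDr.
Qed.
Definition dx (f : laurent A) : laurent A := Laurent (dx_bounded f).

Definition euler (f : laurent A) : laurent A := laurent_monom 1 1 * dx f.

(* [P = (x d/dx - r_1) ... (x d/dx - r_k)] *)
Definition opP (r : seq F) (f : laurent A) : laurent A :=
  foldr (fun c g => euler g - laurentC (inj c) * g) f r.

(* [q] stands for [\sum_j q_j (d/dx)^j]. *)
Definition diffop (q : seq (laurent F)) (f : laurent A) : laurent A :=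
  \sum_(j < size q) laurent_map inj q`_j * iter j dx f.

(* [Q = \sum_(i >= 1) Q_i t^i]; the value [Q 0] is ignored. *)
Definition opQ (Q : nat -> seq (laurent F)) (f : fps (laurent A)) :
    fps (laurent A) :=
  Fps (fun n => \sum_(1 <= i < n.+1) diffop (Q i) (f (n - i)%N)).

End DiffOp.

Notation ratfun K := {fraction {poly K}}.

Definition eps {K : fieldType} : ratfun K := FracField.tofrac 'X.
Definition ratC {K : fieldType} : K -> ratfun K := @FracField.tofrac _ \o polyC.
HB.instance Definition _ (K : fieldType) := GRing.RMorphism.on (@ratC K).
Arguments ratC {K} _ : simpl never.

Definition theta_eps {K : fieldType} (v : ratfun K) : ratfun K := eps * v.

Fact theta_eps_is_zmod_morphism (K : fieldType) :
  zmod_morphism (@theta_eps K).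
Proof. exact: mulrBr. Qed.
HB.instance Definition _ (K : fieldType) :=
  GRing.isZmodMorphism.Build (ratfun K) (ratfun K) (@theta_eps K)
    (@theta_eps_is_zmod_morphism K).

Section Eps.
Variables (F K : fieldType) (iota : {rmorphism F -> K}).

Definition rat_inj : F -> ratfun K := ratC \o iota.
HB.instance Definition _ := GRing.RMorphism.on rat_inj.

Fact opPinv_bounded (r : seq F) (f : laurent (ratfun K)) :
  exists N : int, forall n, n < N ->
    (\prod_(c <- r) (eps + n%:~R - rat_inj c))^-1 * f n = 0.
Proof.
by have [N fN] := laurent_bounded f; exists N => n /fN ->; rewrite mulr0.
Qed.
Definition opPinv (r : seq F) (f : laurent (ratfun K)) : laurent (ratfun K) :=
  Laurent (opPinv_bounded r f).

Definition opPinvQ (r : seq F) (Q : nat -> seq (laurent F))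
    (f : fps (laurent (ratfun K))) : fps (laurent (ratfun K)) :=
  fps_map (opPinv r) (opQ rat_inj theta_eps Q f).

(* [log (1 + P^-1 Q)] applied to [x^eps], divided by [x^eps].  The operator
   [P^-1 Q] raises the order in [t], so that its powers of exponent [m > n] do
   not contribute to the coefficient of [t^n]. *)
Definition log_xeps (r : seq F) (Q : nat -> seq (laurent F)) :
    fps (laurent (ratfun K)) :=
  Fps (fun n => \sum_(1 <= m < n.+1)
    laurentC ((-1) ^+ m.-1 / m%:R) * (iter m (opPinvQ r Q) 1) n).

Definition coef_log_xeps (r : seq F) (Q : nat -> seq (laurent F)) :
    fps (ratfun K) :=
  fps_map (fun f : laurent (ratfun K) => f 0) (log_xeps r Q).

End Eps.

Section Teps.
Variable K : fieldType.
Local Open Scope classical_set_scope.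

(* The term [(c, j, a)] stands for [a (eps - c)^-(j + 1)]. *)
Definition pfrac (p : {poly K}) (u : seq (K * nat * K)) : ratfun K :=
  FracField.tofrac p
  + \sum_(v <- u) ratC v.2 * (eps - ratC v.1.1) ^- v.1.2.+1.

Definition Teps_pfrac (u : seq (K * nat * K)) : ratfun K :=
  \sum_(v <- u) ratC v.2 * eps ^- v.1.2.+1.

Definition Teps (f : ratfun K) : ratfun K :=
  xget 0 [set y | exists p u, f = pfrac p u /\ y = Teps_pfrac u].

End Teps.

(* [Teps] is well defined: every [f] has a partial fraction decomposition, and
   [Teps f] does not depend on the decomposition. *)
Section TepsTheory.
Variable K : fieldType.
Implicit Types (p : {poly K}) (u : seq (K * nat * K)) (f g : ratfun K).
Local Notation tofrac := (@FracField.tofrac {poly K}).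

Let epsB c : eps - ratC c = tofrac ('X - c%:P) :> ratfun K.
Proof. by rewrite tofracB. Qed.

Let epsB_neq0 c : eps - ratC c != 0 :> ratfun K.
Proof. by rewrite epsB tofrac_eq0 polyXsubC_eq0. Qed.

(* [f] is regular at [c], with value [e]. *)
Let reg c f e := exists a b : {poly K},
  [/\ b.[c] != 0, f * tofrac b = tofrac a & a.[c] = e * b.[c]].

Let reg0 c e : reg c 0 e -> e = 0.
Proof.
move=> [a [b [bc]]]; rewrite mul0r => /esym/eqP; rewrite tofrac_eq0 => /eqP ->.
by rewrite horner0 => /esym/eqP; rewrite mulf_eq0 (negPf bc) orbF => /eqP.
Qed.

Let regD c f g d e : reg c f d -> reg c g e -> reg c (f + g) (d + e).
Proof.
move=> [a [b [bc fb ac]]] [a' [b' [bc' gb ac']]].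
exists (a * b' + a' * b), (b * b'); split.
- by rewrite hornerM mulf_neq0.
- by rewrite tofracD !tofracM -fb -gb mulrDl !mulrA [g * _ * _]mulrAC.
- by rewrite hornerD !hornerM ac ac' mulrDl mulrA mulrAC -!mulrA
    [b'.[c] * _]mulrC.
Qed.

Let regM c f g d e : reg c f d -> reg c g e -> reg c (f * g) (d * e).
Proof.
move=> [a [b [bc fb ac]]] [a' [b' [bc' gb ac']]].
exists (a * a'), (b * b'); split.
- by rewrite hornerM mulf_neq0.
- by rewrite !tofracM -fb -gb mulrACA.
- by rewrite !hornerM ac ac' mulrACA.
Qed.

Let reg_poly c p : reg c (tofrac p) p.[c].
Proof.
exists p, 1%:P; rewrite hornerC oner_eq0 mulr1.
by split; rewrite // polyC1 tofrac1 mulr1.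
Qed.

Let reg_exp c f e n : reg c f e -> reg c (f ^+ n) (e ^+ n).
Proof.
move=> fe; elim: n => [|n IHn]; last by rewrite !exprS; apply: regM.
by have := reg_poly c 1; rewrite tofrac1 -polyC1 hornerC.
Qed.

Let reg_inv c d n :
  c != d -> exists e, reg c ((eps - ratC d) ^- n.+1) e.
Proof.
move=> cd; rewrite -exprVn; exists ((c - d)^-1 ^+ n.+1); apply: reg_exp.
exists 1%:P, ('X - d%:P); rewrite hornerXsubC hornerC subr_eq0 cd.
by rewrite mulVf ?subr_eq0// -epsB mulVf ?epsB_neq0 ?polyC1 ?tofrac1.
Qed.

Let weight u (k : K * nat) : K := \sum_(v <- u | v.1 == k) v.2.

Let weightE u (h : K * nat -> ratfun K) :
  \sum_(v <- u) ratC v.2 * h v.1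
  = \sum_(k <- undup [seq v.1 | v <- u]) ratC (weight u k) * h k.
Proof.
under [RHS]eq_bigr do rewrite /weight big_mkcond /= raddf_sum mulr_suml.
rewrite exchange_big /= big_seq_cond [RHS]big_seq_cond.
apply: eq_bigr => v /andP[uv _].
rewrite (bigD1_seq v.1) ?undup_uniq ?mem_undup ?map_f//= eqxx.
rewrite big1 ?addr0// => k /negPf kv.
by rewrite eq_sym kv raddf0 mul0r.
Qed.

Let pfrac0 p u : pfrac p u = 0 -> forall k, weight u k = 0.
Proof.
move=> pu0 [c j]; apply/eqP/negPn/negP => wcj.
pose s := undup [seq v.1 | v <- u].
pose ex := fun i => weight u (c, i) != 0.
have exP : exists i, ex i by exists j.
have [N sN] : exists N, forall k, k \in s -> (k.2 <= N)%N.
  exists (\max_(k <- s) k.2) => k ks.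
  by rewrite (big_rem k)//= leq_maxl.
have exN i : ex i -> (i <= N)%N.
  move=> wi; suff /sN : (c, i) \in s by [].
  rewrite mem_undup; apply: contraR wi => ci; rewrite /weight big1_seq// => v.
  by case/andP => /eqP vc uv; rewrite -vc map_f in ci.
have [m wm mmax] := ex_maxnP exP exN.
have H : reg c ((eps - ratC c) ^+ m.+1 * pfrac p u) (weight u (c, m)).
  rewrite /pfrac (weightE u (fun k => (eps - ratC k.1) ^- k.2.+1)) -/s mulrDr.
  have regX n : reg c ((eps - ratC c) ^+ n.+1) 0.
    have -> : 0 = ('X - c%:P).[c] ^+ n.+1 by rewrite hornerXsubC subrr expr0n.
    by apply: reg_exp; rewrite epsB; apply: reg_poly.
  rewrite mulr_sumr -[weight _ _]add0r; apply: regD.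
    by rewrite -(mul0r p.[c]); apply: regM; [exact: regX|exact: reg_poly].
  have -> : weight u (c, m) =
      \sum_(k <- s) if k == (c, m) then weight u k else 0.
    rewrite (bigD1_seq (c, m)) ?undup_uniq//=.
      by rewrite eqxx big1 ?addr0// => k /negPf ->.
    rewrite mem_undup; apply: contraR wm => ci.
    rewrite /ex /weight big1_seq// => v.
    by case/andP => /eqP vc uv; rewrite -vc map_f in ci.
  apply: (big_ind2 (reg c)).
  - by have := reg_poly c 0; rewrite tofrac0 horner0.
  - by move=> f1 e1 f2 e2; apply: regD.
  move=> [d i] _; rewrite mulrCA /=.
  have regC (a : K) f e : reg c f e -> reg c (ratC a * f) (a * e).
    by move=> fe; apply: regM => //; rewrite -[a in reg c _ a](hornerC a c);
      apply: reg_poly.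
  have [/eqP[-> ->]|] := ifPn.
    rewrite -[X in reg c _ X]mulr1; apply: regC; rewrite mulfV ?expf_neq0//.
    by have := reg_poly c 1; rewrite tofrac1 -polyC1 hornerC.
  have [<-{d}|dc _] := eqVneq c d; last first.
    have [e he] := reg_inv i dc.
    by rewrite -(mulr0 (weight u (d, i))) -(mul0r e); apply/regC/regM.
  have [im|mi|->] := ltngtP i m; last by rewrite eqxx.
  - rewrite -(mulr0 (weight u (c, i))) => _; apply: regC.
    have -> : m.+1 = ((m - i.+1).+1 + i.+1)%N by rewrite addSn subnK.
    by rewrite exprD mulfK ?expf_neq0//; apply: regX.
  - have [/mmax|/negPn/eqP -> _] := boolP (ex i); first by rewrite leqNgt mi.
    rewrite rmorph0 mul0r.
    by have := reg_poly c 0; rewrite tofrac0 horner0.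
by move: H wm; rewrite pu0 mulr0 /ex => /reg0 ->; rewrite eqxx.
Qed.

Let opp_terms u := [seq (v.1, - v.2) | v <- u].

Let pfracB p p' u u' :
  pfrac p u - pfrac p' u' = pfrac (p - p') (u ++ opp_terms u').
Proof.
rewrite /pfrac big_cat big_map /= tofracB opprD addrACA -sumrN.
by congr (_ + (_ + _)); apply: eq_bigr => v _; rewrite raddfN mulNr.
Qed.

Let Teps_pfracB u u' :
  Teps_pfrac u - Teps_pfrac u' = Teps_pfrac (u ++ opp_terms u').
Proof.
rewrite /Teps_pfrac big_cat big_map /= -sumrN.
by congr (_ + _); apply: eq_bigr => v _; rewrite raddfN mulNr.
Qed.

Lemma Teps_pfracE p u : Teps (pfrac p u) = Teps_pfrac u.
Proof.
apply: xget_unique; first by exists p, u.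
move=> y [p' [u' [puu' ->]]]; apply/eqP; rewrite -subr_eq0 Teps_pfracB.
have /pfrac0 w0 : pfrac (p' - p) (u' ++ opp_terms u) = 0.
  by rewrite -pfracB puu' subrr.
rewrite /Teps_pfrac (weightE _ (fun k => eps ^- k.2.+1)) big1// => k _.
by rewrite w0 rmorph0 mul0r.
Qed.

End TepsTheory.

Lemma pfrac_surj (K : closedFieldType) (f : ratfun K) :
  exists p u, f = pfrac p u.
Proof.
pose PF (g : ratfun K) := exists p u, g = pfrac p u.
have PFD g h : PF g -> PF h -> PF (g + h).
  move=> [p [u ->]] [q [v ->]]; exists (p + q), (u ++ v).
  by rewrite /pfrac big_cat tofracD addrACA.
have PFZ a g : PF g -> PF (ratC a * g).
  move=> [p [u ->]]; exists (a%:P * p), [seq (v.1, a * v.2) | v <- u].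
  rewrite /pfrac big_map tofracM mulrDr mulr_sumr; congr (_ + _).
  by apply: eq_bigr => v _; rewrite /= rmorphM mulrA.
have PFp p : PF (FracField.tofrac p).
  by exists p, [::]; rewrite /pfrac big_nil addr0.
have PFt c j : PF ((eps - ratC c) ^- j.+1).
  exists 0, [:: (c, j, 1)]; rewrite /pfrac big_seq1 /=.
  by rewrite rmorph1 mul1r tofrac0 add0r.
have epsB c : eps - ratC c = FracField.tofrac ('X - c%:P) :> ratfun K.
  by rewrite tofracB.
have epsB_neq0 c : eps - ratC c != 0 :> ratfun K.
  by rewrite epsB tofrac_eq0 polyXsubC_eq0.
have PFtt c d j : PF ((eps - ratC d) ^- j.+1 / (eps - ratC c)).
  have [->|dc] := eqVneq d c.
    by rewrite -invfM -exprSr; apply: PFt.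
  have dc0 : ratC (d - c) != 0 :> ratfun K.
    by rewrite tofrac_eq0 polyC_eq0 subr_eq0.
  have E : (eps - ratC d)^-1 / (eps - ratC c) =
      ratC (d - c)^-1 * ((eps - ratC d)^-1 - (eps - ratC c)^-1).
    rewrite fmorphV; apply: (mulfI dc0); rewrite mulVKf//.
    have -> : ratC (d - c) = (eps - ratC c) - (eps - ratC d) :> ratfun K.
      by rewrite opprB [RHS]addrC subrKA rmorphB.
    by rewrite mulrBl [X in X - _]mulrCA !(mulfV, mulVKf) ?epsB_neq0 ?mulr1.
  elim: j => [|j IHj].
    rewrite expr1 E; apply: (PFZ); apply: PFD; first exact: (PFt _ 0).
    by rewrite -mulN1r -(rmorphN1 ratC); apply/PFZ/(PFt _ 0).
  rewrite [_ ^+ j.+2]exprSr invfM -mulrA E mulrCA mulrBr -invfM -exprSr.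
  apply: (PFZ); apply: PFD; first exact: PFt.
  by rewrite -mulN1r -(rmorphN1 ratC); apply: PFZ.
have PFX c g : PF g -> PF (g / (eps - ratC c)).
  move=> [p [u ->]]; rewrite /pfrac mulrDl; apply: (PFD).
    rewrite (divp_eq p ('X - c%:P)) modp_XsubC tofracD tofracM -epsB mulrDl.
    rewrite mulfK ?epsB_neq0//; apply: (PFD) => //.
    by apply: PFZ; apply: (PFt _ 0).
  rewrite mulr_suml; apply: (big_ind PF) => [||v _].
  - by rewrite -tofrac0; exact: (PFp 0).
  - exact PFD.
  - by rewrite -mulrA; apply: (PFZ); apply: PFtt.
suff PFpq (p q : {poly K}) :
    q != 0 -> PF (FracField.tofrac p / FracField.tofrac q).
  elim/quotW: f => x; have d0 := denom_ratioP x.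
  suff -> : \pi_(ratfun K)%qT x =
      FracField.tofrac \n_x / FracField.tofrac \d_x :> ratfun K by exact: PFpq.
  apply: (canRL (mulfK _)); first by rewrite tofrac_eq0.
  unlock FracField.tofrac; rewrite -[LHS]FracField.pi_mul.
  apply/eqmodP; rewrite /= FracField.equivfE /FracField.mulf.
  by rewrite !numden_Ratio ?mulf_neq0 ?oner_eq0// !mulr1 mulrC.
move=> q0; have [s qE] := closed_field_poly_normal q.
have a0 : lead_coef q != 0 by rewrite lead_coef_eq0.
have aE : (FracField.tofrac (lead_coef q)%:P)^-1 = ratC (lead_coef q)^-1.
  by rewrite fmorphV.
rewrite qE -mul_polyC tofracM invfM mulrCA aE.
apply: (PFZ); elim: s {qE} => [|c s IHs].
  by rewrite big_nil tofrac1 invr1 mulr1.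
by rewrite big_cons tofracM invfM mulrCA mulrC -epsB; apply: PFX.
Qed.

Definition congrZ (F : fieldType) (x y : F) : Prop :=
  exists m : int, x - y = m%:~R.

(* [s] enumerates the smallest elements of the classes of [r] modulo [Z]. *)
Definition smallest_reps (F : fieldType) (r : seq F) (l : nat) (s : 'I_l -> F) :
    Prop :=
  [/\ forall i, s i \in r,
      forall i j, congrZ (s i) (s j) -> i = j &
      forall c, c \in r -> exists i (m : nat), c = s i + m%:R].

Definition class_size (F : fieldType) (r : seq F) (s : F) : nat :=
  count (fun c => `[< congrZ c s >]) r.

(* In [{poly F}], the variable stands for [log x]. *)
Definition theta_log (F : fieldType) (s : F) (p : {poly F}) : {poly F} :=
  s *: p + p^`().

Fact theta_log_is_zmod_morphism (F : fieldType) (s : F) :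
  zmod_morphism (theta_log s).
Proof.
by move=> p q; rewrite /theta_log scalerBr derivB opprD addrACA.
Qed.
HB.instance Definition _ (F : fieldType) (s : F) :=
  GRing.isZmodMorphism.Build {poly F} {poly F} (theta_log s)
    (@theta_log_is_zmod_morphism F s).

(* [f] represents [x^s f]; the first condition says that the coefficient of each
   power of [t] is in [F((x))[log x]], inside [F[log x]((x))]. *)
Definition solution (F : fieldType) (r : seq F) (Q : nat -> seq (laurent F))
    (s : F) (f : fps (laurent {poly F})) : Prop :=
  (forall n, exists d, forall m, size (f n m) <= d)%N /\
  fps_map (opP polyC (theta_log s) r) f + opQ polyC (theta_log s) Q f = 0.

Section Exponents.
Variables (F K : fieldType) (iota : {rmorphism F -> K}) (L : nat).

(* [K((u))], with [u = t^(1/L)], acts on [K[log x]((x))((u))]. *)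
Definition scal (c : laurent K) (h : laurent (laurent {poly K})) :
    laurent (laurent {poly K}) :=
  laurent_map (@laurentC _ \o polyC) c * h.

(* From [F[log x]((x))[[t]]] to [K[log x]((x))((u))] *)
Definition base_change (f : fps (laurent {poly F})) :
    laurent (laurent {poly K}) :=
  laurent_of_fps (fps_ramify L (fps_map (laurent_map (map_poly iota)) f)).

(* The extension of scalars of a [F[[t]]]-submodule [M] of
   [F[log x]((x))[[t]]], identified with its image in [K[log x]((x))((u))]. *)
Definition ext_scalars (M : fps (laurent {poly F}) -> Prop)
    (h : laurent (laurent {poly K})) : Prop :=
  exists (n : nat) (c : 'I_n -> laurent K) (f : 'I_n -> fps (laurent {poly F})),
    (forall a, M (f a)) /\ h = \sum_a scal (c a) (base_change (f a)).

Definition is_basis (V : laurent (laurent {poly K}) -> Prop) (n : nat)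
    (b : 'I_n -> laurent (laurent {poly K})) : Prop :=
  (forall c : 'I_n -> laurent K,
     \sum_j scal (c j) (b j) = 0 -> forall j, c j = 0) /\
  (forall h, V h <-> exists c : 'I_n -> laurent K, h = \sum_j scal (c j) (b j)).

(* [x^lambda = \sum_m lambda^m (log x)^m / m!] *)
Definition xpow (lambda : fps K) : fps {poly K} :=
  fps_exp (fps_map (fun c => c *: 'X) lambda).

(* [lambda] is the family of exponents in [u K[[u]]] attached to the class of
   [s], of cardinal [n], for the operator [P + Q]. *)
Definition class_exponents (r : seq F) (Q : nat -> seq (laurent F)) (s : F)
    (n : nat) (lambda : 'I_n -> fps K) : Prop :=
  (forall j, lambda j 0%N = 0) /\
  exists g : 'I_n -> fps (laurent {poly K}),
    (forall j a m, size (g j a m) <= n)%N /\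
    is_basis (ext_scalars (solution r Q s))
      (fun j => laurent_of_fps
                  (fps_map (@laurentC _) (xpow (lambda j)) * g j)).

End Exponents.

(* Main.v *)
(** The matrix of [D_log] on the solutions attached to the class of [s_i] is the
    monodromy.  Its characteristic polynomial is the product of the
    [X - lambda_(i, j)], because after extension of scalars the basis
    [x^(s_i + lambda_(i, j)) g_(i, j)] consists of generalized eigenvectors of
    [D_log].  Both sides of the identity are therefore compared with the product
    over [i] of these characteristic polynomials.

    The operator [T_eps] adds up the polar parts at [eps = 0] of the translates
    by all [c].  Modulo [t^(N + 1)], only [c = s_i + n] with [n] in a finite window
    contribute, and the translate by [s_i + n] of the coefficient of [x^eps] is
    the diagonal entry of index [n] of [log (1 + P^-1 Q)] on
    [x^(s_i + eps + Z)].  Thus [T_eps] gives the polar parts of the traces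
    of logarithms of window matrices, and [exp tr log = det].  The
    window matrix [A] of [P + Q] and [eps - D], with [D] the monodromy of the
    truncated operator, have the same Fitting ideal over the series regular at
    [eps = 0], so that [det A] is [char_poly D] up to a regular factor.  A series
    with constant term [1] that is both polar and regular is [1], which turns
    this into the equality of [eps^k exp (polar part)] and [char_poly D]. *)

Require Import Defs.
From HB Require Import structures.
From mathcomp Require Import all_boot all_order all_fingroup all_algebra.
From mathcomp Require Import boolp classical_sets functions fsbigop zify.

Set Implicit Arguments.
Unset Strict Implicit.
Unset Printing Implicit Defensive.

Import Order.TTheory GRing.Theory Num.Theory.

Local Open Scope ring_scope.

(** * Power series and Laurent series *)

(** The infinite matrix of [P + Q] has no determinant to speak of: the [Q_i] may raise exponents
    without limit, and only the amount by which they lower them is bounded. If [Q_1, ..., Q_N] lower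
    exponents by at most [b], an error made at the upper edge of a window [|n| <= B] has descended
    by at most [j b] in the coefficient of [t^j]. When all exponents lie in [|n| <= M], taking
    [B = M + 2 N b] leaves a core [|n| <= B - N b] where the diagonal of [log (1 + P^-1 Q)] is
    exact; outside the core it is regular, no exponent being within [N b]. The identity with the
    monodromy is exact for the truncated operator, and truncation is undone one coefficient of [t]
    at a time.

    Of the Fitting ideals, the proof uses the inclusion [char_poly D = det A * U] with [U] regular;
    the value of the total regular factor is then forced, because [eps^-k char_poly D] is polar with
    constant term 1, by nilpotency of [D] at [t = 0]. The monodromy is built over [F[[t]]], where
    the monic polynomial of the last claim is found; the ramification [t = u^L] enters only when the
    exponents are compared with it. *)

Section FpsCoef.
Variable R : zmodType.

Lemma fps_coef_sum (I : Type) (r : seq I) (P : pred I) (f : I -> fps R) n :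
  (\sum_(i <- r | P i) f i) n = \sum_(i <- r | P i) f i n.
Proof. by elim/big_rec2: _ => // i x y _ <-. Qed.

Lemma fps_coefB (f g : fps R) n : (f - g) n = f n - g n.
Proof. by []. Qed.

Definition vanish (N : nat) (f : fps R) := forall n, (n < N)%N -> f n = 0.

Lemma vanishD N f g : vanish N f -> vanish N g -> vanish N (f + g).
Proof. by move=> fN gN n nN; rewrite fps_coefD fN ?gN ?addr0. Qed.

Lemma vanish_sum N (I : Type) (r : seq I) (P : pred I) (f : I -> fps R) :
  (forall i, P i -> vanish N (f i)) -> vanish N (\sum_(i <- r | P i) f i).
Proof.
by move=> fN; elim/big_ind: _ => [//|f1 f2|i /fN//]; apply: vanishD.
Qed.

End FpsCoef.

Section FpsRing.
Variable R : comNzRingType.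
Implicit Types f g : fps R.

Lemma vanishM M N f g : vanish M f -> vanish N g -> vanish (M + N) (f * g).
Proof.
move=> fM gN n nMN; rewrite fps_coefM big1// => i _.
have [/fM ->|Mi] := ltnP i M; first by rewrite mul0r.
by rewrite gN ?mulr0//; have := ltn_ord i; lia.
Qed.

Lemma vanishMl N f g : vanish N f -> vanish N (f * g).
Proof. by move=> fN; rewrite -[N]addn0; apply: vanishM. Qed.

Lemma vanishMr N f g : vanish N g -> vanish N (f * g).
Proof. by rewrite mulrC; apply: vanishMl. Qed.

Lemma vanishX f n : f 0%N = 0 -> vanish n (f ^+ n).
Proof.
move=> f0; elim: n => [//|n IHn]; rewrite exprS -add1n.
by apply: vanishM => // -[].
Qed.

Lemma fps_coefM0 f g : (f * g) 0%N = f 0%N * g 0%N.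
Proof. by rewrite fps_coefM big_ord1. Qed.

Lemma fpsCE (c : R) n : fpsC c n = c *+ (n == 0%N).
Proof. by case: n. Qed.

Fact fpsC_zmod : zmod_morphism (@fpsC R).
Proof. by move=> a b; apply/fpsP => -[|n] //=; rewrite subr0. Qed.
HB.instance Definition _ :=
  GRing.isZmodMorphism.Build R (fps R) (@fpsC R) fpsC_zmod.

Lemma fps_coefCM (c : R) f n : (fpsC c * f) n = c * f n.
Proof.
rewrite fps_coefM big_ord_recl /= subn0 big1 ?addr0// => i _.
by rewrite mul0r.
Qed.

Fact fpsC_monoid : monoid_morphism (@fpsC R).
Proof.
split=> [//|a b]; apply/fpsP => n; rewrite fps_coefCM !fpsCE mulrnAr.
by [].
Qed.
HB.instance Definition _ :=
  GRing.isMonoidMorphism.Build R (fps R) (@fpsC R) fpsC_monoid.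

Lemma fps_coef_nat (m n : nat) : (m%:R : fps R) n = m%:R *+ (n == 0%N).
Proof. by rewrite -(rmorph_nat (@fpsC R)) fpsCE. Qed.

Definition cst_coef f : R := f 0%N.
Fact cst_coef_zmod : zmod_morphism cst_coef. Proof. by []. Qed.
Fact cst_coef_monoid : monoid_morphism cst_coef.
Proof. by split=> // f g; apply: fps_coefM0. Qed.
HB.instance Definition _ :=
  GRing.isZmodMorphism.Build (fps R) R cst_coef cst_coef_zmod.
HB.instance Definition _ :=
  GRing.isMonoidMorphism.Build (fps R) R cst_coef cst_coef_monoid.

End FpsRing.

Section FpsMorphisms.

Fact fps_map_zmod (R S : zmodType) (h : {additive R -> S}) :
  zmod_morphism (fps_map h).
Proof. by move=> f g; apply/fpsP => n /=; rewrite raddfB. Qed.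
HB.instance Definition _ (R S : zmodType) (h : {additive R -> S}) :=
  GRing.isZmodMorphism.Build (fps R) (fps S) (fps_map h) (fps_map_zmod h).

Variables (R S : comNzRingType) (h : {rmorphism R -> S}).

Lemma fps_mapC c : fps_map h (fpsC c) = fpsC (h c).
Proof. by apply/fpsP => -[|n] //=; rewrite rmorph0. Qed.

Fact fps_map_monoid : monoid_morphism (fps_map h).
Proof.
split=> [|f g]; first by rewrite fps_mapC rmorph1.
apply/fpsP => n /=; rewrite rmorph_sum; apply: eq_bigr => i _.
by rewrite rmorphM.
Qed.
HB.instance Definition _ :=
  GRing.isMonoidMorphism.Build (fps R) (fps S) (fps_map h) fps_map_monoid.

End FpsMorphisms.

Section Ramify.
Variables (R : comNzRingType) (L : nat).

Fact fps_ramify_zmod : zmod_morphism (@fps_ramify R L).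
Proof. by move=> f g; apply/fpsP => n /=; case: ifP; rewrite ?subr0. Qed.
HB.instance Definition _ :=
  GRing.isZmodMorphism.Build (fps R) (fps R) (@fps_ramify R L) fps_ramify_zmod.

Hypothesis L_gt0 : (0 < L)%N.

Lemma fps_ramifyC c : fps_ramify L (fpsC c) = fpsC c :> fps R.
Proof.
apply/fpsP => n; rewrite -[LHS]/(if _ then fpsC c (n %/ L)%N else 0) !fpsCE.
case: ifPn => [/dvdnP[q ->]|].
  by rewrite mulnK// muln_eq0 (gtn_eqF L_gt0) orbF.
by case: n => //; rewrite dvdn0.
Qed.

Lemma fps_ramifyM (f g : fps R) :
  fps_ramify L (f * g) = fps_ramify L f * fps_ramify L g.
Proof.
apply/fpsP => n; rewrite fps_coefM /=.
rewrite (eq_bigr (fun i : 'I_n.+1 => if (L %| i)%N then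
    f (i %/ L)%N * (if (L %| n - i)%N then g ((n - i) %/ L)%N else 0) else 0));
  last by move=> i _; case: ifP; rewrite ?mul0r.
rewrite -big_mkcondr /=.
case: ifPn => [/dvdnP[q ->]|Ln]; last first.
  rewrite big1// => i Li; have iN : (i <= n)%N by rewrite -ltnS.
  rewrite ifN ?mulr0//; apply: contra Ln => Lni.
  by rewrite -(subnK iN) dvdn_add.
rewrite mulnK// (reindex_onto (fun j : 'I_q.+1 => inord (j * L) : 'I_(q * L).+1)
  (fun i => inord (i %/ L))) /=; last first.
  move=> i Li; have iq : (i %/ L < q.+1)%N.
    by rewrite ltnS leq_divLR// -ltnS ltn_ord.
  by apply/val_inj; rewrite /= (inordK iq) divnK// inordK ?ltn_ord.
have jL (j : 'I_q.+1) : (j * L < (q * L).+1)%N.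
  by rewrite ltnS leq_mul2r -ltnS ltn_ord orbT.
apply: eq_big => j /=.
  rewrite !inordK// dvdn_mull//= mulnK//; apply/esym/eqP/val_inj.
  by rewrite /= inordK.
by move=> _; rewrite !inordK// -mulnBl dvdn_mull// !mulnK.
Qed.

Fact fps_ramify_monoid : monoid_morphism (@fps_ramify R L).
Proof. by split; [exact: fps_ramifyC|exact: fps_ramifyM]. Qed.

End Ramify.

(** The proof of [L > 0] is an argument so that the ring morphism instance, which relies on it, can
    be inferred from the term. *)
Definition ramify_rm (R : comNzRingType) (L : nat) (L_gt0 : (0 < L)%N) :
  fps R -> fps R := @fps_ramify R L.
HB.instance Definition _ (R : comNzRingType) L (L_gt0 : (0 < L)%N) :=
  GRing.isZmodMorphism.Build (fps R) (fps R) (@ramify_rm R L L_gt0)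
    (@fps_ramify_zmod R L).
HB.instance Definition _ (R : comNzRingType) L (L_gt0 : (0 < L)%N) :=
  GRing.isMonoidMorphism.Build (fps R) (fps R) (@ramify_rm R L L_gt0)
    (fps_ramify_monoid R L_gt0).

Section LaurentMorphisms.
Variable R : comNzRingType.
Implicit Types f g : laurent R.
Local Open Scope classical_set_scope.

Lemma laurent_coef_sum (I : Type) (r : seq I) (P : pred I)
    (f : I -> laurent R) n :
  (\sum_(i <- r | P i) f i) n = \sum_(i <- r | P i) f i n.
Proof. by elim/big_rec2: _ => // i x y _ <-. Qed.

(** Replaces the sum over all integers by one over [W] consecutive indices. Any window will do as
    long as the terms outside it vanish; [W = 0] serves to show that a coefficient is zero. *)
Lemma laurent_coefM_window f g (lo : int) (W : nat) n :
  (forall m : int, (m < lo) || (lo + W%:Z <= m) -> f m * g (n - m) = 0) ->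
  (f * g) n = \sum_(i < W) f (lo + i%:Z) * g (n - (lo + i%:Z)).
Proof.
move=> fg0; rewrite laurent_coefM (fsbigE [seq lo + i%:Z | i <- iota 0 W]).
- rewrite big_map -[W in iota 0 W]subn0 -/(index_iota 0 W) big_mkord.
  by under eq_bigl do rewrite in_setT.
- by rewrite map_inj_uniq ?iota_uniq// => i j /addrI [].
- by [].
move=> m _ mW; apply: fg0; apply: contraR mW; rewrite negb_or -leNgt -ltNge.
move=> /andP[lom mW]; apply/mapP; exists `|m - lo|%N; last first.
  by rewrite gez0_abs ?subr_ge0// addrCA subrr addr0.
by rewrite mem_iota /= add0n -ltz_nat gez0_abs ?subr_ge0// ltrBlDl.
Qed.

Fact laurentC_monoid : monoid_morphism (@laurentC R).
Proof.
split=> // a b; apply/laurentP => n.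
rewrite (@laurent_coefM_window _ _ 0 1).
  by rewrite big_ord1 addr0 subr0 /=; case: (n == 0); rewrite ?mulr0.
by move=> m /=; case: eqVneq => [->|_]; rewrite ?mul0r.
Qed.
HB.instance Definition _ :=
  GRing.isMonoidMorphism.Build R (laurent R) (@laurentC R) laurentC_monoid.

Lemma laurent_coefCM c f n : (laurentC c * f) n = c * f n.
Proof.
rewrite (@laurent_coefM_window _ _ 0 1); first by rewrite big_ord1 addr0 subr0.
by move=> m /=; case: eqVneq => [->|_]; rewrite ?mul0r.
Qed.

Lemma laurent_coef_monomM c a f n : (laurent_monom c a * f) n = c * f (n - a).
Proof.
rewrite (@laurent_coefM_window _ _ a 1); first by rewrite big_ord1 addr0 /= eqxx.
move=> m /=; case: eqVneq => [->|_]; last by rewrite mul0r.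
by rewrite ltxx/= leNgt ltrDl.
Qed.

Fact laurent_of_fps_zmod : zmod_morphism (@laurent_of_fps R).
Proof. by move=> f g; apply/laurentP => -[n|n] //=; rewrite subr0. Qed.
HB.instance Definition _ :=
  GRing.isZmodMorphism.Build (fps R) (laurent R) (@laurent_of_fps R)
    laurent_of_fps_zmod.

Fact laurent_of_fps_monoid : monoid_morphism (@laurent_of_fps R).
Proof.
split=> [|f g]; first by apply/laurentP => -[[|n]|n].
apply/laurentP => n; case: n => n.
  rewrite (@laurent_coefM_window _ _ 0 n.+1).
    apply: eq_bigr => i _ /=.
    by rewrite add0r /= subzn // -ltnS.
  move=> [m|m] /=; rewrite ?mul0r// add0r lez_nat => nm.
  have -> : n%:Z - m%:Z = Negz (m - n).-1.
    by rewrite NegzE prednK ?subn_gt0// -subzn ?opprB// ltnW.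
  exact: mulr0.
rewrite (@laurent_coefM_window _ _ 0 0) ?big_ord0// => -[m|m] _ /=.
  have -> : Negz n - m%:Z = Negz (n + m) by rewrite !NegzE -opprD -PoszD addSn.
  exact: mulr0.
exact: mul0r.
Qed.
HB.instance Definition _ :=
  GRing.isMonoidMorphism.Build (fps R) (laurent R) (@laurent_of_fps R)
    laurent_of_fps_monoid.

Lemma laurent_of_fps_inj : injective (@laurent_of_fps R).
Proof. by move=> f g /laurentP fg; apply/fpsP => n; apply: (fg n%:Z). Qed.

End LaurentMorphisms.

Fact laurent_map_zmod (R S : zmodType) (h : {additive R -> S}) :
  zmod_morphism (laurent_map h).
Proof. by move=> f g; apply/laurentP => n /=; rewrite raddfB. Qed.
HB.instance Definition _ (R S : zmodType) (h : {additive R -> S}) :=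
  GRing.isZmodMorphism.Build (laurent R) (laurent S) (laurent_map h)
    (laurent_map_zmod h).

Section LaurentMap.
Variables (R S : comNzRingType) (h : {rmorphism R -> S}).

Lemma laurent_mapC c : laurent_map h (laurentC c) = laurentC (h c).
Proof. by apply/laurentP => n /=; case: (n == 0) => //; rewrite rmorph0. Qed.

Fact laurent_map_monoid : monoid_morphism (laurent_map h).
Proof.
split=> [|f g]; first by rewrite -[1]/(laurentC 1) laurent_mapC rmorph1.
apply/laurentP => n; rewrite -[LHS]/(h ((f * g) n)).
have [a fa] := laurent_bounded f; have [b gb] := laurent_bounded g.
have fg0 m : (m < a) || (a + (absz (n - b - a)%R).+1%:Z <= m) -> f m = 0 \/ g (n - m) = 0.
  move=> /orP[/fa|am]; [by left|right]; apply: gb.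
  rewrite ltrBlDr -ltrBlDl; apply: lt_le_trans am; rewrite -ltrBlDl.
  by lia.
rewrite !(@laurent_coefM_window _ _ _ a (absz (n - b - a)%R).+1).
- by rewrite rmorph_sum; apply: eq_bigr => i _; rewrite rmorphM.
- by move=> m /fg0[] /= ->; rewrite rmorph0 ?mul0r ?mulr0.
- by move=> m /fg0[] ->; rewrite ?mul0r ?mulr0.
Qed.
HB.instance Definition _ :=
  GRing.isMonoidMorphism.Build (laurent R) (laurent S) (laurent_map h)
    laurent_map_monoid.

End LaurentMap.

(** * Exponentials, traces and determinants *)

Section Derivation.
Variables (A : comNzRingType) (D : {additive A -> A}).
Hypothesis DM : forall x y, D (x * y) = D x * y + x * D y.

Lemma derivation1 : D 1 = 0.
Proof. by have := DM 1 1; rewrite !mulr1 mul1r => /eqP; rewrite eq_sym -subr_eq0 addrK => /eqP. Qed.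

Lemma derivationX x n : D (x ^+ n.+1) = D x * x ^+ n *+ n.+1.
Proof.
elim: n => [|n IHn]; first by rewrite expr0 mulr1.
by rewrite exprS DM IHn mulrnAr mulrCA -exprS [in RHS]mulrS.
Qed.

Lemma derivation_prod (I : finType) (P : pred I) (f : I -> A) :
  D (\prod_(i | P i) f i) =
  \sum_(i | P i) D (f i) * \prod_(j | P j && (j != i)) f j.
Proof.
have [m] := ubnP #|P|; elim: m P => // m IHm P; rewrite ltnS => Pm.
have [i Pi|P0] := pickP P; last by rewrite !big_pred0// derivation1.
rewrite (bigD1 i Pi)/= DM [RHS](bigD1 i Pi)/= IHm; last first.
  have -> : #|[pred j | P j & j != i]| = #|[predD1 P & i]|.
    by apply: eq_card => j; rewrite !inE andbC.
  by apply: leq_trans Pm; rewrite [X in (_ < X)%N](cardD1 i) [i \in _]Pi ltnS.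
congr (_ + _); rewrite mulr_sumr; apply: eq_bigr => j /andP[Pj ji].
rewrite [in RHS](bigD1 i)/=; last by rewrite Pi eq_sym.
rewrite mulrCA; congr (_ * (_ * _)).
by apply: eq_bigl => j'; rewrite -!andbA [X in _ && X]andbC.
Qed.

(** Jacobi's formula for an arbitrary derivation. The Leibniz rule differentiates one row at a time;
    in the expansion along that row the cofactors are those of [M], since they do not involve it. *)
Lemma derivation_det n (M : 'M[A]_n) : D (\det M) = \tr (\adj M *m map_mx D M).
Proof.
pose Mi (i : 'I_n) := \matrix_(i', j) if i' == i then D (M i' j) else M i' j.
transitivity (\sum_i \det (Mi i)).
  rewrite raddf_sum exchange_big /=; apply: eq_bigr => s _.
  rewrite DM; have -> : D ((-1) ^+ odd_perm s) = 0.
    by case: (odd_perm s); rewrite ?expr0 ?expr1 ?raddfN derivation1 ?oppr0.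
  rewrite mul0r add0r derivation_prod mulr_sumr; apply: eq_bigr => i _.
  rewrite [in RHS](bigD1 i)//= mxE eqxx; congr (_ * (_ * _)).
  by apply: eq_bigr => j ji; rewrite mxE (negPf ji).
have -> : \tr (\adj M *m map_mx D M) = \sum_j \sum_i D (M i j) * cofactor M i j.
  rewrite /mxtrace; apply: eq_bigr => j _; rewrite mxE.
  by apply: eq_bigr => i _; rewrite !mxE mulrC.
rewrite [RHS]exchange_big /=; apply: eq_bigr => i _.
rewrite (expand_det_row _ i); apply: eq_bigr => j _; rewrite mxE eqxx.
congr (_ * (_ * \det _)); apply/matrixP => i' j'; rewrite !mxE.
by rewrite eq_sym (negPf (neq_lift _ _)).
Qed.

(** [M] and its derivative need not commute: it is the cyclicity of the trace that makes the [m + 1]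
    terms of the Leibniz rule equal. *)
Lemma derivation_tr_expr n (M : 'M[A]_n.+1) m :
  D (\tr (M ^+ m.+1)) = \tr (M ^+ m * map_mx D M) *+ m.+1.
Proof.
have DMx (B C : 'M[A]_n.+1) : map_mx D (B * C) = map_mx D B * C + B * map_mx D C.
  apply/matrixP => i j; rewrite !mxE raddf_sum -big_split /=.
  by apply: eq_bigr => k _; rewrite !mxE DM.
have -> B : D (\tr B) = \tr (map_mx D B :> 'M_n.+1).
  by rewrite raddf_sum; apply: eq_bigr => i _; rewrite mxE.
elim: m => [|m IHm]; first by rewrite expr0 mul1r.
rewrite exprS DMx mxtraceD; rewrite -[X in _ + X]/(\tr (M *m _)).
(* The right factor [B] stays free because the induction moves a factor [M] into it. *)
have E B : \tr (map_mx D (M ^+ m.+1) * B) =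
  \sum_(k < m.+1) \tr (M ^+ k * map_mx D M * M ^+ (m - k) * B).
  elim: m {IHm} => [|m IHm] in B *.
    by rewrite big_ord1 !expr0 mul1r mulr1.
  rewrite [in LHS]exprSr DMx mulrDl mxtraceD -mulrA IHm [RHS]big_ord_recr /= subnn.
  rewrite expr0 mulr1; congr (_ + _); apply: eq_bigr => k _.
  by rewrite subSn -1?ltnS// exprSr !mulrA.
have cyc (B C : 'M[A]_n.+1) : \tr (B * C) = \tr (C * B) by apply: mxtrace_mulC.
rewrite -[X in _ + X]/(\tr (M * _)) cyc E.
rewrite (eq_bigr (fun=> \tr (M ^+ m.+1 * map_mx D M))); last first.
  move=> k _; rewrite -!mulrA -exprSr cyc -mulrA -exprD cyc; congr (\tr (_ ^+ _ * _)).
  by rewrite addSn subnK -1?ltnS.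
by rewrite sumr_const card_ord cyc -mulrS.
Qed.

End Derivation.

Section FpsExp.
Variable R : comUnitRingType.
Hypothesis Rchar0 : forall n, n.+1%:R \is a @GRing.unit R.
Implicit Types f g y z : fps R.

Let fact_unit m : (m`!)%:R \is a @GRing.unit R.
Proof. by case: (m`!) (fact_gt0 m) => // n _. Qed.

Lemma fps_exp0 f : fps_exp f 0%N = 1.
Proof. by rewrite /= big_ord1 expr0 fact0 invr1 mulr1. Qed.

Definition exp_upto M f := \sum_(m < M) f ^+ m * fpsC (m`!%:R^-1).

Lemma exp_uptoE M f n : f 0%N = 0 -> (n < M)%N -> fps_exp f n = exp_upto M f n.
Proof.
move=> f0 nM; rewrite -[LHS]/(\sum_(m < n.+1) (f ^+ m) n / m`!%:R) fps_coef_sum.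
rewrite (big_ord_widen _ (fun m => (f ^+ m) n / m`!%:R) nM).
rewrite big_mkcond; apply: eq_bigr => m _; rewrite [f ^+ m * _]mulrC fps_coefCM [RHS]mulrC.
by case: ltnP => // nm; rewrite vanishX// mul0r.
Qed.

(** Truncated exponentials satisfy the identity with one term lost, and a derivation that respects
    the order of vanishing passes to the limit. This serves both for [t d/dt] and for the derivation
    in [log x] applied to each coefficient. *)
Lemma fps_exp_derivation (D : {additive fps R -> fps R}) f :
  (forall x y, D (x * y) = D x * y + x * D y) ->
  (forall N g, vanish N g -> vanish N (D g)) ->
  f 0%N = 0 -> D (fps_exp f) = D f * fps_exp f.
Proof.
move=> DM Dv f0; apply/fpsP => n.
have DC m : D (fpsC (m`!%:R^-1)) = 0.
  have := DM (fpsC m`!%:R^-1) (fpsC m`!%:R).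
  rewrite -rmorphM mulVr// rmorph1 derivation1//.
  have -> : D (fpsC m`!%:R) = 0.
    by rewrite rmorph_nat raddfMn derivation1 ?mul0rn.
  rewrite mulr0 addr0 => /(congr1 (fun z => z * fpsC m`!%:R^-1)).
  by rewrite mul0r -mulrA -rmorphM mulrV// rmorph1 mulr1.
have E M g : D (exp_upto M.+1 g) = D g * exp_upto M g.
  rewrite /exp_upto raddf_sum big_ord_recl /= expr0 mul1r DC add0r mulr_sumr.
  apply: eq_bigr => m _; rewrite DM DC mulr0 addr0 derivationX// mulrnAl.
  rewrite -!mulrA -!mulrnAr; congr (_ * (_ * _)).
  rewrite -raddfMn /= factS natrM invrM//; congr (fpsC _).
  by rewrite -[_ *+ _]mulr_natr -mulrA mulVr// mulr1.
have -> : D (fps_exp f) n = D (exp_upto n.+2 f) n.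
  apply/eqP; rewrite -subr_eq0 -fps_coefB -raddfB; apply/eqP.
  apply: (Dv n.+1) => // m mn; rewrite fps_coefB (exp_uptoE (M := n.+2))// ?subrr//.
  by rewrite ltnW.
rewrite E !fps_coefM; apply: eq_bigr => i _; rewrite -exp_uptoE//.
by rewrite ltnS leq_subr.
Qed.

(** The derivation [t d/dt], which preserves the order of vanishing, unlike [d/dt]. *)
Definition theta_t f := Fps (fun n => f n *+ n).

Fact theta_t_zmod : zmod_morphism theta_t.
Proof. by move=> f g; apply/fpsP => n /=; rewrite mulrnBl. Qed.
HB.instance Definition _ :=
  GRing.isZmodMorphism.Build (fps R) (fps R) theta_t theta_t_zmod.

Lemma theta_tM f g : theta_t (f * g) = theta_t f * g + f * theta_t g.
Proof.
apply/fpsP => n; rewrite fps_coefD !fps_coefM /= -sumrMnl -big_split /=.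
apply: eq_bigr => i _; rewrite mulrnAl mulrnAr -mulrnDr subnKC//.
by rewrite -ltnS.
Qed.

Lemma theta_t_vanish N g : vanish N g -> vanish N (theta_t g).
Proof. by move=> gN n nN; rewrite /= gN// mul0rn. Qed.

(** Since [theta_t f] has no constant term, the coefficient of index [n + 1] is determined by the
    earlier ones, after division by [n + 1]. *)
Lemma theta_t_ode f y z : theta_t y = theta_t f * y -> theta_t z = theta_t f * z ->
  y 0%N = z 0%N -> y = z.
Proof.
move=> /fpsP Dy /fpsP Dz yz0; apply/fpsP => n.
have [m] := ubnP n; elim: m n => // m IHm [//|n]; rewrite ltnS => nm.
apply: (mulIr (Rchar0 n)); rewrite !mulr_natr.
rewrite -[LHS]/(theta_t y n.+1) -[RHS]/(theta_t z n.+1) Dy Dz !fps_coefM.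
rewrite [LHS]big_ord_recl [RHS]big_ord_recl /= !mulr0n !mul0r !add0r; apply: eq_bigr => i _.
by rewrite /bump /= add1n subSS IHm//; have := ltn_ord i; lia.
Qed.

Lemma theta_t_exp f : f 0%N = 0 -> theta_t (fps_exp f) = theta_t f * fps_exp f.
Proof. by apply: fps_exp_derivation; [exact: theta_tM|exact: theta_t_vanish]. Qed.

Lemma fps_expD f g : f 0%N = 0 -> g 0%N = 0 ->
  fps_exp (f + g) = fps_exp f * fps_exp g.
Proof.
move=> f0 g0; have fg0 : (f + g) 0%N = 0 by rewrite fps_coefD f0 g0 addr0.
apply: (@theta_t_ode (f + g)); first exact: theta_t_exp.
  rewrite theta_tM !theta_t_exp// raddfD mulrDl -mulrA; congr (_ + _).
  exact: mulrCA.
by rewrite [RHS]fps_coefM0 !fps_exp0 mulr1.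
Qed.

Lemma fps_exp_zero : fps_exp 0 = 1 :> fps R.
Proof.
apply: (@theta_t_ode 0); rewrite ?theta_t_exp//; last by rewrite fps_exp0.
by rewrite (derivation1 theta_tM) raddf0 mul0r.
Qed.

Lemma fps_exp_sum (I : Type) (r : seq I) (F : I -> fps R) :
  (forall i, F i 0%N = 0) ->
  fps_exp (\sum_(i <- r) F i) = \prod_(i <- r) fps_exp (F i).
Proof.
move=> F0; elim: r => [|i r IHr]; first by rewrite !big_nil fps_exp_zero.
rewrite !big_cons fps_expD ?IHr// fps_coef_sum big1// => j _.
Qed.

Lemma eq_fps_exp N f g : (forall n, (n <= N)%N -> f n = g n) ->
  forall n, (n <= N)%N -> fps_exp f n = fps_exp g n.
Proof.
move=> fg n nN; have v : vanish N.+1 (f - g).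
  by move=> m mN; rewrite fps_coefB fg// subrr.
apply: eq_bigr => m _; congr (_ / _); apply/eqP; rewrite -subr_eq0.
by rewrite -fps_coefB subrXX (@vanishMl _ N.+1).
Qed.

(* The trace of [log (1 + A)], where [A] has no constant term. *)
Definition tr_log n (A : 'M[fps R]_n.+1) : fps R :=
  Fps (fun j => \sum_(1 <= m < j.+1) (-1) ^+ m.-1 / m%:R * (\tr (A ^+ m)) j).

Lemma mx_vanishX n (A : 'M[fps R]_n.+1) m :
  (forall i j, A i j 0%N = 0) -> forall i j, vanish m ((A ^+ m) i j).
Proof.
move=> A0; elim: m => [|m IHm] i j; first by [].
rewrite exprS !mxE; apply: vanish_sum => k _; rewrite -add1n.
by apply: vanishM => // -[].
Qed.

(** Both sides have constant term 1 and solve [theta_t y = theta_t (tr_log A) * y]. For the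
    determinant this is Jacobi's formula, with [\adj (1 + A)] equal to the determinant times the
    geometric series in [- A]. *)
Lemma fps_exp_tr_log n (A : 'M[fps R]_n.+1) :
  (forall i j, A i j 0%N = 0) -> fps_exp (tr_log A) = \det (1 + A).
Proof.
move=> A0; have y0 : tr_log A 0%N = 0 by rewrite /= big_geq.
apply: (@theta_t_ode (tr_log A)); first exact: theta_t_exp; last first.
  rewrite fps_exp0 -[RHS]/(cst_coef _) -det_map_mx.
  suff -> : map_mx (@cst_coef R) (1 + A) = 1 by rewrite det1.
  apply/matrixP => i j; rewrite !mxE rmorphD rmorph_nat /=.
  by have -> : cst_coef (A i j) = 0; [exact: A0|rewrite addr0].
rewrite (derivation_det theta_tM).
have -> : map_mx theta_t (1 + A) = map_mx theta_t A.
  apply/matrixP => i j; rewrite !mxE raddfD /= raddfMn derivation1; last exact: theta_tM.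
  by rewrite mul0rn add0r.
(* Up to index [N] the finite sum [SM] inverts [1 + A]: the defect [(- A) ^+ N.+1] vanishes
   there. *)
apply/fpsP => N; pose SM := \sum_(m < N.+1) (- A) ^+ m.
have geo : (1 + A) * SM = 1 - (- A) ^+ N.+1.
  by rewrite -[RHS]opprB subrX1 -mulNr opprB opprK.
have -> : \adj (1 + A) = (\det (1 + A))%:M * SM + \adj (1 + A) * (- A) ^+ N.+1 :> 'M_n.+1.
  by rewrite -mul_adj_mx -mulrA geo mulrBr mulr1 subrK.
rewrite mulmxDl mxtraceD fps_coefD.
have vtr (B : 'M[fps R]_n.+1) : vanish N.+1 (\tr (\adj (1 + A) * (- A) ^+ N.+1 *m B)).
  apply: vanish_sum => i _; rewrite mxE; apply: vanish_sum => j _.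
  apply: vanishMl; rewrite mxE; apply: vanish_sum => k _.
  apply: vanishMr; apply: mx_vanishX => i' j'.
  by rewrite mxE fps_coefN A0 oppr0.
rewrite [X in _ + X = _](vtr _ N (ltnSn N)) addr0 -mulmxA mul_scalar_mx mxtraceZ mulrC !fps_coefM.
apply: eq_bigr => i _; congr (_ * _); apply/esym.
have vA m : vanish m.+1 (\tr ((A ^+ m) *m map_mx theta_t A)).
  apply: vanish_sum => k _; rewrite mxE; apply: vanish_sum => k' _.
  rewrite -addn1; apply: vanishM; first exact: mx_vanishX.
  by case=> // _; rewrite mxE /= mulr0n.
transitivity (\sum_(m < i) (-1) ^+ m * (\tr (A ^+ m *m map_mx theta_t A)) i).
  rewrite -[LHS]/((\sum_(1 <= m < i.+1)
    (-1) ^+ m.-1 / m%:R * (\tr (A ^+ m)) i) *+ i).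
  rewrite big_add1 big_mkord -sumrMnl; apply: eq_bigr => m _.
  rewrite -mulrnAr -[X in _ * X]/(theta_t _ _) (derivation_tr_expr theta_tM).
  rewrite -mulr_natl -[in X in _ * X]mulr_natl.
  have -> (f : fps R) : (m.+1%:R * f) i = m.+1%:R * f i.
    by rewrite -[m.+1%:R](rmorph_nat (@fpsC R)) fps_coefCM.
  by rewrite mulr1 mulrA mulrVK.
rewrite /SM mulmx_suml raddf_sum fps_coef_sum /=.
have iN : (i <= N.+1)%N by rewrite ltnW.
rewrite (big_ord_widen _ (fun m => (-1) ^+ m * (\tr (A ^+ m *m map_mx theta_t A)) i) iN).
rewrite big_mkcond; apply: eq_bigr => m _ /=.
have -> : (- A) ^+ m *m map_mx theta_t A = (-1) ^+ m *: (A ^+ m *m map_mx theta_t A).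
  by rewrite -scaleN1r exprZn scalemxAl.
rewrite mxtraceZ.
have -> f : ((-1) ^+ m * f) i = (-1) ^+ m * f i :> R.
  by rewrite -[-1 in LHS](rmorphN1 (@fpsC R)) -rmorphXn fps_coefCM.
by case: ltnP => // im; rewrite vA ?mulr0.
Qed.

End FpsExp.

(** * Subrings cut out by conditions on the coefficients *)

Section FpsInverse.
Variable R : comNzRingType.
Implicit Types f g h : fps R.

Definition fps_geom h : fps R := Fps (fun n => (\sum_(m < n.+1) h ^+ m) n).

Lemma fps_geomP h : h 0%N = 0 -> (1 - h) * fps_geom h = 1.
Proof.
move=> h0; apply: (fpsP _ _).1 => n; have <- : ((1 - h) * \sum_(m < n.+1) h ^+ m) n = (1 : fps R) n.
  have -> : (1 - h) * \sum_(m < n.+1) h ^+ m = 1 - h ^+ n.+1.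
    by rewrite -[RHS]opprB subrX1 -mulNr opprB.
  by rewrite fps_coefB (vanishX h0) ?subr0.
rewrite !fps_coefM; apply: eq_bigr => i _; congr (_ * _).
rewrite -[LHS]/((\sum_(m < (n - i).+1) h ^+ m) (n - i)%N) !fps_coef_sum.
have ni : ((n - i).+1 <= n.+1)%N by rewrite ltnS leq_subr.
rewrite (big_ord_widen _ (fun m => (h ^+ m) (n - i)%N) ni) big_mkcond.
by apply: eq_bigr => m _; case: ltnP => // nm; rewrite (vanishX h0).
Qed.

Definition fps_in (T : nat -> R -> Prop) f := forall n, T n (f n).

(** [T n] is the set of values allowed for the coefficient of [t^n]. The dependence on [n] is for
    polar series: their coefficients are polar in positive degree, but 1 is not polar, so constants
    must be allowed in degree 0. *)
Record graded_subring (T : nat -> R -> Prop) : Prop := GradedSubring {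
  graded1 : fps_in T 1;
  gradedB : forall f g, fps_in T f -> fps_in T g -> fps_in T (f - g);
  gradedM : forall f g, fps_in T f -> fps_in T g -> fps_in T (f * g) }.

Section Graded.
Variable T : nat -> R -> Prop.
Hypothesis gT : graded_subring T.

Lemma graded0 : fps_in T 0.
Proof. by rewrite -(subrr 1); apply: (gradedB gT) => //; apply: (graded1 gT). Qed.

Lemma gradedN f : fps_in T f -> fps_in T (- f).
Proof. by move=> Tf; rewrite -sub0r; apply: (gradedB gT) => //; apply: graded0. Qed.

Lemma gradedD f g : fps_in T f -> fps_in T g -> fps_in T (f + g).
Proof.
by move=> Tf Tg; rewrite -[g]opprK; apply: (gradedB gT) => //; apply: gradedN.
Qed.

Lemma graded_sum (I : Type) (r : seq I) (P : pred I) (F : I -> fps R) :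
  (forall i, P i -> fps_in T (F i)) -> fps_in T (\sum_(i <- r | P i) F i).
Proof.
by move=> TF; elim/big_ind: _ => //; [exact: graded0|exact: gradedD].
Qed.

Lemma graded_prod (I : Type) (r : seq I) (P : pred I) (F : I -> fps R) :
  (forall i, P i -> fps_in T (F i)) -> fps_in T (\prod_(i <- r | P i) F i).
Proof.
by move=> TF; elim/big_ind: _ => //; [exact: (graded1 gT)|exact: (gradedM gT)].
Qed.

Lemma gradedX f n : fps_in T f -> fps_in T (f ^+ n).
Proof.
move=> Tf; elim: n => [|n IHn]; first exact: (graded1 gT).
by rewrite exprS; apply: (gradedM gT).
Qed.

Lemma graded_geom h : fps_in T h -> fps_in T (fps_geom h).
Proof. by move=> Th n; apply: graded_sum => m _; apply: gradedX. Qed.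

(** With [fpsC c * f = 1 - h], the inverse is [c] times the geometric series in [h], so it stays in
    the subring once [c] does. *)
Lemma graded_inverse f c : fps_in T f -> fps_in T (fpsC c) -> c * f 0%N = 1 ->
  exists2 g, fps_in T g & g * f = 1.
Proof.
move=> Tf Tc cf0; pose h := 1 - fpsC c * f.
have Th : fps_in T h by apply: (gradedB gT) => //; [exact: (graded1 gT)|exact: (gradedM gT)].
have h0 : h 0%N = 0 by rewrite fps_coefB fps_coefCM cf0 subrr.
exists (fps_geom h * fpsC c); first by apply: (gradedM gT) => //; apply: graded_geom.
by rewrite -mulrA mulrC -{1}[fpsC c * f](subKr 1) fps_geomP.
Qed.

Lemma graded_det n (A : 'M[fps R]_n) :
  (forall i j, fps_in T (A i j)) -> fps_in T (\det A).
Proof.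
move=> TA; apply: graded_sum => s _; apply: (gradedM gT); last exact: graded_prod.
by apply: gradedX; apply: gradedN; apply: (graded1 gT).
Qed.

Lemma graded_mulmx m n p (A : 'M[fps R]_(m, n)) (B : 'M[fps R]_(n, p)) :
  (forall i j, fps_in T (A i j)) -> (forall i j, fps_in T (B i j)) ->
  forall i j, fps_in T ((A *m B) i j).
Proof.
by move=> TA TB i j; rewrite mxE; apply: graded_sum => k _; apply: (gradedM gT).
Qed.

Lemma graded_adj n (A : 'M[fps R]_n) :
  (forall i j, fps_in T (A i j)) -> forall i j, fps_in T ((\adj A) i j).
Proof.
move=> TA i j; rewrite mxE; apply: (gradedM gT).
  by apply: gradedX; apply: gradedN; apply: (graded1 gT).
by apply: graded_det => i' j'; rewrite !mxE.
Qed.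

Lemma graded_mx_inverse n (A : 'M[fps R]_n) :
  (forall i j, fps_in T (A i j)) -> (forall i j, A i j 0%N = (i == j)%:R) ->
  exists2 B : 'M_n, (forall i j, fps_in T (B i j)) & A *m B = 1%:M.
Proof.
move=> TA A0; have d0 : (\det A) 0%N = 1.
  rewrite -[LHS]/(cst_coef _) -det_map_mx.
  suff -> : map_mx (@cst_coef R) A = 1%:M by rewrite det1.
  by apply/matrixP => i j; rewrite !mxE -A0.
have [|||g Tg gd] := @graded_inverse (\det A) 1.
- exact: graded_det.
- by rewrite rmorph1; apply: (graded1 gT).
- by rewrite d0 mulr1.
exists (g *: \adj A).
  by move=> i j; rewrite mxE; apply: (gradedM gT) => //; apply: graded_adj.
by rewrite -scalemxAr mul_mx_adj scale_scalar_mx gd.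
Qed.

End Graded.

End FpsInverse.

Section GradedExp.
Variables (R : comUnitRingType) (T : nat -> R -> Prop).
Hypothesis gT : graded_subring T.

Lemma graded_exp f : (forall m, fps_in T (fpsC (m`!%:R^-1))) ->
  fps_in T f -> fps_in T (fps_exp f).
Proof.
move=> TC Tf n; have := @graded_sum _ _ gT 'I_n.+1 (index_enum 'I_n.+1) xpredT
  (fun m => fpsC (m`!%:R^-1) * f ^+ m).
move=> /(_ (fun m _ => gradedM gT (TC m) (gradedX gT m Tf)) n).
rewrite fps_coef_sum (eq_bigr (fun m : 'I__ => (f ^+ m) n / m`!%:R))// => m _.
by rewrite fps_coefCM mulrC.
Qed.

End GradedExp.

Section LaurentField.
Variable K : fieldType.
Implicit Types f g : laurent K.

Lemma laurent_inverse f : f != 0 -> exists g, g * f = 1.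
Proof.
move=> f0; have [N fN] := laurent_bounded f.
have exf : exists n : nat, f (N + n%:Z) != 0.
  apply: contraNP f0 => nex; apply/eqP/laurentP => n.
  have [/fN//|Nn] := ltP n N; apply/eqP; apply: contra_notT nex => fn0.
  by exists (absz (n - N)%R); have -> : N + (absz (n - N)%R)%:Z = n by lia.
have [n fn0 nmin] := ex_minnP exf; pose a := N + n%:Z.
pose h : fps K := Fps (fun m => f (a + m%:Z)).
have fE : f = laurent_monom 1 a * laurent_of_fps h.
  apply/laurentP => m; rewrite laurent_coef_monomM mul1r.
  case E : (m - a) => [p|p] /=; first by rewrite -E addrC subrK.
  have [/fN//|Nm] := ltP m N; apply/eqP/negPn/negP => fm0.
  have /nmin : f (N + (absz (m - N)%R)%:Z) != 0.
    by have -> : N + (absz (m - N)%R)%:Z = m by lia.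
  by rewrite /a in E; lia.
have gT : graded_subring (fun (_ : nat) (_ : K) => True) by [].
have [|||g _ gh] := graded_inverse gT (f := h) (c := (h 0%N)^-1).
- by [].
- by [].
- by rewrite mulVf// /= addr0.
exists (laurent_of_fps g * laurent_monom 1 (- a)).
rewrite fE mulrA -[X in X * _]mulrA.
have -> : laurent_monom 1 (- a) * laurent_monom 1 a = 1 :> laurent K.
  apply/laurentP => m; rewrite laurent_coef_monomM mul1r /= opprK.
  by rewrite -[in X in _ == X](add0r a) (inj_eq (addIr _)).
by rewrite mulr1 -rmorphM gh rmorph1.
Qed.

(** Chosen classically. The field structure is wanted on [K((u))], over which the two bases of
    solutions are compared. *)
Definition laurent_inv f : laurent K :=
  if pselect (exists g, g * f = 1) is left e then sval (cid e) else 0.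

Fact laurent_mulVf f : f != 0 -> laurent_inv f * f = 1.
Proof.
move=> /laurent_inverse ef; rewrite /laurent_inv.
by case: pselect => // e; case: cid.
Qed.

Fact laurent_inv0 : laurent_inv 0 = 0.
Proof.
rewrite /laurent_inv; case: pselect => // e; exfalso; case: e => g /eqP.
by rewrite mulr0 eq_sym oner_eq0.
Qed.

HB.instance Definition _ :=
  GRing.ComNzRing_isField.Build (laurent K) laurent_mulVf laurent_inv0.

End LaurentField.

(** ['X - N] divides ['X^m - N^m], so on taking determinants the characteristic polynomial divides a
    power of ['X]; it is monic of degree [n]. *)
Lemma char_poly_nilpotent (F : fieldType) n (N : 'M[F]_n) m :
  N ^+ m = 0 -> char_poly N = 'X^n.
Proof.
move=> N0; have dvd : char_poly N %| ('X - 0%:P) ^+ (m * n).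
  pose X1 : 'M[{poly F}]_n := 'X%:M; pose N1 : 'M[{poly F}]_n := map_mx polyC N.
  have cXN : GRing.comm X1 N1 by apply/esym; exact: scalar_mxC.
  have N1m : N1 ^+ m = 0 by rewrite /N1 -rmorphXn /= N0 map_mx0.
  have := subrXX_comm m cXN; rewrite N1m subr0 => /(congr1 determinant).
  rewrite det_mulmx subr0 exprM -rmorphXn det_scalar => ->.
  exact: dvdp_mulr.
have [k _] := dvdp_exp_XsubCP dvd; rewrite subr0 => NX.
have := eqp_eq NX; rewrite lead_coefXn (monicP (char_poly_monic N)) !scale1r => NE.
by move: (size_char_poly N); rewrite NE size_polyXn => -[->].
Qed.

Lemma det_1B_nilpotent (F : fieldType) n (N : 'M[F]_n.+1) m :
  N ^+ m = 0 -> \det (1 - N) = 1.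
Proof.
move=> /char_poly_nilpotent /(congr1 (fun p => p.[1])).
rewrite hornerXn expr1n => <-; rewrite /char_poly -horner_evalE -det_map_mx.
congr (\det _); apply/matrixP => i j; rewrite !mxE /= /horner_eval.
by rewrite hornerD hornerN hornerMn hornerX hornerC.
Qed.

(** * Generalized eigenvectors and monodromy *)

Section GeneralizedEigenvectors.
Variables (F : fieldType) (n : nat).
Variables (D : 'M[F]_n.+1) (lam : 'I_n.+1 -> F) (m : nat).
Hypothesis lamP : forall j, (D - (lam j)%:M) ^+ m *m delta_mx j (0 : 'I_1) = 0.

Let e j : 'cV[F]_n.+1 := delta_mx j 0.

Let DE i : (D - (lam i)%:M) ^+ m = horner_mx D (('X - (lam i)%:P) ^+ m).
Proof. by rewrite rmorphXn rmorphB /= horner_mx_X horner_mx_C. Qed.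

(** The basis vectors are generalized eigenvectors, and [D] preserves each generalized eigenspace:
    the part [w] of column [j] carried by the other eigenvalues is killed by two coprime polynomials
    in [D]. *)
Lemma gen_eig_block i j : lam i != lam j -> D i j = 0.
Proof.
move=> ij; pose w : 'cV[F]_n.+1 := \sum_(i | lam i != lam j) D i j *: e i.
suff w0 : w = 0.
  have := congr1 (fun v : 'cV_n.+1 => v i 0) w0.
  rewrite /w summxE (bigD1 i)//= !mxE eqxx mulr1 big1 ?addr0// => k /andP[_ ki].
  by rewrite !mxE eq_sym (negPf ki) mulr0.
pose p := ('X - (lam j)%:P) ^+ m.
pose q := \prod_(i | lam i != lam j) ('X - (lam i)%:P) ^+ m.
have pw : horner_mx D p *m w = 0.
  have Dej : D *m e j = \sum_i D i j *: e i.
    by apply/colP => k; rewrite -colE summxE (bigD1 k)//= !mxE eqxx mulr1 big1 ?addr0// => l lk;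
      rewrite !mxE eq_sym (negPf lk) mulr0.
  have : horner_mx D p *m (D *m e j) = 0.
    have cD : horner_mx D p *m D = D *m horner_mx D p.
      exact: (comm_horner_mx _ (comm_mx_refl D)).
    by rewrite mulmxA cD -mulmxA -DE lamP mulmx0.
  rewrite Dej (bigID (fun i => lam i == lam j))/= mulmxDr mulmx_sumr big1 ?add0r//.
  by move=> k /eqP kj; rewrite -scalemxAr /p -kj -DE lamP scaler0.
have qw : horner_mx D q *m w = 0.
  rewrite /w mulmx_sumr big1// => k kj; rewrite -scalemxAr /q (bigD1 k)//= mulrC.
  by rewrite rmorphM -[X in X *m _]/(_ *m _) -mulmxA /= -DE lamP mulmx0 scaler0.
have : coprimep p q.
  apply: coprimep_expl; rewrite /q; elim/big_rec: _ => [|k x kj IH]; first exact: coprimep1.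
  by rewrite coprimepMr IH andbT; apply: coprimep_expr; rewrite coprimep_XsubC root_XsubC.
move=> /Bezout_eq1_coprimepP[[u v]/= uv].
have -> : w = horner_mx D 1 *m w by rewrite rmorph1 mul1mx.
rewrite -uv rmorphD !rmorphM /=.
by rewrite mulmxDl -[X in X *m _]/(_ *m _) -[X in _ + X *m _]/(_ *m _) -!mulmxA pw qw !mulmx0 addr0.
Qed.

(** [D] is a diagonal matrix plus a nilpotent [N] commuting with it. Over the rational functions the
    diagonal part [Xd] of [X - D] is invertible and factors out, leaving 1 minus a nilpotent matrix,
    of determinant 1. *)
Lemma char_poly_gen_eig : char_poly D = \prod_j ('X - (lam j)%:P).
Proof.
pose Ld : 'M[F]_n.+1 := diag_mx (\row_j lam j); pose N := D - Ld.
have cDL : GRing.comm D Ld.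
  suff : D *m Ld = Ld *m D by [].
  apply/matrixP => i j; rewrite mul_mx_diag mul_diag_mx !mxE.
  have [->|/gen_eig_block ->] := eqVneq (lam i) (lam j); first exact: mulrC.
  by rewrite mulr0 mul0r.
have cDN : GRing.comm D N by apply: commrB.
have Ne j k : N ^+ k *m e j = (D - (lam j)%:M) ^+ k *m e j.
  elim: k => [|k IHk]; first by rewrite !expr0.
  have Nj : N *m e j = (D - (lam j)%:M) *m e j.
    rewrite !mulmxBl; congr (_ - _); rewrite mul_diag_mx mul_scalar_mx.
    by apply/colP => i; rewrite !mxE; case: eqP => [->//|_]; rewrite !mulr0.
  rewrite exprSr -mulmxA Nj mulmxA.
  have -> : N ^+ k *m (D - (lam j)%:M) = (D - (lam j)%:M) *m N ^+ k.
    apply: commrB; first exact/commr_sym/commrX.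
    exact: scalar_mxC.
  by rewrite -mulmxA IHk mulmxA [in RHS]exprS.
have Nm : N ^+ m = 0.
  apply/matrixP => i j; have := congr1 (fun v : 'cV_n.+1 => v i 0) (Ne j m).
  by rewrite lamP -colE !mxE.
pose phi : {rmorphism F -> ratfun F} := ratC.
pose Xd : 'M[ratfun F]_n.+1 := diag_mx (\row_j (eps - ratC (lam j))).
pose Xi : 'M[ratfun F]_n.+1 := diag_mx (\row_j (eps - ratC (lam j))^-1).
pose N1 : 'M[ratfun F]_n.+1 := map_mx (@ratC F) N.
have eps_neq j : eps - ratC (lam j) != 0 :> ratfun F.
  by rewrite -tofracB tofrac_eq0 polyXsubC_eq0.
have XiX : Xi * Xd = 1.
  suff : Xi *m Xd = 1%:M by [].
  apply/matrixP => i j; rewrite mul_diag_mx !mxE.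
  by case: eqP => [->|]; rewrite ?mulr0// mulVf.
have XXi : Xd * Xi = 1 by apply: mulmx1C.
have cXN : GRing.comm Xi N1.
  suff : Xi *m N1 = N1 *m Xi by [].
  apply/matrixP => i j; rewrite mul_mx_diag mul_diag_mx !mxE.
  have [E|ij] := eqVneq (lam i) (lam j); first by rewrite E mulrC.
  suff -> : D i j - lam i *+ (i == j) = 0 by rewrite rmorph0 mulr0 mul0r.
  have -> : (i == j) = false by apply: contraNF ij => /eqP ->.
  by rewrite gen_eig_block// subr0.
have d1 : \det (1 - Xi * N1) = 1.
  apply: (@det_1B_nilpotent _ _ _ m); rewrite exprMn_comm//.
  by rewrite /N1 -rmorphXn /= Nm map_mx0 mulr0.
have tof : map_mx (@FracField.tofrac _) (char_poly_mx D) = Xd * (1 - Xi * N1).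
  rewrite mulrBr mulr1 mulrA XXi mul1r; apply/matrixP => i j; rewrite !mxE.
  rewrite tofracB tofracMn -[FracField.tofrac (_)%:P]/(ratC _) -/eps.
  rewrite rmorphB rmorphMn mulrnBl opprB.
  by rewrite addrA subrK.
apply/eqP; rewrite -tofrac_eq; apply/eqP.
rewrite /char_poly -det_map_mx tof det_mulmx d1 mulr1 det_diag rmorph_prod.
by apply: eq_bigr => j _; rewrite mxE /= tofracB.
Qed.

End GeneralizedEigenvectors.

Lemma exchange_triangle (V : zmodType) n (G : nat -> nat -> V) :
  \sum_(i < n.+1) \sum_(m < (n - i).+1) G i m =
  \sum_(m < n.+1) \sum_(i < (n - m).+1) G i m.
Proof.
have E (H : nat -> nat -> V) : \sum_(i < n.+1) \sum_(m < (n - i).+1) H i m =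
    \sum_(i < n.+1) \sum_(m < n.+1 | (i + m <= n)%N) H i m.
  apply: eq_bigr => i _; have ni : ((n - i).+1 <= n.+1)%N by lia.
  rewrite (big_ord_widen _ (H i) ni); apply: eq_bigl => m.
  by have := ltn_ord i; lia.
rewrite !(E G) (E (fun m i => G i m)) (exchange_big_dep xpredT)//=.
by apply: eq_bigr => m _; apply: eq_bigl => i; rewrite addnC.
Qed.

(** * Formal solutions of a perturbed operator *)

Section FormalSolutions.
Variables (F : comNzRingType) (V : zmodType) (sc : F -> {additive V -> V}).
Variables (P : {additive V -> V}) (J : V -> V) (k : nat).
Variables (co : 'I_k -> {additive V -> F}) (e0 : 'I_k -> V).
Hypothesis P_sc : forall c v, P (sc c v) = sc c (P v).
Hypothesis co_sc : forall a c v, co a (sc c v) = c * co a v.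
Hypothesis PJ : forall v, P (J v) = v.
Hypothesis coJ : forall a v, co a (J v) = 0.
Hypothesis Pe0 : forall a, P (e0 a) = 0.
Hypothesis co_e0 : forall a b, co a (e0 b) = (a == b)%:R.
Hypothesis P_inj : forall v, P v = 0 -> (forall a, co a v = 0) -> v = 0.

Section Operator.
Variable Q : nat -> {additive V -> V}.
Hypothesis Q_sc : forall i c v, Q i (sc c v) = sc c (Q i v).

Definition formal_op (f : nat -> V) j := P (f j) + \sum_(1 <= i < j.+1) Q i (f (j - i)%N).

(** Each coefficient depends on all the earlier ones, so the recursion carries their list. The
    kernel vector [e0 b] is corrected through the right inverse [J] of [P]; as the forms [co] vanish
    on the image of [J], the coordinates of [fsol b] remain those of [e0 b]. *)
Fixpoint sol_seq (b : 'I_k) n : seq V :=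
  if n is n'.+1 then
    rcons (sol_seq b n') (if n' is 0 then e0 b else
      - J (\sum_(1 <= i < n'.+1) Q i (nth 0 (sol_seq b n') (n' - i))))
  else [::].

Let sol_seqS b n : sol_seq b n.+1 =
  rcons (sol_seq b n) (if n is 0 then e0 b else
      - J (\sum_(1 <= i < n.+1) Q i (nth 0 (sol_seq b n) (n - i)))).
Proof. by []. Qed.

Definition fsol b n := nth 0 (sol_seq b n.+1) n.

Let size_sol_seq b n : size (sol_seq b n) = n.
Proof. by elim: n => //= n IHn; rewrite size_rcons IHn. Qed.

Let nth_sol_seq b n m : (m < n)%N -> nth 0 (sol_seq b n) m = fsol b m.
Proof.
elim: n => // n IHn; rewrite ltnS leq_eqVlt => /orP[/eqP -> //|mn].
by rewrite sol_seqS nth_rcons size_sol_seq mn IHn.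
Qed.

Lemma fsol0 b : fsol b 0 = e0 b. Proof. by []. Qed.

Lemma fsolS b n : fsol b n.+1 = - J (\sum_(1 <= i < n.+2) Q i (fsol b (n.+1 - i)%N)).
Proof.
rewrite {1}/fsol sol_seqS nth_rcons size_sol_seq ltnn eqxx; congr (- J _).
apply: eq_big_nat => i i_bnd; rewrite nth_sol_seq//; lia.
Qed.

Lemma formal_op_fsol b j : formal_op (fsol b) j = 0.
Proof.
rewrite /formal_op; case: j => [|j]; first by rewrite fsol0 Pe0 big_geq ?addr0.
by rewrite {1}fsolS raddfN /= PJ addNr.
Qed.

Lemma co_fsol a b j : co a (fsol b j) = ((j == 0%N) && (a == b))%:R.
Proof.
by case: j => [|j]; rewrite ?fsol0 ?co_e0// fsolS raddfN /= coJ oppr0.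
Qed.

Lemma formal_op_inj f : (forall j, formal_op f j = 0) -> (forall j a, co a (f j) = 0) ->
  forall j, f j = 0.
Proof.
move=> f0 cf j; have [m] := ubnP j; elim: m j => // m IHm j jm.
apply: P_inj => //; have := f0 j; rewrite /formal_op big_nat_cond big1 ?addr0//.
by move=> i; rewrite andbT => ij; rewrite IHm ?raddf0//; lia.
Qed.

(** The combination of the [fsol a] with coefficients in [F[[t]]], written as a convolution because
    [V] only carries an action of [F]. *)
Definition fcomb (c : 'I_k -> nat -> F) j :=
  \sum_a \sum_(i < j.+1) sc (c a i) (fsol a (j - i)%N).

(** With [P] as the term of index 0 the operator becomes a convolution, which commutes with
    multiplication by scalar series. *)
Let Q' i := if i is 0 then P else Q i.

Let formal_opE f j : formal_op f j = \sum_(i < j.+1) Q' i (f (j - i)%N).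
Proof.
rewrite -(big_mkord xpredT (fun i => Q' i (f (j - i)%N))) big_nat_recl// subn0.
by rewrite /formal_op big_add1.
Qed.

Lemma formal_op_fcomb c j : formal_op (fcomb c) j = 0.
Proof.
have Q'_sc i x v : Q' i (sc x v) = sc x (Q' i v) by case: i => /=.
rewrite formal_opE; under eq_bigr do rewrite raddf_sum.
rewrite exchange_big big1//= => a _; under eq_bigr do rewrite raddf_sum.
rewrite (exchange_triangle j (fun i m => Q' i (sc (c a m) (fsol a (j - i - m))))).
rewrite big1// => m _; under eq_bigr do rewrite Q'_sc subnAC.
by rewrite -raddf_sum /= -formal_opE formal_op_fsol raddf0.
Qed.

(** Subtracting the combination with the same coordinates leaves a solution without coordinates,
    which vanishes coefficient by coefficient by [P_inj]. *)
Lemma formal_sol_span f : (forall j, formal_op f j = 0) ->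
  forall j, f j = fcomb (fun a i => co a (f i)) j.
Proof.
move=> f0 j; apply/eqP; rewrite -subr_eq0; apply/eqP.
pose g j := f j - fcomb (fun a i => co a (f i)) j.
rewrite -/(g j); apply: formal_op_inj => {}j.
  have -> : formal_op g j = formal_op f j - formal_op (fcomb (fun a i => co a (f i))) j.
    rewrite /formal_op /g raddfB /= opprD addrACA -sumrB; congr (_ + _).
    by apply: eq_bigr => i _; rewrite raddfB.
  by rewrite f0 formal_op_fcomb subrr.
move=> a; rewrite /g raddfB /= raddf_sum (bigD1 a)//= [X in _ - (_ + X)]big1 ?addr0.
  rewrite raddf_sum big_ord_recr /= big1 ?add0r => [|i _].
    by rewrite co_sc subnn co_fsol !eqxx mulr1 subrr.
  by rewrite co_sc co_fsol subn_eq0 leqNgt ltn_ord mulr0.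
move=> b ba; rewrite raddf_sum big1// => i _.
by rewrite /= co_sc co_fsol [a == b]eq_sym (negPf ba) andbF mulr0.
Qed.

Variable d : {additive V -> V}.
Hypothesis dP : forall v, d (P v) = P (d v).
Hypothesis dQ : forall i v, d (Q i v) = Q i (d v).
Hypothesis d_sc : forall c v, d (sc c v) = sc c (d v).

(** The matrix of [d] on the solutions: the forms [co] give the coordinates in the basis [fsol],
    thanks to the normalization [co_fsol]. *)
Definition monodromy : 'M[fps F]_k := \matrix_(a, b) Fps (fun j => co a (d (fsol b j))).

Lemma d_fsol b j : d (fsol b j) = fcomb (fun a => monodromy a b) j.
Proof.
rewrite (@formal_sol_span (fun j => d (fsol b j))).
  by apply: eq_bigr => a _; apply: eq_bigr => i _; rewrite mxE.
move=> {}j; rewrite -[RHS](raddf0 d) -(formal_op_fsol b j) raddfD raddf_sum /= dP.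
by congr (_ + _); apply: eq_bigr => i _; rewrite dQ.
Qed.

(** With [phi] a coefficient at [log x = 0], this recovers all powers of [log x] in the solutions
    from their values there and the powers of the monodromy. *)
Lemma iter_d_fsol (phi : {additive V -> F}) :
  (forall c v, phi (sc c v) = c * phi v) -> forall m b,
  Fps (fun j => phi (iter m d (fsol b j))) =
  \sum_a Fps (fun j => phi (fsol a j)) * (monodromy ^+ m) a b.
Proof.
move=> phi_sc m b.
have iterD n (I : Type) (r : seq I) (G : I -> V) :
    iter n d (\sum_(i <- r) G i) = \sum_(i <- r) iter n d (G i).
  by elim: n => //= n ->; rewrite raddf_sum.
have iter_sc n c v : iter n d (sc c v) = sc c (iter n d v).
  by elim: n => //= n ->.
elim: m b => [|m IHm] b.
  rewrite (bigD1 b)//= mxE eqxx mulr1 big1 ?addr0// => a /negPf ab.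
  by rewrite mxE ab mulr0.
transitivity (\sum_a Fps (fun j => phi (iter m d (fsol a j))) * monodromy a b).
  apply: (fpsP _ _).1 => j; rewrite fps_coef_sum.
  rewrite -[LHS]/(phi (iter m.+1 d (fsol b j))) iterSr d_fsol iterD raddf_sum.
  apply: eq_bigr => a _; rewrite iterD raddf_sum mulrC fps_coefM.
  apply: eq_bigr => i _ /=.
  by rewrite iter_sc phi_sc.
under eq_bigr do rewrite IHm mulr_suml.
rewrite exchange_big; apply: eq_bigr => a _ /=.
by rewrite exprSr mxE mulr_sumr; apply: eq_bigr => a' _; rewrite mulrA.
Qed.

End Operator.

End FormalSolutions.

(** * Polar and regular parts *)

Section RationalFunctions.
Variable K : fieldType.
Implicit Types (f g : ratfun K) (p q : {poly K}).
Local Notation tofrac := (@FracField.tofrac {poly K}).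

Lemma ratfun_repr f : exists p q, q != 0 /\ f = tofrac p / tofrac q.
Proof.
elim/quotW: f => x; have d0 := denom_ratioP x; exists \n_x, \d_x; split=> //.
apply: (canRL (mulfK _)); first by rewrite tofrac_eq0.
unlock FracField.tofrac; rewrite -[LHS]FracField.pi_mul.
apply/eqmodP; rewrite /= FracField.equivfE /FracField.mulf.
by rewrite !numden_Ratio ?mulf_neq0 ?oner_eq0// !mulr1 mulrC.
Qed.

Section Shift.
Variable c : K.

Let sh p := p \Po ('X + c%:P).

Let sh_eq0 p : (sh p == 0) = (p == 0).
Proof. by rewrite comp_poly2_eq0// size_XaddC. Qed.

(** The substitution [eps := eps + c], which moves a pole at [c] to 0. By [shift_frac] the chosen
    representative is immaterial. *)
Definition shift f : ratfun K :=
  let: exist p ep := cid (ratfun_repr f) in let: exist q _ := cid ep in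
  tofrac (p \Po ('X + c%:P)) / tofrac (q \Po ('X + c%:P)).

Lemma shift_frac p q : q != 0 ->
  shift (tofrac p / tofrac q) = tofrac (p \Po ('X + c%:P)) / tofrac (q \Po ('X + c%:P)).
Proof.
move=> q0; rewrite /shift; case: cid => p' ep; case: cid => q' [q'0 /eqP].
rewrite eqr_div ?tofrac_eq0// -!tofracM tofrac_eq => /eqP pq.
apply/eqP; rewrite eqr_div ?tofrac_eq0 ?[_ == _]sh_eq0//.
by rewrite -!tofracM tofrac_eq -!comp_polyM pq.
Qed.

Fact shift_zmod : zmod_morphism shift.
Proof.
move=> f g; have [p [q [q0 ->]]] := ratfun_repr f.
have [p' [q' [q'0 ->]]] := ratfun_repr g.
have E (a b a' b' : {poly K}) : b != 0 -> b' != 0 ->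
    tofrac a / tofrac b - tofrac a' / tofrac b' =
    tofrac (a * b' - a' * b) / tofrac (b * b').
  move=> b0 b'0; rewrite -mulNr addf_div ?tofrac_eq0//.
  by rewrite -tofracN -!tofracM -tofracD mulNr.
rewrite E// !shift_frac ?mulf_neq0// E ?sh_eq0 ?[_ == _]sh_eq0//.
by rewrite comp_polyB !comp_polyM.
Qed.
HB.instance Definition _ :=
  GRing.isZmodMorphism.Build (ratfun K) (ratfun K) shift shift_zmod.

Lemma shift_tofrac p : shift (tofrac p) = tofrac (p \Po ('X + c%:P)).
Proof.
have := @shift_frac p 1 (oner_neq0 _).
by rewrite comp_polyC -polyC1 -/(1%:P) tofrac1 !divr1.
Qed.

Fact shift_monoid : monoid_morphism shift.
Proof.
split=> [|f g]; first by rewrite -tofrac1 shift_tofrac comp_polyC.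
have [p [q [q0 ->]]] := ratfun_repr f.
have [p' [q' [q'0 ->]]] := ratfun_repr g.
rewrite mulf_div -!tofracM !shift_frac ?mulf_neq0//.
by rewrite mulf_div -!tofracM !comp_polyM.
Qed.
HB.instance Definition _ :=
  GRing.isMonoidMorphism.Build (ratfun K) (ratfun K) shift shift_monoid.

Lemma shift_ratC a : shift (ratC a) = ratC a.
Proof. by rewrite /ratC /= shift_tofrac comp_polyC. Qed.

Lemma shift_eps : shift eps = eps + ratC c.
Proof. by rewrite /eps shift_tofrac comp_polyX tofracD. Qed.

End Shift.

Definition reg0 f := exists p q, q.[0] != 0 /\ f * tofrac q = tofrac p.

Lemma reg0_tofrac p : reg0 (tofrac p).
Proof. by exists p, 1; rewrite hornerC oner_eq0 tofrac1 mulr1. Qed.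

Lemma reg0D f g : reg0 f -> reg0 g -> reg0 (f + g).
Proof.
move=> [p [q [q0 fE]]] [p' [q' [q'0 gE]]]; exists (p * q' + p' * q), (q * q').
split; first by rewrite hornerM mulf_neq0.
by rewrite tofracD !tofracM -fE -gE mulrDl !mulrA [g * _ * _]mulrAC.
Qed.

Lemma reg0M f g : reg0 f -> reg0 g -> reg0 (f * g).
Proof.
move=> [p [q [q0 fE]]] [p' [q' [q'0 gE]]]; exists (p * p'), (q * q').
split; first by rewrite hornerM mulf_neq0.
by rewrite !tofracM -fE -gE mulrACA.
Qed.

Lemma reg00 : reg0 0. Proof. by rewrite -tofrac0; apply: reg0_tofrac. Qed.
Lemma reg01 : reg0 1. Proof. by rewrite -tofrac1; apply: reg0_tofrac. Qed.

Lemma reg0N f : reg0 f -> reg0 (- f).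
Proof.
by move=> rf; rewrite -mulN1r; apply: reg0M => //; rewrite -tofrac1 -tofracN; apply: reg0_tofrac.
Qed.

Lemma reg0B f g : reg0 f -> reg0 g -> reg0 (f - g).
Proof. by move=> rf rg; apply: reg0D => //; apply: reg0N. Qed.

Lemma reg0_sum (I : Type) (r : seq I) (P : pred I) (G : I -> ratfun K) :
  (forall i, P i -> reg0 (G i)) -> reg0 (\sum_(i <- r | P i) G i).
Proof. by move=> rG; elim/big_ind: _ => //; [exact: reg00|exact: reg0D]. Qed.

Lemma reg0_prod (I : Type) (r : seq I) (P : pred I) (G : I -> ratfun K) :
  (forall i, P i -> reg0 (G i)) -> reg0 (\prod_(i <- r | P i) G i).
Proof. by move=> rG; elim/big_ind: _ => //; [exact: reg01|exact: reg0M]. Qed.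

Lemma reg0_inv q : q.[0] != 0 -> reg0 (tofrac q)^-1.
Proof.
move=> q0; exists 1, q; split=> //; rewrite mulVf ?tofrac1// tofrac_eq0.
by apply: contraNneq q0 => ->; rewrite horner0.
Qed.

Lemma reg0_ratC a : reg0 (ratC a).
Proof. exact: reg0_tofrac. Qed.

Lemma graded_reg0 : graded_subring (fun _ => reg0).
Proof.
split=> [n|f g rf rg n|f g rf rg n]; first by rewrite fps_coef1; case: eqP => _; [exact: reg01|exact: reg00].
  exact: reg0B.
by rewrite fps_coefM; apply: reg0_sum => i _; apply: reg0M.
Qed.

(** The space [eps^-1 K[eps^-1]]: size at most [M] means degree below [M], so that only strictly
    negative powers of [eps] occur. *)
Definition polar f := exists p M, (size p <= M)%N /\ f * eps ^+ M = tofrac p.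

Lemma polar0 : polar 0.
Proof. by exists 0, 0%N; rewrite size_poly0 mul0r tofrac0. Qed.

Lemma polar_monom a j : polar (ratC a * eps ^- j.+1).
Proof.
exists a%:P, j.+1; rewrite mulfVK ?expf_neq0 ?tofrac_eq0 ?polyX_eq0//.
by split=> //; apply: leq_trans (size_polyC_leq1 _) _.
Qed.

Lemma polarB f g : polar f -> polar g -> polar (f - g).
Proof.
move=> [p [M [pM fE]]] [q [N [qN gE]]]; exists (p * 'X^N - q * 'X^M), (M + N)%N.
split; last first.
  rewrite mulrBl tofracB !tofracM -fE -gE !tofracXn exprD mulrA; congr (_ - _).
  by rewrite [_ ^+ M * _]mulrC mulrA.
have sX (a : {poly K}) x y : (size a <= x)%N -> (size (a * 'X^y)%R <= x + y)%N.
  move=> ax; apply: leq_trans (size_polyMleq _ _) _; rewrite size_polyXn addnS /=.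
  by rewrite leq_add2r.
apply: leq_trans (size_polyD _ _) _; rewrite size_polyN geq_max sX//=.
by rewrite addnC sX.
Qed.

Lemma polarN f : polar f -> polar (- f).
Proof. by move=> pf; rewrite -sub0r; apply: polarB => //; apply: polar0. Qed.

Lemma polarD f g : polar f -> polar g -> polar (f + g).
Proof. by move=> pf pg; rewrite -[g]opprK; apply: polarB => //; apply: polarN. Qed.

Lemma polar_sum (I : Type) (r : seq I) (P : pred I) (G : I -> ratfun K) :
  (forall i, P i -> polar (G i)) -> polar (\sum_(i <- r | P i) G i).
Proof. by move=> rG; elim/big_ind: _ => //; [exact: polar0|exact: polarD]. Qed.

Lemma polarM f g : polar f -> polar g -> polar (f * g).
Proof.
move=> [p [M [pM fE]]] [q [N [qN gE]]]; exists (p * q), (M + N)%N.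
split; last by rewrite tofracM -fE -gE exprD mulrACA.
by apply: leq_trans (size_polyMleq _ _) _; lia.
Qed.

Lemma polarZ a f : polar f -> polar (ratC a * f).
Proof.
move=> [p [M [pM fE]]]; exists (a *: p), M; rewrite (leq_trans (size_scale_leq _ _))//.
by rewrite -mul_polyC tofracM -mulrA fE.
Qed.

Definition polar_coef n f := if n is 0 then exists a, f = ratC a else polar f.

Lemma graded_polar : graded_subring polar_coef.
Proof.
split=> [[|n]|f g Tf Tg [|n]|f g Tf Tg [|n]] /=.
- by exists 1; rewrite rmorph1.
- exact: polar0.
- have [[a fa] [b gb]] := (Tf 0%N, Tg 0%N).
  by exists (a - b); rewrite fa gb rmorphB.
- by apply: polarB; [exact: (Tf n.+1)|exact: (Tg n.+1)].
- have [[a fa] [b gb]] := (Tf 0%N, Tg 0%N).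
  by exists (a * b); rewrite big_ord1 fa gb rmorphM.
have [[a fa] [b gb]] := (Tf 0%N, Tg 0%N).
apply: polar_sum => i _; case: i => -[|i] /= ilt.
  by rewrite fa subn0; apply: polarZ; apply: (Tg n.+1).
have := Tf i.+1; rewrite /= => pf.
case E : (n.+1 - i.+1)%N => [|m]; last by apply: polarM => //; apply: (Tg m.+1).
by rewrite gb mulrC; apply: polarZ.
Qed.

(** With [f = p / eps^M = a / b], the power [eps^M] divides [p * b], hence [p], since [b] does not
    vanish at 0; but [p] has degree less than [M]. *)
Lemma polar_reg0_eq0 f : polar f -> reg0 f -> f = 0.
Proof.
move=> [p [M [pM fE]]] [a [b [b0 fb]]].
have E : p * b = a * 'X^M.
  by apply/eqP; rewrite -tofrac_eq !tofracM -fE -fb tofracXn mulrAC.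
have dvd : 'X^M %| p.
  rewrite -(@Gauss_dvdpl _ p b) ?E ?dvdp_mull//.
  by apply: coprimep_expl; rewrite coprimep_sym -['X]subr0 -polyC0 coprimep_XsubC.
suff p0 : p = 0.
  apply/eqP; move: fE; rewrite p0 tofrac0 => /eqP; rewrite mulf_eq0 expf_eq0.
  by rewrite tofrac_eq0 polyX_eq0 andbF orbF.
apply/eqP; apply: contraTT dvd => p0; apply/negP => /(dvdp_leq p0).
by rewrite size_polyXn leqNgt ltnS pM.
Qed.

Definition polar_pfrac (u : seq (K * nat * K)) : ratfun K :=
  \sum_(v <- u | v.1.1 == 0) ratC v.2 * eps ^- v.1.2.+1.

Lemma polar_pfracP p u : polar (polar_pfrac u) /\ reg0 (pfrac p u - polar_pfrac u).
Proof.
split; first by apply: polar_sum => v _; apply: polar_monom.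
rewrite /pfrac (bigID (fun v : K * nat * K => v.1.1 == 0))/=.
have E (x a b g : ratfun K) : x + (a + b) - g = x + (a - g) + b.
  by rewrite -!addrA [b - g]addrC.
rewrite E; apply: reg0D; last first.
  apply: reg0_sum => v v0; apply: reg0M; first exact: reg0_ratC.
  rewrite -[eps - _]tofracB -tofracXn; apply: reg0_inv.
  by rewrite horner_exp expf_neq0// hornerXsubC sub0r oppr_eq0.
apply: reg0D; first exact: reg0_tofrac.
rewrite (eq_bigr (fun v : K * nat * K => ratC v.2 * eps ^- v.1.2.+1)) ?subrr; first exact: reg00.
by move=> v /eqP ->; rewrite rmorph0 subr0.
Qed.

Lemma shift_pfrac c p u : shift c (pfrac p u) =
  pfrac (p \Po ('X + c%:P)) [seq (v.1.1 - c, v.1.2, v.2) | v <- u].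
Proof.
rewrite /pfrac rmorphD /= shift_tofrac rmorph_sum big_map; congr (_ + _).
apply: eq_bigr => v _ /=; rewrite rmorphM fmorphV rmorphXn /= shift_ratC.
by rewrite rmorphB /= shift_eps shift_ratC rmorphB opprB addrA [RHS]mulrC mulrC addrAC.
Qed.

End RationalFunctions.

Section PolarPart.
Variable K : closedFieldType.
Implicit Types f g : ratfun K.

Lemma polar_part_ex f : exists g, polar g /\ reg0 (f - g).
Proof.
have [p [u ->]] := pfrac_surj f; exists (polar_pfrac u); exact: polar_pfracP.
Qed.

Definition polar_part f : ratfun K := sval (cid (polar_part_ex f)).

Lemma polar_partP f : polar (polar_part f) /\ reg0 (f - polar_part f).
Proof. by rewrite /polar_part; case: cid. Qed.

Lemma polar_part_unique f g : polar g -> reg0 (f - g) -> polar_part f = g.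
Proof.
move=> pg fg; have [pf ff] := polar_partP f; apply/eqP; rewrite -subr_eq0.
apply/eqP/polar_reg0_eq0; first exact: polarB.
have -> : polar_part f - g = (f - g) - (f - polar_part f); last exact: reg0B.
by rewrite opprB [RHS]addrC addrA subrK.
Qed.

Fact polar_part_zmod : zmod_morphism polar_part.
Proof.
move=> f g; have [[pf ff] [pg gg]] := (polar_partP f, polar_partP g).
apply: polar_part_unique; first exact: polarB.
have -> : f - g - (polar_part f - polar_part g) = (f - polar_part f) - (g - polar_part g).
  by rewrite !opprB addrACA [RHS]addrACA [- g + _]addrC.
exact: reg0B.
Qed.
HB.instance Definition _ :=
  GRing.isZmodMorphism.Build (ratfun K) (ratfun K) polar_part polar_part_zmod.

Lemma polar_part_reg0 f : reg0 f -> polar_part f = 0.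
Proof. by move=> rf; apply: polar_part_unique; rewrite ?subr0//; apply: polar0. Qed.

(** Translation by [c] brings the polar part at [c] to 0, where [T_eps] puts all of them. Regular
    points are allowed in [C], so one list can serve for all coefficients up to a given order in
    [t]. *)
Lemma Teps_local f (C : seq K) : uniq C ->
  (forall c, c \notin C -> reg0 (shift c f)) ->
  Teps f = \sum_(c <- C) polar_part (shift c f).
Proof.
move=> uC; have [p [u ->]] := pfrac_surj f; rewrite Teps_pfracE => regC.
have ppE c : polar_part (shift c (pfrac p u)) =
    \sum_(v <- u | v.1.1 == c) ratC v.2 * eps ^- v.1.2.+1.
  rewrite shift_pfrac; have [pol reg] := polar_pfracP (p \Po ('X + c%:P))
    [seq (v.1.1 - c, v.1.2, v.2) | v <- u].
  rewrite (polar_part_unique pol reg) /polar_pfrac big_map.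
  by apply: eq_bigl => v /=; rewrite subr_eq0.
(* A term of the decomposition may sit at a point outside [C], where the terms cancel; enlarging [C]
   to [B] adds only zero polar parts. *)
pose B := C ++ [seq c <- undup [seq v.1.1 | v <- u] | c \notin C].
transitivity (\sum_(c <- B) polar_part (shift c (pfrac p u))); last first.
  rewrite big_cat /= [X in _ + X]big1_seq ?addr0// => c /andP[_].
  by rewrite mem_filter => /andP[/regC/polar_part_reg0].
under eq_bigr do rewrite ppE big_mkcond /=.
rewrite exchange_big /= /Teps_pfrac big_seq [RHS]big_seq; apply: eq_bigr => v uv.
have vB : v.1.1 \in B.
  rewrite mem_cat mem_filter mem_undup (map_f (fun v : K * nat * K => v.1.1) uv) andbT.
  by case: (v.1.1 \in C).
have uB : uniq B.
  rewrite cat_uniq uC filter_uniq ?undup_uniq// andbT; apply/hasPn => c.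
  by rewrite mem_filter => /andP[].
rewrite (bigD1_seq v.1.1)//= eqxx big1 ?addr0// => c.
by rewrite eq_sym => /negPf ->.
Qed.

End PolarPart.

(** * Differential operators as infinite matrices *)

Section Action.
Variables (F : fieldType) (A : comNzRingType) (inj : {rmorphism F -> A}).
Implicit Types p q : {poly F}.

Section OneMap.
Variable theta : {additive A -> A}.

Definition pact p v := \sum_(i < size p) inj p`_i * iter i theta v.

Fact iter_additive_zmod i : zmod_morphism (iter i theta).
Proof. by elim: i => [//|i IHi] u v; rewrite !iterS IHi raddfB. Qed.
HB.instance Definition _ i :=
  GRing.isZmodMorphism.Build A A (iter i theta) (iter_additive_zmod i).

Fact pact_zmod p : zmod_morphism (pact p).
Proof.
by move=> u v; rewrite /pact -sumrB; apply: eq_bigr => i _; rewrite raddfB mulrBr.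
Qed.
HB.instance Definition _ p := GRing.isZmodMorphism.Build A A (pact p) (pact_zmod p).

Lemma pact_widen N p v : (size p <= N)%N ->
  pact p v = \sum_(i < N) inj p`_i * iter i theta v.
Proof.
move=> pN; rewrite /pact (big_ord_widen _ (fun i => inj p`_i * iter i theta v) pN).
rewrite big_mkcond; apply: eq_bigr => i _; case: ltnP => // /(nth_default 0) ->.
by rewrite rmorph0 mul0r.
Qed.

Lemma pactD p q v : pact (p + q) v = pact p v + pact q v.
Proof.
set N := maxn (size p) (size q).
rewrite (@pact_widen N (p + q)) ?size_polyD// (@pact_widen N p) ?leq_maxl//.
rewrite (@pact_widen N q) ?leq_maxr// -big_split; apply: eq_bigr => i _ /=.
by rewrite coefD rmorphD mulrDl.
Qed.

Lemma pact0 v : pact 0 v = 0.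
Proof. by rewrite /pact size_poly0 big_ord0. Qed.

Lemma pact_sum (I : Type) (r : seq I) (P : pred I) (G : I -> {poly F}) v :
  pact (\sum_(i <- r | P i) G i) v = \sum_(i <- r | P i) pact (G i) v.
Proof.
by elim/big_rec2: _ => [|i x y _ <-]; [exact: pact0|exact: pactD].
Qed.

Lemma pactC c v : pact c%:P v = inj c * v.
Proof.
by rewrite (@pact_widen 1) ?size_polyC_leq1// big_ord1 coefC.
Qed.

Lemma pact_cons p c v : pact (p * 'X + c%:P) v = pact p (theta v) + inj c * v.
Proof.
rewrite pactD pactC (@pact_widen (size p).+1); last first.
  by apply: leq_trans (size_polyMleq _ _) _; rewrite size_polyX addn2.
rewrite big_ord_recl coefMX rmorph0 mul0r add0r; congr (_ + _).
by apply: eq_bigr => i _; rewrite lift0 coefMX iterSr.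
Qed.

Lemma pactX v : pact 'X v = theta v.
Proof.
have := pact_cons 1 0 v; rewrite mul1r polyC0 addr0 rmorph0 mul0r addr0 => ->.
by rewrite -polyC1 pactC rmorph1 mul1r.
Qed.

Hypothesis theta_inj : forall c v, theta (inj c * v) = inj c * theta v.

Lemma pact_theta p v : pact p (theta v) = theta (pact p v).
Proof.
rewrite /pact raddf_sum; apply: eq_bigr => i _.
by rewrite theta_inj -iterS iterSr.
Qed.

Lemma pactZ c p v : pact (c *: p) v = inj c * pact p v.
Proof.
rewrite (@pact_widen (size p)) ?size_scale_leq// mulr_sumr.
by apply: eq_bigr => i _; rewrite coefZ rmorphM mulrA.
Qed.

Lemma pactM p q v : pact (p * q) v = pact p (pact q v).
Proof.
elim/poly_ind: p v => [|p a IHp] v; first by rewrite mul0r !pact0.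
rewrite pact_cons -pact_theta -IHp mulrDl mul_polyC pactD pactZ; congr (_ + _).
rewrite -mulrA ['X * _]mulrC mulrA.
by have := pact_cons (p * q) 0 v; rewrite polyC0 addr0 rmorph0 mul0r addr0.
Qed.

Lemma pact1 v : pact 1 v = v.
Proof. by rewrite -polyC1 pactC rmorph1 mul1r. Qed.

Lemma pact_exp p n v : pact (p ^+ n) v = iter n (pact p) v.
Proof. by elim: n => [|n IHn]; rewrite ?expr0 ?pact1// exprS pactM IHn. Qed.

End OneMap.

Lemma pact_comp (theta theta' : {additive A -> A}) q p v :
  (forall c v, theta (inj c * v) = inj c * theta v) ->
  (forall v, theta' v = pact theta q v) ->
  pact theta' p v = pact theta (p \Po q) v.
Proof.
move=> th E; elim/poly_ind: p v => [|p a IHp] v; first by rewrite comp_poly0 !pact0.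
by rewrite pact_cons comp_polyD comp_polyM comp_polyX comp_polyC pactD pactM// pactC IHp E.
Qed.

End Action.

Section Symbol.
Variables (F : fieldType).
Implicit Types (q : seq (laurent F)).

(** Falling factorial: [x^j (d/dx)^j] is this polynomial in [x d/dx]. *)
Definition ffpoly j : {poly F} := \prod_(i < j) ('X - i%:R%:P).

(** The part of [q] that is homogeneous of degree [d]: as [x^(d + j) (d/dx)^j] is [x^d] times a
    polynomial in [x d/dx], the operator [q] is the sum of the [x^d (symbol q d)(x d/dx)]. *)
Definition symbol q (d : int) : {poly F} := \sum_(j < size q) q`_j (d + j%:Z) *: ffpoly j.

(* The operator [q] maps [x^m v] to the sum of the [x^n (op_entry q n m) v],
   where the variable stands for the action of [x d/dx] on [v]. *)
Definition op_entry q (n m : int) : {poly F} := symbol q (n - m) \Po ('X + m%:~R%:P).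

(** [q] lowers exponents by at most [b]; nothing bounds how far it raises them. *)
Definition band (b : nat) q := forall (j : nat) (n : int), n < j%:Z - b%:Z -> q`_j n = 0.

Lemma band_exists q : exists b, band b q.
Proof.
have [B Bq] : exists B : nat, forall j (n : int), n < - B%:Z -> q`_j n = 0.
  elim: q => [|f q [B IHq]]; first by exists 0%N => j n _; rewrite nth_nil.
  have [N fN] := laurent_bounded f; exists (maxn B `|N|%N) => -[|j] n nlt /=.
    by apply: fN; lia.
  by apply: IHq; lia.
exists (B + size q)%N => j n nlt.
have [/(nth_default 0) ->//|jq] := leqP (size q) j.
by apply: Bq; lia.
Qed.

Lemma band_widen b b' q : (b <= b')%N -> band b q -> band b' q.
Proof. by move=> bb qb j n nj; apply: qb; lia. Qed.

Lemma op_entry0 b q n m : band b q -> n < m - b%:Z -> op_entry q n m = 0.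
Proof.
move=> qb nm; rewrite /op_entry /symbol big1 ?comp_poly0// => j _.
by rewrite qb ?scale0r//; lia.
Qed.

End Symbol.

Section DiffOp.
Variables (F : fieldType) (A : comNzRingType).
Variables (inj : {rmorphism F -> A}) (theta : {additive A -> A}).
Hypothesis theta_inj : forall c v, theta (inj c * v) = inj c * theta v.
Implicit Types (f g : laurent A) (q : seq (laurent F)).
Local Notation dx := (dx theta).
Local Notation pact := (pact inj theta).

Fact dx_zmod : zmod_morphism dx.
Proof.
by move=> f g; apply/laurentP => n /=; rewrite raddfB mulrzBl opprD addrACA.
Qed.
HB.instance Definition _ := GRing.isZmodMorphism.Build (laurent A) (laurent A) dx dx_zmod.

Fact iter_dx_zmod j : zmod_morphism (iter j dx).
Proof. by elim: j => [//|j IHj] f g; rewrite !iterS IHj raddfB. Qed.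

Fact diffop_zmod q : zmod_morphism (diffop inj theta q).
Proof.
move=> f g; rewrite /diffop -sumrB; apply: eq_bigr => j _.
by rewrite iter_dx_zmod mulrBr.
Qed.

Lemma pact_XaddC (c : int) v : pact ('X + c%:~R%:P) v = theta v + v *~ c.
Proof. by rewrite pactD pactX pactC rmorph_int mulrzl. Qed.

Lemma dxE f n : dx f n = pact ('X + (n + 1)%:~R%:P) (f (n + 1)).
Proof. by rewrite pact_XaddC. Qed.

Lemma iter_dxE j f n :
  iter j dx f n = pact (ffpoly F j \Po ('X + (n + j%:Z)%:~R%:P)) (f (n + j%:Z)).
Proof.
elim: j n => [|j IHj] n.
  by rewrite /ffpoly big_ord0 -polyC1 comp_polyC polyC1 pact1// addr0.
rewrite [LHS](dxE (iter j dx f)) IHj -pactM//.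
have E : n + 1 + j%:Z = n + j.+1%:Z by lia.
rewrite E mulrC /ffpoly big_ord_recr comp_polyM; congr (pact (_ * _) _).
rewrite comp_polyB comp_polyX comp_polyC -addrA -polyCB; congr ('X + _%:P).
by rewrite -E rmorphD rmorphD /= -pmulrn addrK -rmorphD.
Qed.

Lemma opPE (r : seq F) f n :
  opP inj theta r f n = pact (\prod_(c <- r) ('X + (n%:~R - c)%:P)) (f n).
Proof.
elim: r => [|c r IHr]; first by rewrite big_nil pact1.
rewrite big_cons [LHS]laurent_coefD laurent_coefN laurent_coef_monomM laurent_coefCM.
rewrite mul1r dxE subrK IHr pactM// polyCB addrA.
by rewrite [RHS]pactD -polyCN pactC rmorphN mulNr.
Qed.

(** A position may be left out of the window for either of two reasons: [f] is zero there, or [q]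
    cannot bring it to [n]. *)
Lemma diffop_coef q f n lo W :
  (forall m : int, (m < lo) || (lo + W%:Z <= m) ->
     f m = 0 \/ forall j, q`_j (n - m + j%:Z) = 0) ->
  diffop inj theta q f n =
  \sum_(i < W) pact (op_entry q n (lo + i%:Z)) (f (lo + i%:Z)).
Proof.
move=> out; rewrite /diffop laurent_coef_sum.
transitivity (\sum_(j < size q) \sum_(i < W)
    pact (q`_j (n - (lo + i%:Z) + j%:Z) *: ffpoly F j \Po ('X + (lo + i%:Z)%:~R%:P))
      (f (lo + i%:Z))).
  apply: eq_bigr => j _; rewrite mulrC (@laurent_coefM_window _ _ _ (lo - j%:Z) W).
    apply: eq_bigr => i _; rewrite iter_dxE -/(laurent_map inj) comp_polyZ pactZ mulrC.
    have -> : lo - j%:Z + i%:Z + j%:Z = lo + i%:Z by lia.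
    by congr (inj (q`_j _) * _); lia.
  move=> m mout; have [|fm|qm] := out (m + j%:Z); first by lia.
    by rewrite iter_dxE fm raddf0 mul0r.
  rewrite [X in _ * X](_ : _ = 0) ?mulr0//=.
  rewrite (_ : n - m = n - (m + j%:Z) + j%:Z); last by lia.
  by rewrite qm rmorph0.
rewrite exchange_big; apply: eq_bigr => i _ /=.
rewrite -pact_sum /op_entry /symbol; congr (pact _ _).
by rewrite raddf_sum.
Qed.

End DiffOp.

Section DiffOpCommute.
Variables (F : fieldType) (A : comNzRingType).
Variables (inj : {rmorphism F -> A}) (theta h : {additive A -> A}).
Hypothesis h_inj : forall c v, h (inj c * v) = inj c * h v.
Hypothesis h_theta : forall v, h (theta v) = theta (h v).

Lemma laurent_map_injM (a : laurent F) (g : laurent A) :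
  laurent_map h (laurent_map inj a * g) = laurent_map inj a * laurent_map h g.
Proof.
apply/laurentP => n; rewrite -[LHS]/(h ((laurent_map inj a * g) n)).
have [b ab] := laurent_bounded a; have [c gc] := laurent_bounded g.
have ag0 m : (m < b) || (b + (absz (n - c - b)%R).+1%:Z <= m) -> a m = 0 \/ g (n - m) = 0.
  by move=> /orP[/ab|bm]; [left|right; apply: gc; lia].
rewrite !(@laurent_coefM_window _ _ _ b (absz (n - c - b)%R).+1).
- by rewrite raddf_sum; apply: eq_bigr => i _; rewrite h_inj.
- by move=> m /ag0[] /= ->; rewrite !raddf0 ?mul0r ?mulr0.
- by move=> m /ag0[] /= ->; rewrite ?raddf0 ?mul0r ?mulr0.
Qed.

Lemma laurent_map_dx f : laurent_map h (dx theta f) = dx theta (laurent_map h f).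
Proof. by apply/laurentP => n /=; rewrite raddfD raddfMz h_theta. Qed.

Lemma laurent_map_diffop q f :
  laurent_map h (diffop inj theta q f) = diffop inj theta q (laurent_map h f).
Proof.
rewrite /diffop raddf_sum; apply: eq_bigr => j _; rewrite [LHS]laurent_map_injM.
by congr (_ * _); elim: (j : nat) => //= i <-; rewrite laurent_map_dx.
Qed.

Lemma laurent_map_opP r f :
  laurent_map h (opP inj theta r f) = opP inj theta r (laurent_map h f).
Proof.
elim: r => //= c r <-; set g := opP _ _ r f; apply/laurentP => n.
rewrite -[LHS]/(h ((euler theta g - laurentC (inj c) * g) n)) /euler.
have E (t : {additive A -> A}) (g' : laurent A) :
    (laurent_monom 1 1 * dx t g' - laurentC (inj c) * g') n =
    t (g' (n - 1 + 1)) + g' (n - 1 + 1) *~ (n - 1 + 1) - inj c * g' n.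
  by rewrite laurent_coefD laurent_coefN laurent_coef_monomM laurent_coefCM mul1r.
by rewrite !E raddfB /= h_inj raddfD raddfMz h_theta.
Qed.

End DiffOpCommute.

(** * Operators with constant coefficients in the derivation by [log x] *)

Section DerivativeAction.
Variable F : fieldType.
Hypothesis charF : [pchar F] =i pred0.
Implicit Types (p q v w : {poly F}).

Let natF0 n : (n.+1%:R == 0 :> F) = false.
Proof. by rewrite (pcharf0P F).1. Qed.

Local Notation dact := (pact (@polyC F) (@deriv F)).

Lemma deriv_polyCM c v : (c%:P * v)^`() = c%:P * v^`().
Proof. by rewrite mul_polyC derivZ mul_polyC. Qed.

Lemma iter_deriv i v : iter i (@deriv F) v = v^`(i).
Proof. by elim: i => //= i ->; rewrite derivnS. Qed.

Lemma dact_Xn n v : dact 'X^n v = v^`(n).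
Proof.
rewrite pact_exp; last exact: deriv_polyCM.
by rewrite -iter_deriv; elim: n => //= n ->; rewrite pactX.
Qed.

Lemma size_iter_deriv i v : (size v^`(i) <= size v)%N.
Proof.
elim: i => // i IHi; rewrite derivnS; apply: leq_trans IHi.
apply: leq_trans (size_poly _ _) _; exact: leq_pred.
Qed.

Lemma size_dact p v : (size (dact p v) <= size v)%N.
Proof.
apply: leq_trans (size_sum _ _ _) _; apply/bigmax_leqP => i _.
by rewrite iter_deriv mul_polyC (leq_trans (size_scale_leq _ _))// size_iter_deriv.
Qed.

Lemma deriv_inj0 v : v^`() = 0 -> v.[0] = 0 -> v = 0.
Proof.
move=> /polyP dv v0; apply/polyP => -[|i]; first by rewrite -horner_coef0 v0 coef0.
move: (dv i); rewrite coef_deriv !coef0 -mulr_natr => /eqP.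
by rewrite mulf_eq0 natF0 orbF => /eqP.
Qed.

Lemma derivn_inj0 m v : v^`(m) = 0 -> (forall a, (a < m)%N -> v^`(a).[0] = 0) -> v = 0.
Proof.
elim: m v => // m IHm v vm v0; apply: deriv_inj0; last exact: (v0 0%N).
by apply: IHm => [|a am]; rewrite -derivSn//; apply: v0.
Qed.

(** The normalization at 0 makes the primitive complementary to the kernel; the size bound controls
    the degree in [log x]. *)
Lemma integral_ex m w : exists y, [/\ y^`(m) = w,
  forall a, (a < m)%N -> y^`(a).[0] = 0 & (size y <= size w + m)%N].
Proof.
elim: m w => [|m IHm] w; first by exists w; rewrite addn0.
pose z := \poly_(i < (size w).+1) (if i is j.+1 then w`_j / j.+1%:R else 0).
have zw : z^`() = w.
  apply/polyP => i; rewrite coef_deriv coef_poly ltnS; case: ltnP => [_|iw].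
    by rewrite -[LHS]mulr_natr divfK// natF0.
  by rewrite mul0rn nth_default.
have [y [ym y0 sy]] := IHm z; exists y; split; first by rewrite derivnS ym.
  move=> a; rewrite ltnS leq_eqVlt => /orP[/eqP ->|/y0//].
  by rewrite ym horner_coef0 coef_poly.
by apply: leq_trans sy _; rewrite addnS -addSn leq_add2r; apply: size_poly.
Qed.

(** Differentiation is nilpotent on polynomials of bounded degree, so a polynomial in it with
    nonzero constant term is invertible there; the inverse comes from a Bezout relation with
    ['X^N]. *)
Lemma dact_unit q N : q.[0] != 0 ->
  exists g, forall v, (size v <= N)%N -> dact (g * q) v = v.
Proof.
move=> q0; have : coprimep q 'X^N.
  by apply: coprimep_expr; rewrite -['X]subr0 -polyC0 coprimep_XsubC.
move=> /Bezout_eq1_coprimepP[[g w]/= gw]; exists g => v vN.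
have := pact1 polyC (@deriv F) v; rewrite -gw pactD [X in _ + X]pactM; last exact: deriv_polyCM.
by rewrite dact_Xn derivn_poly0// raddf0 addr0.
Qed.

Lemma dact_solve m q w : q.[0] != 0 -> exists y, [/\ dact ('X^m * q) y = w,
  forall a, (a < m)%N -> y^`(a).[0] = 0 & (size y <= size w + m)%N].
Proof.
move=> q0; have [g gq] := dact_unit (size w) q0.
have [y [yw y0 sy]] := integral_ex m (dact g w); exists y; split=> //.
  rewrite mulrC pactM; last exact: deriv_polyCM.
  rewrite dact_Xn yw -pactM; last exact: deriv_polyCM.
  by rewrite mulrC gq.
by apply: leq_trans sy _; rewrite leq_add2r size_dact.
Qed.

Lemma dact_inj0 m q v : q.[0] != 0 -> dact ('X^m * q) v = 0 ->
  (forall a, (a < m)%N -> v^`(a).[0] = 0) -> v = 0.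
Proof.
move=> q0; rewrite mulrC pactM; last exact: deriv_polyCM.
rewrite dact_Xn => qv; apply: derivn_inj0.
have [g gq] := dact_unit (size v^`(m)) q0.
rewrite -[LHS](gq _ (leqnn _)) pactM; last exact: deriv_polyCM.
by rewrite qv raddf0.
Qed.

End DerivativeAction.

(** * Logarithmic solutions *)

Section LogSide.
Variables (F : fieldType) (charF : [pchar F] =i pred0) (s : F) (r : seq F).
Implicit Types (u v : laurent {poly F}) (q : seq (laurent F)).
Local Notation V := (laurent {poly F}).
Local Notation dact := (pact (@polyC F) (@deriv F)).
Local Notation dact_lin := (@deriv_polyCM F).

Lemma intr_inj0 : injective (fun n : int => n%:~R : F).
Proof.
have natF0 n : (n.+1%:R == 0 :> F) = false by rewrite (pcharf0P F).1.
move=> n m /eqP; rewrite -subr_eq0 -rmorphB => nm; apply/eqP; rewrite -subr_eq0.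
by case: (n - m) nm => [[|k]|k] //=; rewrite ?NegzE ?mulrNz ?oppr_eq0 -pmulrn natF0.
Qed.

Definition exp_mult (n : int) := count_mem (s + n%:~R) r.
(** [P] acts on [x^(s + n) v] through this polynomial in the derivation by [log x]; it vanishes at 0
    to the order given by the multiplicity of [s + n] in [r]. *)
Definition indicial (n : int) : {poly F} := \prod_(c <- r) ('X + (s + n%:~R - c)%:P).
Definition indicial_unit (n : int) : {poly F} :=
  \prod_(c <- r | c != s + n%:~R) ('X + (s + n%:~R - c)%:P).

Lemma indicialE n : indicial n = 'X^(exp_mult n) * indicial_unit n.
Proof.
rewrite /indicial (bigID (pred1 (s + n%:~R)))/=; congr (_ * _).
rewrite (eq_bigr (fun=> 'X)) => [|c /eqP ->]; last by rewrite subrr addr0.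
by rewrite big_const_seq iter_mulr_1.
Qed.

Lemma indicial_unit0 n : (indicial_unit n).[0] != 0.
Proof.
rewrite /indicial_unit horner_prod; elim/big_rec: _ => [|c x cn x0]; first exact: oner_neq0.
by rewrite mulf_neq0// hornerD hornerX hornerC add0r subr_eq0 eq_sym.
Qed.

Lemma theta_log_polyCM c (v : {poly F}) : theta_log s (c%:P * v) = c%:P * theta_log s v.
Proof. by rewrite /theta_log mulrDr -scalerAr deriv_polyCM. Qed.

Lemma pact_theta_log p (v : {poly F}) :
  pact (@polyC F) (theta_log s) p v = dact (p \Po ('X + s%:P)) v.
Proof.
apply: pact_comp; first exact: dact_lin.
by move=> {}v; rewrite pactD pactX pactC mul_polyC /theta_log addrC.
Qed.

Definition op_log v : V := opP (@polyC F) (theta_log s) r v.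

Lemma op_logE v n : op_log v n = dact (indicial n) (v n).
Proof.
rewrite /op_log opPE; last exact: theta_log_polyCM.
rewrite pact_theta_log; congr (pact _ _ _ _); rewrite /indicial.
elim: r => [|c r' IHr]; first by rewrite !big_nil rmorph1.
rewrite !big_cons comp_polyM IHr comp_polyD comp_polyX comp_polyC.
by rewrite -!addrA -polyCD addrA.
Qed.

Fact op_log_zmod : zmod_morphism op_log.
Proof.
move=> u v; apply/laurentP => n.
by rewrite laurent_coefD laurent_coefN !op_logE laurent_coefD laurent_coefN raddfB.
Qed.
HB.instance Definition _ := GRing.isZmodMorphism.Build V V op_log op_log_zmod.

Definition qop_log q v : V := diffop (@polyC F) (theta_log s) q v.
HB.instance Definition _ q := GRing.isZmodMorphism.Build V V (qop_log q)
  (diffop_zmod (@polyC F) (theta_log s) q).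

Definition log_entry q n m := op_entry q n m \Po ('X + s%:P).

Lemma qop_log_coef q v n lo W :
  (forall m : int, (m < lo) || (lo + W%:Z <= m) ->
     v m = 0 \/ forall j, q`_j (n - m + j%:Z) = 0) ->
  qop_log q v n = \sum_(i < W) dact (log_entry q n (lo + i%:Z)) (v (lo + i%:Z)).
Proof.
move=> out; rewrite /qop_log (@diffop_coef _ _ _ _ theta_log_polyCM _ _ _ lo W)//.
by apply: eq_bigr => i _; rewrite pact_theta_log.
Qed.

Lemma qop_log_local b q u v n : band b q ->
  (forall m, m <= n + b%:Z -> u m = v m) -> qop_log q u n = qop_log q v n.
Proof.
move=> qb uv; apply/eqP; rewrite -subr_eq0 -laurent_coefN -laurent_coefD -raddfB.
rewrite (@qop_log_coef _ _ _ 0 0) ?big_ord0// => m _.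
have [mn|nm] := leP m (n + b%:Z); first by left; rewrite laurent_coefD laurent_coefN uv ?subrr.
by right=> j; apply: qb; lia.
Qed.

Definition scl (c : F) v : V := laurent_map ( *:%R c) v.
HB.instance Definition _ c := GRing.isZmodMorphism.Build V V (scl c) (laurent_map_zmod ( *:%R c)).

Lemma sclE c v : scl c v = laurentC c%:P * v.
Proof. by apply/laurentP => n; rewrite laurent_coefCM mul_polyC. Qed.

Definition dlog v : V := laurent_map (@deriv F) v.
HB.instance Definition _ := GRing.isZmodMorphism.Build V V dlog (laurent_map_zmod (@deriv F)).

Lemma op_log_scl c v : op_log (scl c v) = scl c (op_log v).
Proof.
apply/esym/laurent_map_opP => [c' {}v|{}v] /=; first exact: scalerAr.
by rewrite -!mul_polyC theta_log_polyCM.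
Qed.

Lemma qop_log_scl q c v : qop_log q (scl c v) = scl c (qop_log q v).
Proof.
apply/esym/laurent_map_diffop => [c' {}v|{}v] /=; first exact: scalerAr.
by rewrite -!mul_polyC theta_log_polyCM.
Qed.

Let deriv_theta (v : {poly F}) : (theta_log s v)^`() = theta_log s v^`().
Proof. by rewrite /theta_log derivD derivZ. Qed.

Lemma dlog_op v : dlog (op_log v) = op_log (dlog v).
Proof. by apply: laurent_map_opP => [c {}v|{}v] /=; [exact: dact_lin|exact: deriv_theta]. Qed.

Lemma dlog_qop q v : dlog (qop_log q v) = qop_log q (dlog v).
Proof. by apply: laurent_map_diffop => [c {}v|{}v] /=; [exact: dact_lin|exact: deriv_theta]. Qed.

Lemma dlog_scl c v : dlog (scl c v) = scl c (dlog v).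
Proof. by apply/laurentP => n; apply: derivZ. Qed.

(** This is [a!] times the coefficient of [x^n (log x)^a]; so normalized, the derivation by [log x]
    simply raises [a]. *)
Definition coef_log (x : int * nat) v : F := (v x.1)^`(x.2).[0].

Fact coef_log_zmod x : zmod_morphism (coef_log x).
Proof. by move=> u v; rewrite /coef_log laurent_coefD laurent_coefN derivnB hornerD hornerN. Qed.
HB.instance Definition _ x := GRing.isZmodMorphism.Build V F (coef_log x) (coef_log_zmod x).

Lemma coef_log_scl x c v : coef_log x (scl c v) = c * coef_log x v.
Proof. by rewrite /coef_log /= derivnZ hornerZ. Qed.

Lemma coef_log_dlog n a v m : coef_log (n, a) (iter m dlog v) = coef_log (n, (m + a)%N) v.
Proof.
elim: m a => // m IHm a; rewrite addSnnS -IHm.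
by rewrite -[RHS]/((iter m dlog v n)^`(a.+1).[0]) derivSn.
Qed.

(** Zero is sent to zero by definition, so that [inv_log] yields series bounded below. *)
Definition inv_at (n : int) (w : {poly F}) : {poly F} :=
  if w == 0 then 0 else sval (cid (dact_solve charF (exp_mult n) w (indicial_unit0 n))).

Lemma inv_at0 n : inv_at n 0 = 0. Proof. by rewrite /inv_at eqxx. Qed.

Lemma inv_atP n w : [/\ dact (indicial n) (inv_at n w) = w,
  forall a, (a < exp_mult n)%N -> (inv_at n w)^`(a).[0] = 0 &
  (size (inv_at n w) <= size w + exp_mult n)%N].
Proof.
rewrite indicialE /inv_at; case: eqP => [->|_]; last by case: cid.
by split=> [|a _|]; rewrite ?raddf0 ?horner0 ?size_poly0.
Qed.

Fact inv_log_bounded v : exists N : int, forall n, n < N -> inv_at n (v n) = 0.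
Proof. by have [N vN] := laurent_bounded v; exists N => n /vN ->; apply: inv_at0. Qed.
Definition inv_log v : V := Laurent (inv_log_bounded v).

Lemma op_inv_log v : op_log (inv_log v) = v.
Proof. by apply/laurentP => n; rewrite op_logE; have [] := inv_atP n (v n). Qed.

Definition int_part (c : F) : int :=
  if pselect (congrZ c s) is left e then sval (cid e) else 0.

Lemma int_partE n : int_part (s + n%:~R) = n.
Proof.
rewrite /int_part; case: pselect => [e|[]]; last by exists n; rewrite addrC addKr.
by case: cid => m /= /esym; rewrite addrC addKr => /intr_inj0.
Qed.

Lemma congrZE c : congrZ c s -> c = s + (int_part c)%:~R.
Proof. by move=> [n cn]; rewrite -(subrK s c) cn addrC int_partE. Qed.

Definition exps : seq int := undup [seq int_part c | c <- r & `[< congrZ c s >]].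

Lemma mem_exps n : (n \in exps) = (0 < exp_mult n)%N.
Proof.
rewrite mem_undup -has_count has_pred1; apply/mapP/idP => [[c]|rn].
  by rewrite mem_filter => /andP[/asboolP/congrZE cE rc] ->; rewrite -cE.
exists (s + n%:~R); last by rewrite int_partE.
by rewrite mem_filter rn andbT; apply/asboolP; exists n; rewrite addrC addKr.
Qed.

(** Labels of the basis [x^(s + n) (log x)^a / a!] of the kernel of [P]. *)
Definition exp_pairs : seq (int * nat) := [seq (n, a) | n <- exps, a <- iota 0 (exp_mult n)].

Lemma mem_exp_pairs n a : ((n, a) \in exp_pairs) = (a < exp_mult n)%N.
Proof.
apply/allpairsPdep/idP => [[m [b [_]]]|an]; first by rewrite mem_iota add0n => bm [-> ->].
by exists n, a; rewrite mem_exps mem_iota add0n (leq_ltn_trans _ an).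
Qed.

Lemma uniq_exp_pairs : uniq exp_pairs.
Proof.
apply: allpairs_uniq_dep; first exact: undup_uniq.
  by move=> n _; apply: iota_uniq.
by move=> [n a] [m b] _ _ [-> ->].
Qed.

Lemma size_exp_pairs : size exp_pairs == class_size r s.
Proof.
rewrite size_allpairs_dep sumnE big_map.
under eq_bigr do rewrite size_iota /exp_mult -sum1_count big_mkcond.
rewrite exchange_big /class_size -sum1_count; apply/eqP; rewrite [RHS]big_mkcond /=.
apply: eq_big_seq => c rc; case: asboolP => [cs|ncs]; last first.
  rewrite big1// => n _; case: eqP => // cE; case: ncs.
  by exists n; rewrite cE addrC addKr.
have cE := congrZE cs.
have ce : int_part c \in exps by rewrite mem_exps -has_count has_pred1 -cE.
rewrite (bigD1_seq (int_part c)) ?undup_uniq//= -cE eqxx big1 ?addn0// => n nc.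
by rewrite {1}cE; case: eqP => // /addrI/intr_inj0 nE; rewrite nE eqxx in nc.
Qed.

Definition exp_tuple : (class_size r s).-tuple (int * nat) := Tuple size_exp_pairs.

Local Notation k := (class_size r s).
Local Notation index_of := (tnth exp_tuple).

Lemma index_of_inj : injective index_of.
Proof. exact/tuple_uniqP/uniq_exp_pairs. Qed.

Lemma index_ofP (b : 'I_k) : ((index_of b).2 < exp_mult (index_of b).1)%N.
Proof. by rewrite -mem_exp_pairs -surjective_pairing; apply: mem_tnth. Qed.

Definition log_monom (b : 'I_k) : V :=
  laurent_monom ((index_of b).2`!%:R^-1 *: 'X^((index_of b).2)) (index_of b).1.

Lemma coef_log_monom x b : coef_log x (log_monom b) = (x == index_of b)%:R.
Proof.
case: x => n a; rewrite /coef_log /log_monom /=; case: (index_of b) => m c /=.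
rewrite xpair_eqE; case: eqP => _ /=; last by rewrite raddf0 horner0.
rewrite derivnZ derivnXn hornerZ hornerMn hornerXn.
have f0 : c`!%:R != 0 :> F by rewrite (pcharf0P F).1// -lt0n fact_gt0.
case: (ltngtP a c) => ac; last by rewrite ac subnn ffactnn expr0 mulVf.
  by rewrite expr0n subn_eq0 leqNgt ac mul0rn mulr0.
by rewrite ffact_small// mulr0n mulr0.
Qed.

Lemma op_log_monom b : op_log (log_monom b) = 0.
Proof.
apply/laurentP => n; rewrite op_logE /log_monom /=; case: eqP => [->|_]; last by rewrite raddf0.
rewrite indicialE mulrC pactM; last exact: dact_lin.
by rewrite dact_Xn derivnZ derivnXn ffact_small ?index_ofP// mulr0n scaler0 raddf0.
Qed.

Lemma coef_inv_log (b : 'I_k) v : coef_log (index_of b) (inv_log v) = 0.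
Proof. by rewrite /coef_log /=; have [_ -> //] := inv_atP (index_of b).1 (v (index_of b).1); apply: index_ofP. Qed.

Lemma op_log_inj v : op_log v = 0 -> (forall b : 'I_k, coef_log (index_of b) v = 0) -> v = 0.
Proof.
move=> /laurentP v0 cv; apply/laurentP => n; have := v0 n.
rewrite op_logE indicialE => /(dact_inj0 charF); apply; first exact: indicial_unit0.
move=> a; rewrite -mem_exp_pairs -[_ \in _]/((n, a) \in exp_tuple) => /tnthP[b nab].
have := cv b.
by rewrite /coef_log -nab.
Qed.

End LogSide.

Section LogSolutions.
Variables (F : fieldType) (charF : [pchar F] =i pred0) (s : F) (r : seq F).
Local Notation V := (laurent {poly F}).
Local Notation k := (class_size r s).
Local Notation dact := (pact (@polyC F) (@deriv F)).
Local Notation scA := (fun c : F => scl c : {additive V -> V}).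
Local Notation index_of := (tnth (exp_tuple charF s r)).
Local Notation J := (inv_log charF s r).
Local Notation e0 := (@log_monom F charF s r).
Local Notation co := (fun b : 'I_k => coef_log (index_of b)).

Definition log_sol (Q : nat -> {additive V -> V}) : 'I_k -> nat -> V := fsol J e0 Q.

Definition log_monodromy (Q : nat -> {additive V -> V}) : 'M[fps F]_k :=
  monodromy J (co : 'I_k -> {additive V -> F}) e0 Q (@dlog F).

Section Operator.
Variable Q : nat -> {additive V -> V}.
Hypothesis Q_sc : forall i c v, Q i (scl c v) = scl c (Q i v).
Hypothesis dQ : forall i v, dlog (Q i v) = Q i (dlog v).
Local Notation P := (@op_log F s r).
Local Notation sol := (log_sol Q).

Lemma log_sol0 b : sol b 0 = e0 b.
Proof. by []. Qed.

Lemma log_solS b n : sol b n.+1 = - J (\sum_(1 <= i < n.+2) Q i (sol b (n.+1 - i)%N)).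
Proof. exact: fsolS. Qed.

Lemma formal_op_log_sol b j : formal_op P Q (sol b) j = 0.
Proof.
apply: formal_op_fsol; [exact: op_inv_log|exact: op_log_monom].
Qed.

Lemma log_monodromyE a b j : log_monodromy Q a b j = coef_log (index_of a) (dlog (sol b j)).
Proof. by rewrite mxE. Qed.

Lemma log_sol_span f : (forall j, formal_op P Q f j = 0) ->
  forall j, f j = fcomb scA J e0 Q (fun a i => coef_log (index_of a) (f i)) j.
Proof.
apply: (@formal_sol_span _ _ scA P J _ (co : 'I_k -> {additive V -> F}) e0) => //.
- exact: op_log_scl.
- by move=> a c v; apply: coef_log_scl.
- exact: op_inv_log.
- exact: coef_inv_log.
- exact: op_log_monom.
- by move=> a b; rewrite /= coef_log_monom (inj_eq (@index_of_inj _ _ _ _)).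
- exact: op_log_inj.
Qed.

Lemma dlog_sol b j : dlog (sol b j) = fcomb scA J e0 Q (fun a => log_monodromy Q a b) j.
Proof.
apply: (@d_fsol _ _ scA P J _ (co : 'I_k -> {additive V -> F}) e0) => //.
- exact: op_log_scl.
- by move=> a c v; apply: coef_log_scl.
- exact: op_inv_log.
- exact: coef_inv_log.
- exact: op_log_monom.
- by move=> a a'; rewrite /= coef_log_monom (inj_eq (@index_of_inj _ _ _ _)).
- exact: op_log_inj.
- exact: dlog_op.
Qed.

Lemma coef_iter_dlog x m b :
  Fps (fun j => coef_log (x.1, (m + x.2)%N) (sol b j)) =
  \sum_a Fps (fun j => coef_log x (sol a j)) * (log_monodromy Q ^+ m) a b.
Proof.
have := @iter_d_fsol _ _ scA P J _ (co : 'I_k -> {additive V -> F}) e0 _ _ _ _ _ _ _ Q Q_sc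
  (@dlog F) _ _ _ (coef_log x).
have cE a a' : coef_log (index_of a) (e0 a') = (a == a')%:R.
  by rewrite coef_log_monom (inj_eq (@index_of_inj _ _ _ _)).
move=> /(_ (@op_log_scl F s r) (fun a => @coef_log_scl F _) (@op_inv_log F charF s r)
  (@coef_inv_log F charF s r) (@op_log_monom F charF s r) cE (@op_log_inj F charF s r)
  (@dlog_op F s r) dQ (@dlog_scl F) (@coef_log_scl F x) m b) <-.
by apply: (fpsP _ _).1 => j /=; case: x => n a; rewrite coef_log_dlog.
Qed.

Lemma coef_log_sol a b j : coef_log (index_of a) (sol b j) = ((j == 0%N) && (a == b))%:R.
Proof.
apply: (@co_fsol _ _ J _ (co : 'I_k -> {additive V -> F})) => [a' v|a' b'].
  exact: coef_inv_log.
by rewrite /= coef_log_monom (inj_eq (@index_of_inj _ _ _ _)).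
Qed.

(** At [t = 0] the monodromy differentiates the [x^(s + n) (log x)^a / a!], so its [m]-th power
    lowers the power of the logarithm by [m], more than any label allows. *)
Lemma monodromy_nilpotent m : (forall a, (index_of a).2 < m)%N ->
  map_mx (@cst_coef F) (log_monodromy Q) ^+ m = 0.
Proof.
move=> lt_m; rewrite -rmorphXn; apply/matrixP => a b; rewrite !mxE.
have := coef_iter_dlog (index_of a) m b; rewrite (bigD1 a)//= big1 ?addr0.
  have -> : Fps (fun j => coef_log (index_of a) (sol a j)) = 1.
    by apply: (fpsP _ _).1 => j; rewrite fps_coef1 -[LHS]/(coef_log _ _) coef_log_sol eqxx andbT.
  rewrite mul1r => <-; rewrite /cst_coef /= log_sol0 coef_log_monom.
  case: eqP => // E; have := lt_m b; rewrite -E /=; lia.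
move=> a' a'a; rewrite (_ : Fps _ = 0) ?mul0r//.
apply: (fpsP _ _).1 => j; rewrite -[LHS]/(coef_log _ _) coef_log_sol.
by rewrite [a == a']eq_sym (negPf a'a) andbF.
Qed.

End Operator.

End LogSolutions.

(** * Truncation to a window of exponents *)

Section Cut.
Variables (R : zmodType) (B : nat).

Fact cut_bounded (v : laurent R) : exists N : int, forall n, n < N ->
  (if (`|n| <= B)%N then v n else 0) = 0.
Proof. by exists (- B%:Z) => n nB; case: ifP => //; lia. Qed.
Definition cut v := Laurent (cut_bounded v).

Fact cut_zmod : zmod_morphism cut.
Proof. by move=> u v; apply/laurentP => n /=; case: ifP; rewrite ?subr0. Qed.
HB.instance Definition _ := GRing.isZmodMorphism.Build (laurent R) (laurent R) cut cut_zmod.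

Lemma cut_in v (n : int) : (`|n| <= B)%N -> cut v n = v n.
Proof. by move=> nB; rewrite /= nB. Qed.

Lemma cut_out v (n : int) : (B < `|n|)%N -> cut v n = 0.
Proof. by move=> nB; rewrite /= leqNgt nB. Qed.

End Cut.

Section Window.
Variables (F : fieldType) (charF : [pchar F] =i pred0) (s : F) (r : seq F).
Local Notation V := (laurent {poly F}).
Local Notation k := (class_size r s).
Local Notation dact := (pact (@polyC F) (@deriv F)).
Local Notation index_of := (tnth (exp_tuple charF s r)).
Local Notation J := (inv_log charF s r).
Local Notation e0 := (@log_monom F charF s r).
Variables (Qd : nat -> seq (laurent F)) (N b M B : nat).
Hypothesis bandQ : forall i, (i <= N)%N -> band b (Qd i).
Hypothesis exps_le : forall n, (0 < exp_mult s r n)%N -> (`|n| <= M)%N.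
Hypothesis B_large : (M + (N * b).*2 <= B)%N.

Definition qfull i : V -> V := qop_log s (Qd i).
HB.instance Definition _ i := GRing.Additive.on (qfull i).

(** Compression by [cut] still commutes with scalars and with [dlog], so the truncated operator has
    a monodromy of its own. *)
Definition qcut i (v : V) : V :=
  if (i <= N)%N then cut B (qop_log s (Qd i) (cut B v)) else 0.
Fact qcut_zmod i : zmod_morphism (qcut i).
Proof. by move=> u v; rewrite /qcut; case: ifP => _; rewrite ?subr0// !raddfB. Qed.
HB.instance Definition _ i := GRing.isZmodMorphism.Build V V (qcut i) (qcut_zmod i).

Lemma cut_scl c (v : V) : cut B (scl c v) = scl c (cut B v).
Proof. by apply/laurentP => n /=; case: ifP; rewrite ?scaler0. Qed.

Lemma cut_dlog (v : V) : cut B (dlog v) = dlog (cut B v).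
Proof. by apply/laurentP => n /=; case: ifP; rewrite ?raddf0. Qed.

Lemma qcut_scl i c v : qcut i (scl c v) = scl c (qcut i v).
Proof. by rewrite /qcut; case: ifP => _; rewrite ?raddf0// cut_scl qop_log_scl cut_scl. Qed.

Lemma dlog_qcut i v : dlog (qcut i v) = qcut i (dlog v).
Proof. by rewrite /qcut; case: ifP => _; rewrite ?raddf0// cut_dlog -dlog_qop cut_dlog. Qed.

Local Notation sol := (log_sol charF (s := s) (r := r) qfull).
Local Notation solc := (log_sol charF (s := s) (r := r) qcut).

Lemma index_of_le a : (`|(index_of a).1| <= M)%N.
Proof. by apply: exps_le; apply: leq_ltn_trans (index_ofP charF a). Qed.

Let solS Q a j n : log_sol charF (s := s) (r := r) Q a j.+1 n =
  - inv_at charF s r n (\sum_(1 <= i < j.+2) Q i (log_sol charF (s := s) (r := r) Q a (j.+1 - i)%N) n).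
Proof. by rewrite log_solS /= -laurent_coef_sum. Qed.

(** Each [Q_i] lowers exponents by at most [b] and costs at least one power of [t], while [J] does
    not move them. *)
Lemma sol_support a j n : (j <= N)%N -> n < - M%:Z - (j * b)%N%:Z -> sol a j n = 0.
Proof.
have [m] := ubnP j; elim: m j n => // m IHm [|j] n jm jN nM.
  rewrite log_sol0 /=; case: eqP => // nE; have := index_of_le a; rewrite -nE; lia.
rewrite solS big_nat_cond big1 ?inv_at0 ?oppr0// => i; rewrite andbT => i_bnd.
have -> : qfull i (sol a (j.+1 - i)%N) n = (qop_log s (Qd i) 0) n.
  apply: (@qop_log_local F s b); first by apply: bandQ; lia.
  by move=> m' m'n; rewrite laurent_coef0 IHm//; [lia|lia|nia].
by rewrite raddf0.
Qed.

Lemma solc_support a j n : (B < `|n|)%N -> solc a j n = 0.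
Proof.
move=> nB; case: j => [|j].
  by rewrite log_sol0 /=; case: eqP => // nE; have := index_of_le a; rewrite -nE; lia.
rewrite solS big1 ?inv_at0 ?oppr0// => i _.
by rewrite /= /qcut; case: ifP => // _; rewrite cut_out.
Qed.

(** Truncation disturbs the solutions only from above, and the disturbance descends by at most [b]
    per power of [t]. At the lower end nothing is lost, since the solutions do not reach below
    [- B]. *)
Lemma cut_sol_agree a j (n : int) : (j <= N)%N -> n <= B%:Z - (j * b)%N%:Z ->
  sol a j n = solc a j n.
Proof.
have [m] := ubnP j; elim: m j n => // m IHm [|j] n jm jN nB; first by rewrite !log_sol0.
have [nlt|nge] := ltP n (- B%:Z).
  rewrite solc_support; last by lia.
  by rewrite sol_support//; nia.
rewrite !solS; congr (- inv_at _ _ _ _); apply: eq_big_nat => i i_bnd.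
rewrite /= /qcut ifT; last by lia.
rewrite cut_in; last by nia.
apply: (@qop_log_local F s b); first by apply: bandQ; lia.
move=> m' m'n.
have [m'B|m'B] := leqP `|m'| B; first by rewrite cut_in// IHm//; [lia|lia|nia].
by rewrite cut_out// sol_support//; [lia|nia].
Qed.

Local Notation D := (@log_monodromy F charF s r qfull).
Local Notation Dc := (@log_monodromy F charF s r qcut).

Lemma cut_monodromy a a' j : (j <= N)%N -> D a a' j = Dc a a' j.
Proof.
move=> jN; rewrite !log_monodromyE /coef_log /= cut_sol_agree//.
by have := index_of_le a; nia.
Qed.

End Window.

(* Factor theorem for matrix polynomials: the hypothesis is the vanishing of the
   right evaluation of [A E] at [D]. *)
Lemma mx_right_root (R : comNzRingType) W k d (Ac : 'I_d -> 'M[R]_W)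
    (E : 'M[R]_(W, k)) (D : 'M[R]_k) :
  \sum_(u < d) Ac u *m E *m D ^+ u = 0 ->
  exists2 C : 'M[{poly R}]_(W, k),
    (\sum_(u < d) 'X^u *: map_mx polyC (Ac u)) *m map_mx polyC E = C *m char_poly_mx D &
    C = \sum_(u < d) map_mx polyC (Ac u *m E) *m
      \sum_(a < u) ('X%:M) ^+ (u.-1 - a) * map_mx polyC D ^+ a.
Proof.
set C := (X in exists2 _, _ & _ = X) => AED0; exists C => //.
pose XP : 'M[{poly R}]_k := 'X%:M; pose DP : 'M[{poly R}]_k := map_mx polyC D.
have cXD : GRing.comm XP DP by apply/esym; exact: scalar_mxC.
rewrite /C [RHS]mulmx_suml.
transitivity (\sum_(u < d) map_mx polyC (Ac u *m E) *m (XP ^+ u - DP ^+ u)).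
  under [RHS]eq_bigr do rewrite mulmxBr.
  rewrite sumrB mulmx_suml [X in _ - X](_ : _ = 0) ?subr0.
    apply: eq_bigr => u _; rewrite -scalemxAl map_mxM /= -rmorphXn /=.
    by rewrite mul_mx_scalar.
  rewrite -[RHS](map_mx0 (@polyC R)) -AED0 raddf_sum; apply: eq_bigr => u _ /=.
  by rewrite [RHS]map_mxM; congr (_ *m _); rewrite /DP -rmorphXn.
apply: eq_bigr => u _; rewrite -mulmxA; congr (_ *m _).
(* [XP] and [DP] commute, so the geometric sum can be placed on the left of [XP - DP]. *)
have cs : GRing.comm (\sum_(a < u) XP ^+ (u.-1 - a) * DP ^+ a) (XP - DP).
  apply: commr_sym; apply: commr_sum => a _; apply: commrM; apply: commrX.
    by apply: commr_sym; apply: commrB => //; apply: commr_refl.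
  by apply: commr_sym; apply: commrB; [exact/commr_sym|exact: commr_refl].
by rewrite subrXX_comm// -cs.
Qed.

(** * Window matrices *)

Section WindowMatrix.
Variables (F : fieldType) (charF : [pchar F] =i pred0) (s : F) (r : seq F).
Local Notation V := (laurent {poly F}).
Local Notation k := (class_size r s).
Local Notation dact := (pact (@polyC F) (@deriv F)).
Local Notation index_of := (tnth (exp_tuple charF s r)).
Variables (Qd : nat -> seq (laurent F)) (N b M B : nat).
Local Notation W := B.*2.+1.
Local Notation qcut := (@qcut F s Qd N B).
Local Notation solc := (log_sol charF (s := s) (r := r) qcut).
Local Notation Dc := (@log_monodromy F charF s r qcut).

Definition idx (i : 'I_W) : int := - B%:Z + i%:Z.

Lemma idx_inj : injective idx.
Proof. by rewrite /idx => i j ij; apply: ord_inj; lia. Qed.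

Lemma idx_le i : (`|idx i| <= B)%N.
Proof. by rewrite /idx; have := ltn_ord i; lia. Qed.

Lemma idx_surj n : (`|n| <= B)%N -> exists i, idx i = n.
Proof.
move=> nB; have nW : (absz (n + B%:Z)%R < W)%N by lia.
by exists (Ordinal nW); rewrite /idx /=; lia.
Qed.

(** The variable stands for the derivation by [log x]. Replacing it by [eps] gives the action on
    [x^(s + eps + n)]; this double reading links the logarithmic solutions with the coefficient of
    [x^eps]. *)
Definition win_entry t i j : {poly F} :=
  if t is 0 then (if i == j then indicial s r (idx i) else 0) else
  if (t <= N)%N then log_entry s (Qd t) (idx i) (idx j) else 0.

Definition win_size := \max_(x : 'I_N.+1 * 'I_W * 'I_W) size (win_entry x.1.1 x.1.2 x.2).

Lemma win_entry_size t i j : (size (win_entry t i j) <= win_size)%N.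
Proof.
have [tN|Nt] := leqP t N; last first.
  by case: t Nt => // t Nt; rewrite /win_entry ifN ?size_poly0// -ltnNge.
have tN' : (t < N.+1)%N by [].
exact: (leq_bigmax (Ordinal tN', i, j)).
Qed.

Definition win_coef (u : 'I_win_size) : 'M[fps F]_W :=
  \matrix_(i, j) Fps (fun t => (win_entry t i j)`_u).

Definition win_mx : 'M[{poly fps F}]_W :=
  \sum_(u < win_size) 'X^u *: map_mx polyC (win_coef u).

(** Only values at [log x = 0] are kept; the derivatives there come from powers of the monodromy, by
    [win_solX]. *)
Definition win_sol : 'M[fps F]_(W, k) :=
  \matrix_(m, a) Fps (fun t => coef_log (idx m, 0%N) (solc a t)).

Lemma horner0_dact (p w : {poly F}) d : (size p <= d)%N ->
  (dact p w).[0] = \sum_(u < d) p`_u * w^`(u).[0].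
Proof.
move=> pd; rewrite (pact_widen _ _ _ pd) horner_sum; apply: eq_bigr => u _.
by rewrite iter_deriv hornerM hornerC.
Qed.

Lemma win_solX u : win_sol *m Dc ^+ u =
  \matrix_(m, a) Fps (fun t => coef_log (idx m, u) (solc a t)).
Proof.
apply/matrixP => m a; rewrite !mxE.
have := @coef_iter_dlog F charF s r qcut (@qcut_scl F s Qd N B) (@dlog_qcut F s Qd N B)
  (idx m, 0%N) u a.
rewrite addn0 /= => ->.
by apply: eq_bigr => a' _; rewrite mxE.
Qed.

Lemma win_entry_sum (v : V) t i : (forall n : int, (B < `|n|)%N -> v n = 0) ->
  \sum_m dact (win_entry t i m) (v (idx m)) =
  if t is 0 then op_log s r v (idx i) else qcut t v (idx i).
Proof.
move=> vB; case: t => [|t] /=.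
  rewrite (bigD1 i)//= eqxx big1 ?addr0 ?op_logE// => m mi.
  by rewrite eq_sym (negPf mi) pact0.
rewrite /qcut; case: ifP => tN; last by rewrite big1// => m _; rewrite pact0.
rewrite cut_in ?idx_le// (@qop_log_coef _ _ _ _ _ (- B%:Z) W).
  by apply: eq_bigr => m _; rewrite cut_in ?idx_le.
by move=> n nB; left; rewrite cut_out//; lia.
Qed.

Hypothesis exps_le : forall n, (0 < exp_mult s r n)%N -> (`|n| <= M)%N.
Hypothesis B_large : (M + (N * b).*2 <= B)%N.

(** This is the truncated equation for the basic solutions, evaluated at [log x = 0], where the
    [u]-th derivative of the solutions is [win_sol] times the [u]-th power of the monodromy. *)
Lemma win_relation : \sum_(u < win_size) win_coef u *m win_sol *m Dc ^+ u = 0.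
Proof.
apply/matrixP => i a; rewrite [RHS]mxE.
have -> : (\sum_(u < win_size) win_coef u *m win_sol *m Dc ^+ u) i a =
    \sum_(u < win_size) \sum_m Fps (fun t => (win_entry t i m)`_u) *
      Fps (fun t => coef_log (idx m, u : nat) (solc a t)).
  rewrite summxE; apply: eq_bigr => u _; rewrite -mulmxA win_solX mxE.
  by apply: eq_bigr => m _; rewrite !mxE.
apply: (fpsP _ _).1 => T.
transitivity (\sum_(t < T.+1) \sum_m
    (dact (win_entry t i m) (solc a (T - t)%N (idx m))).[0]).
  rewrite fps_coef_sum; under eq_bigr do rewrite fps_coef_sum.
  under eq_bigr do under eq_bigr do rewrite fps_coefM.
  rewrite exchange_big [RHS]exchange_big; apply: eq_bigr => m _ /=.
  rewrite exchange_big; apply: eq_bigr => t _ /=.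
  by rewrite (horner0_dact _ (win_entry_size _ _ _)).
have E (t : 'I_T.+1) : \sum_m (dact (win_entry t i m) (solc a (T - t)%N (idx m))).[0] =
    ((if t : nat is 0 then op_log s r (solc a (T - t)%N) else qcut t (solc a (T - t)%N)) (idx i)).[0].
  rewrite -horner_sum win_entry_sum; last by move=> n nB; apply: (solc_support _ _ exps_le B_large).
  by case: t => -[].
rewrite (eq_bigr _ (fun t _ => E t)) -horner_sum -laurent_coef_sum.
rewrite big_ord_recl /= subn0.
have := formal_op_log_sol charF (s := s) (r := r) qcut a T.
rewrite /formal_op big_add1 big_mkord /= => E0.
rewrite (_ : _ + _ = 0) ?horner0//.
by rewrite -[RHS](congr1 (fun v : V => v (idx i)) E0).
Qed.

End WindowMatrix.

Section LiftEps.
Variables (F K : fieldType) (iota : {rmorphism F -> K}).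
Local Notation tofrac := (@FracField.tofrac {poly K}).

Definition rpoly : {poly F} -> ratfun K := tofrac \o map_poly iota.
HB.instance Definition _ := GRing.RMorphism.on rpoly.

Definition lift_eps : {poly fps F} -> fps (ratfun K) :=
  horner_eval (fpsC eps) \o map_poly (fps_map (rat_inj iota)).
HB.instance Definition _ := GRing.RMorphism.on lift_eps.

Lemma rpolyX : rpoly 'X = eps.
Proof. by rewrite /rpoly /= map_polyX. Qed.

Lemma rpolyC c : rpoly c%:P = rat_inj iota c.
Proof. by rewrite /rpoly /= map_polyC. Qed.

Lemma rpolyE d (p : {poly F}) : (size p <= d)%N -> rpoly p = \sum_(u < d) eps ^+ u * rat_inj iota p`_u.
Proof.
move=> pd; rewrite -{1}(coefK p) poly_def rmorph_sum /=.
rewrite (big_ord_widen _ (fun u => rpoly (p`_u *: 'X^u)) pd) big_mkcond.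
apply: eq_bigr => u _; case: ltnP => [_|/(nth_default 0) ->]; last by rewrite rmorph0 mulr0.
by rewrite -mul_polyC rmorphM rmorphXn /= rpolyX rpolyC mulrC.
Qed.

Lemma rpoly_eq0 (p : {poly F}) : (rpoly p == 0) = (p == 0).
Proof. by rewrite tofrac_eq0 map_poly_eq0. Qed.

Lemma reg0_rpoly (p : {poly F}) : reg0 (rpoly p).
Proof. exact: reg0_tofrac. Qed.

Lemma reg0_rpolyV (p : {poly F}) : p.[0] != 0 -> reg0 (rpoly p)^-1.
Proof.
move=> p0; apply: reg0_inv; rewrite -[X in _.[X]](rmorph0 iota) horner_map.
by rewrite fmorph_eq0.
Qed.

Lemma lift_epsX : lift_eps 'X = fpsC eps.
Proof. by rewrite /lift_eps /= map_polyX /horner_eval hornerX. Qed.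

Lemma lift_epsC c : lift_eps c%:P = fps_map (rat_inj iota) c.
Proof. by rewrite /lift_eps /= map_polyC /horner_eval hornerC. Qed.

Lemma lift_eps_monom u c :
  lift_eps ('X^u * c%:P) = fpsC (eps ^+ u) * fps_map (rat_inj iota) c.
Proof. by rewrite rmorphM rmorphXn /= lift_epsX lift_epsC -rmorphXn. Qed.

Lemma lift_epsE (p : {poly fps F}) : lift_eps p = \sum_(u < size p) fpsC (eps ^+ u) * fps_map (rat_inj iota) p`_u.
Proof.
rewrite -{1}(coefK p) poly_def rmorph_sum /=; apply: eq_bigr => u _.
by rewrite -mul_polyC mulrC lift_eps_monom.
Qed.

Lemma reg0_lift_eps (p : {poly fps F}) : fps_in (fun=> @reg0 K) (lift_eps p).
Proof.
rewrite lift_epsE => n; rewrite fps_coef_sum; apply: reg0_sum => u _.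
rewrite fps_coefCM; apply: reg0M; last exact: reg0_ratC.
by rewrite -rpolyX -rmorphXn; apply: reg0_rpoly.
Qed.

End LiftEps.

Section WindowDet.
Variables (F : fieldType) (charF : [pchar F] =i pred0) (s : F) (r : seq F).
Variables (K : closedFieldType) (iota : {rmorphism F -> K}).
Local Notation V := (laurent {poly F}).
Local Notation k := (class_size r s).
Local Notation index_of := (tnth (exp_tuple charF s r)).
Variables (Qd : nat -> seq (laurent F)) (N b M B : nat).
Local Notation W := B.*2.+1.
Local Notation qcut := (@qcut F s Qd N B).
Local Notation solc := (log_sol charF (s := s) (r := r) qcut).
Local Notation Dc := (@log_monodromy F charF s r qcut).
Hypothesis exps_le : forall n, (0 < exp_mult s r n)%N -> (`|n| <= M)%N.
Hypothesis B_large : (M + (N * b).*2 <= B)%N.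
Local Notation rpoly := (rpoly iota).
Local Notation lift := (lift_eps iota).
Local Notation idx := (@idx B).
Local Notation entry := (@win_entry F s r Qd N B).
Local Notation A := (map_mx lift (@win_mx F s r Qd N B)).

(** The window matrix of [P^-1 Q] on [x^(s + eps + Z)]: dividing row [i] by its indicial polynomial
    is [P^-1]. *)
Definition eps_mx : 'M[fps (ratfun K)]_W := \matrix_(i, j)
  Fps (fun t => if t is 0 then 0 else (rpoly (indicial s r (idx i)))^-1 * rpoly (entry t i j)).

Lemma indicial_neq0 n : indicial s r n != 0.
Proof.
rewrite indicialE mulf_neq0 ?expf_neq0 ?polyX_eq0//.
by apply: contraNneq (indicial_unit0 s r n) => ->; rewrite horner0.
Qed.

Lemma lift_win_mx i j t : A i j t = rpoly (entry t i j).
Proof.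
rewrite mxE /win_mx summxE rmorph_sum fps_coef_sum (rpolyE _ (win_entry_size _ _ _ _ _ _ _)).
apply: eq_bigr => u _; rewrite !mxE.
rewrite -[LHS]/(lift ('X^u * (Fps (fun t => (entry t i j)`_u))%:P) t).
by rewrite lift_eps_monom fps_coefCM.
Qed.

Lemma win_mx_factor :
  A = diag_mx (\row_i fpsC (rpoly (indicial s r (idx i)))) *m (1 + eps_mx).
Proof.
apply/matrixP => i j; rewrite mul_diag_mx; apply: (fpsP _ _).1 => t.
rewrite lift_win_mx !mxE fps_coefCM fps_coefD.
have p0 : rpoly (indicial s r (idx i)) != 0 by rewrite rpoly_eq0 indicial_neq0.
rewrite fps_coef_nat; case: t => [|t] /=; last by rewrite mulr0n add0r mulVKf.
by rewrite mulr1n addr0; case: eqP => [->|_]; rewrite ?mulr1// mulr0 rmorph0.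
Qed.

Lemma det_win_mx :
  \det A = fpsC (\prod_i rpoly (indicial s r (idx i))) * \det (1 + eps_mx).
Proof.
rewrite win_mx_factor det_mulmx det_diag rmorph_prod; congr (_ * _).
by apply: eq_bigr => i _; rewrite mxE.
Qed.

Lemma sum_exp_mult : (\sum_i exp_mult s r (idx i) = k)%N.
Proof.
rewrite -(eqP (size_exp_pairs charF s r)) /exp_pairs size_allpairs_dep sumnE big_map.
under [RHS]eq_bigr do rewrite size_iota.
rewrite -(big_map idx xpredT (fun n => exp_mult s r n)).
rewrite (bigID (fun n => n \in exps s r))/= [X in (_ + X)%N]big1 ?addn0.
  rewrite -big_filter; apply: perm_big; apply: uniq_perm.
  - by rewrite filter_uniq// map_inj_uniq ?index_enum_uniq//; apply: idx_inj.
  - exact: undup_uniq.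
  move=> n; rewrite mem_filter; apply/andb_idr; rewrite mem_exps// => n0.
  have nB : (`|n| <= B)%N by apply: leq_trans (exps_le n0) _; lia.
  by have [i <-] := idx_surj nB; rewrite map_f ?mem_index_enum.
by move=> n; rewrite mem_exps// -eqn0Ngt => /eqP.
Qed.

Lemma prod_indicial : \prod_i rpoly (indicial s r (idx i)) =
  eps ^+ k * \prod_i rpoly (indicial_unit s r (idx i)).
Proof.
rewrite -sum_exp_mult -prodrXr -big_split; apply: eq_bigr => i _ /=.
by rewrite indicialE rmorphM rmorphXn /= rpolyX.
Qed.

(** Division of an indicial polynomial by its power of the variable, in the form in which it appears
    in the quotient matrix [C] below. *)
Lemma rpoly_shifted m q d : (size ('X^m * q)%R <= d)%N ->
  \sum_(u < d | (m <= u)%N) eps ^+ (u - m) * rat_inj iota ('X^m * q)`_u = rpoly q.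
Proof.
move=> qd; have eps0 : (eps : ratfun K) != 0 by rewrite tofrac_eq0 polyX_eq0.
apply: (mulfI (expf_neq0 m eps0)).
have -> : eps ^+ m * rpoly q = rpoly ('X^m * q) by rewrite rmorphM rmorphXn /= rpolyX.
rewrite (rpolyE _ qd) mulr_sumr big_mkcond; apply: eq_bigr => u _.
case: leqP => [mu|um]; first by rewrite mulrA -exprD subnKC.
by rewrite coefXnM um rmorph0 mulr0.
Qed.


(* The determinant of the window matrix and the characteristic polynomial of
   the monodromy both generate the zeroth Fitting ideal of the cokernel of the
   window matrix, over the power series in [t] that are regular at [eps = 0]. *)
Lemma det_window : exists U : fps (ratfun K), fps_in (fun=> @reg0 K) U /\
  \det A * U = lift (char_poly Dc).
Proof.
have gR := graded_reg0 K.
have [C AE CE] := mx_right_root (win_relation charF Qd exps_le B_large).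
pose CL : 'M[fps (ratfun K)]_(W, k) := map_mx lift C.
pose EL : 'M[fps (ratfun K)]_(W, k) := map_mx lift (map_mx polyC (win_sol charF s r Qd N B)).
pose XD : 'M[fps (ratfun K)]_k := map_mx lift (char_poly_mx Dc).
have AEL : A *m EL = CL *m XD by rewrite -!map_mxM AE.
(* At [t = 0] the operator is diagonal, and the [v]-th derivative of a basic solution at [log x = 0]
   is 1 at a single place, for a single [v], and 0 elsewhere. *)
have CL0 i a : CL i a 0%N =
    \sum_(u < win_size s r Qd N B) \sum_(v < u) eps ^+ (u.-1 - v) *
      rat_inj iota (indicial s r (idx i))`_u *+ ((idx i, v : nat) == index_of a).
  rewrite mxE CE summxE rmorph_sum fps_coef_sum; apply: eq_bigr => u _.
  rewrite mulmx_sumr summxE.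
  pose AED (v : 'I_u) : 'M[fps F]_(W, k) := win_coef u *m (win_sol charF s r Qd N B *m Dc ^+ v).
  have term (v : 'I_u) : (map_mx polyC (win_coef u *m win_sol charF s r Qd N B) *m
      (('X%:M) ^+ (u.-1 - v) * map_mx polyC Dc ^+ v)) i a = 'X^(u.-1 - v) * (AED v i a)%:P.
    rewrite -!rmorphXn /= -[X in _ *m X]/(_ *m _) mulmxA mul_mx_scalar -scalemxAl -map_mxM.
    by rewrite [LHS]mxE [X in _ * X]mxE /AED mulmxA.
  rewrite (eq_bigr _ (fun v _ => term v)) rmorph_sum fps_coef_sum; apply: eq_bigr => v _.
  rewrite -[LHS]/(lift ('X^(u.-1 - v) * (AED v i a)%:P) 0%N) lift_eps_monom fps_coefCM.
  rewrite -mulrnAr; congr (_ * _).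
  rewrite -[LHS]/(rat_inj iota (AED v i a 0%N)) -rmorphMn; congr (rat_inj iota _).
  rewrite /AED mxE fps_coef_sum (bigD1 i)// big1 ?addr0.
    rewrite fps_coefM0 win_solX !mxE /= eqxx log_sol0 coef_log_monom.
    by rewrite addr0 mulr_natr.
  by move=> m /andP[_ mi]; rewrite fps_coefM0 !mxE /= eq_sym (negPf mi) coef0 mul0r.
(* [X0] and [Y0] solve [C X + A Y = 1] at [t = 0]. At a position of multiplicity [m > 0], the column
   of [C] labelled by the top power [m - 1] of the logarithm has there the indicial polynomial
   divided by [eps^m], which is a unit at [eps = 0]; if [m = 0], the diagonal entry of [A] is
   already such a unit. *)
pose X0 : 'M[fps (ratfun K)]_(k, W) := \matrix_(a, j)
  if index_of a == (idx j, (exp_mult s r (idx j)).-1) then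
    fpsC (rpoly (indicial_unit s r (idx j)))^-1 else 0.
pose Y0 : 'M[fps (ratfun K)]_W := \matrix_(i, j)
  if (i == j) && (exp_mult s r (idx j) == 0%N) then
    fpsC (rpoly (indicial_unit s r (idx j)))^-1 else 0.
have regc j : fps_in (fun=> @reg0 K) (fpsC (rpoly (indicial_unit s r (idx j)))^-1).
  by move=> [|n]; [exact/reg0_rpolyV/indicial_unit0|exact: reg00].
have regX0 a j : fps_in (fun=> @reg0 K) (X0 a j).
  by rewrite mxE; case: ifP => _; [exact: regc|exact: (graded0 gR)].
have regY0 i j : fps_in (fun=> @reg0 K) (Y0 i j).
  by rewrite mxE; case: ifP => _; [exact: regc|exact: (graded0 gR)].
have regA i j : fps_in (fun=> @reg0 K) (A i j) by rewrite mxE; exact: reg0_lift_eps.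
have regCL i a : fps_in (fun=> @reg0 K) (CL i a) by rewrite mxE; exact: reg0_lift_eps.
pose Z := CL *m X0 + A *m Y0.
have unit0 j : rpoly (indicial_unit s r (idx j)) != 0.
  rewrite rpoly_eq0; apply: contraNneq (indicial_unit0 s r (idx j)) => ->.
  by rewrite horner0.
have Z0 i j : Z i j 0%N = (i == j)%:R.
  have -> : Z i j = \sum_a CL i a * X0 a j + \sum_m A i m * Y0 m j.
    by rewrite /Z mxE; congr (_ + _); rewrite mxE.
  rewrite fps_coefD !fps_coef_sum.
  rewrite [X in _ + X](bigD1 j)// [X in _ + (_ + X)]big1 ?addr0; last first.
    move=> m /andP[_ mj]; rewrite fps_coefM0 [Y0 _ _]mxE (negPf mj).
    exact: mulr0.
  rewrite fps_coefM0 lift_win_mx [Y0 _ _]mxE eqxx andTb.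
  have [m0|m0] := eqVneq (exp_mult s r (idx j)) 0%N.
    rewrite big1 ?add0r; last first.
      move=> a _; rewrite fps_coefM0 [X0 _ _]mxE; case: eqP => [E|_]; last exact: mulr0.
      by have := index_ofP charF a; rewrite E /= m0.
    rewrite /=; case: eqP => [->|_]; last by rewrite rmorph0 mul0r.
    by rewrite indicialE m0 expr0 mul1r (divff (unit0 j)).
  rewrite [X in _ + _ * X](_ : _ = 0)// mulr0 addr0.
  have : (idx j, (exp_mult s r (idx j)).-1) \in exp_tuple charF s r.
    by rewrite -[_ \in _]/(_ \in exp_pairs s r) mem_exp_pairs// prednK// lt0n.
  move=> /tnthP[a0 a0E].
  have -> : \sum_a (CL i a * X0 a j) 0%N = (CL i a0 * X0 a0 j) 0%N.
    rewrite (bigD1 a0)// big1; first exact: addr0.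
    move=> a /andP[_ aa0]; rewrite fps_coefM0 [X0 _ _]mxE a0E (inj_eq (@index_of_inj _ _ _ _)).
    by rewrite (negPf aa0); apply: mulr0.
  rewrite fps_coefM0 CL0 [X0 _ _]mxE -a0E eqxx [fpsC _ _]/=.
  have [->|ij] := eqVneq i j; last first.
    rewrite big1 ?mul0r// => u _; rewrite big1// => v _.
    by rewrite xpair_eqE (inj_eq (@idx_inj _)) (negPf ij).
  apply: (canLR (mulfK (unit0 j))); rewrite mul1r.
  have sz : (size ('X^(exp_mult s r (idx j)) * indicial_unit s r (idx j))%R <= win_size s r Qd N B)%N.
    have := win_entry_size s r Qd N 0 j j.
    by rewrite -indicialE /win_entry eqxx.
  rewrite -(rpoly_shifted sz) [RHS]big_mkcond -indicialE; apply: eq_bigr => u _.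
  case: leqP => [mu|um].
    have vu : ((exp_mult s r (idx j)).-1 < u)%N by rewrite prednK ?lt0n.
    rewrite (bigD1 (Ordinal vu))//= eqxx mulr1n big1 ?addr0 => [|v vv].
      by congr (eps ^+ _ * _); lia.
    rewrite xpair_eqE eqxx /= (_ : (_ == _) = false) ?mulr0n//.
    by apply: contraNF vv => /eqP vE; apply/eqP/val_inj.
  rewrite big1// => v _; rewrite xpair_eqE eqxx /= (_ : (_ == _) = false) ?mulr0n//.
  by apply/eqP; have := ltn_ord v; lia.
have regZ i j : fps_in (fun=> @reg0 K) (Z i j).
  by rewrite mxE; apply: (gradedD gR); apply: (graded_mulmx gR).
have [Zi regZi ZZi] := graded_mx_inverse gR regZ Z0.
pose X1 := X0 *m Zi; pose Y1 := Y0 *m Zi.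
have bezout : CL *m X1 + A *m Y1 = 1%:M by rewrite /X1 /Y1 !mulmxA -mulmxDl.
(* Multiplied on the left by the block lower triangular matrix with rows [(1, 0)] and [(CL, A)],
   this matrix becomes block upper triangular with diagonal blocks [XD] and 1, because
   [A EL = CL XD] and [CL X1 + A Y1 = 1]. *)
exists (\det (block_mx XD X1 (- EL) Y1)); split.
  apply: (graded_det gR) => i j; rewrite mxE; case: splitP => i' _; rewrite mxE; case: splitP => j' _.
  - by rewrite mxE; exact: reg0_lift_eps.
  - exact: (graded_mulmx gR).
  - by rewrite 2!mxE; apply: (gradedN gR); exact: reg0_lift_eps.
  - exact: (graded_mulmx gR).
have -> : lift (char_poly Dc) = \det XD by rewrite det_map_mx.
have -> : \det A = \det (block_mx 1%:M 0 CL A) by rewrite det_lblock det1 mul1r.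
rewrite -det_mulmx mulmx_block !mul1mx !mul0mx !addr0 mulmxN AEL subrr bezout.
by rewrite det_ublock det1 mulr1.
Qed.

End WindowDet.

Lemma ratfun_unit_nat (F K : fieldType) (iota : {rmorphism F -> K}) :
  [pchar F] =i pred0 -> forall n, n.+1%:R \is a @GRing.unit (ratfun K).
Proof.
move=> charF n; rewrite unitfE -(rmorph_nat (@rat_inj F K iota)) fmorph_eq0.
by rewrite (pcharf0P F).1.
Qed.

(* A power series whose coefficients are both polar and regular is constant. *)
Lemma exp_polar_unique (K : fieldType) (z V chi : fps (ratfun K)) :
  (forall n, n.+1%:R \is a @GRing.unit (ratfun K)) ->
  z 0%N = 0 -> fps_in (@polar_coef K) z -> fps_in (fun=> @reg0 K) V ->
  fps_in (@polar_coef K) chi -> chi 0%N = 1 -> fps_exp z * V = chi -> fps_exp z = chi.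
Proof.
move=> charK z0 zP VR chiP chi0 zV; have gP := graded_polar K.
have CP m : fps_in (@polar_coef K) (fpsC (m`!%:R^-1)).
  case=> [|n]; last exact: polar0.
  by exists (m`!%:R^-1); rewrite fmorphV rmorph_nat.
have z'0 : (- z) 0%N = 0 by rewrite fps_coefN z0 oppr0.
(* The regular series [V] is polar as well, as the product of [exp (- z)] and [chi]. *)
have VE : V = fps_exp (- z) * chi.
  by rewrite -zV mulrA -fps_expD// addrC subrr fps_exp_zero// mul1r.
have VP : fps_in (@polar_coef K) V.
  by rewrite VE; apply: (gradedM gP) => //; apply: (graded_exp gP) => //; apply: (gradedN gP).
suff V1 : V = 1 by rewrite -zV V1 mulr1.
apply: (fpsP _ _).1 => -[|n]; first by rewrite VE fps_coefM0 fps_exp0 chi0 mulr1.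
by rewrite fps_coef1; apply: polar_reg0_eq0; [exact: (VP n.+1)|exact: VR].
Qed.

Section ExpPolar.
Variables (F : fieldType) (charF : [pchar F] =i pred0) (s : F) (r : seq F).
Variables (K : closedFieldType) (iota : {rmorphism F -> K}).
Local Notation k := (class_size r s).
Variables (Qd : nat -> seq (laurent F)) (N b M B : nat).
Local Notation W := B.*2.+1.
Local Notation Dc := (@log_monodromy F charF s r (@qcut F s Qd N B)).
Hypothesis exps_le : forall n, (0 < exp_mult s r n)%N -> (`|n| <= M)%N.
Hypothesis B_large : (M + (N * b).*2 <= B)%N.
Local Notation lift := (lift_eps iota).
Local Notation epsW := (@eps_mx F s r K iota Qd N B).

Definition win_log : fps (ratfun K) := tr_log epsW.

Let eps0 : (eps : ratfun K) != 0.
Proof. by rewrite tofrac_eq0 polyX_eq0. Qed.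

Let epsk0 : (eps : ratfun K) ^+ k != 0.
Proof. exact: expf_neq0 eps0. Qed.

(** At [t = 0] the characteristic polynomial is ['X^k]. Its lower coefficients are thus divisible by
    [t] and give negative powers of [eps] after division by [eps^k]; the leading 1 only gives the
    constant term. *)
Lemma char_poly_cut_polar (D : 'M[fps F]_k) m : map_mx (@cst_coef F) D ^+ m = 0 ->
  fps_in (@polar_coef K) (fpsC (eps ^- k) * lift (char_poly D)) /\
  (fpsC (eps ^- k) * lift (char_poly D)) 0%N = 1.
Proof.
move=> D0.
have coefE t : (fpsC (eps ^- k) * lift (char_poly D)) t =
    eps ^- k * \sum_(u < k.+1) eps ^+ u * rat_inj iota ((char_poly D)`_u t).
  rewrite fps_coefCM lift_epsE size_char_poly fps_coef_sum; congr (_ * _).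
  by apply: eq_bigr => u _; rewrite fps_coefCM.
have c0 u : (char_poly D)`_u 0%N = (u == k)%:R.
  rewrite -[LHS]/(cst_coef _) -coef_map map_char_poly.
  by rewrite (char_poly_nilpotent D0) coefXn.
have D1 : (fpsC (eps ^- k) * lift (char_poly D)) 0%N = 1.
  rewrite coefE big_ord_recr /= big1 => [|u _].
    by rewrite c0 eqxx rmorph1 mulr1 add0r mulVf.
  by rewrite c0 ltn_eqF// rmorph0 mulr0.
split=> // -[|t]; first by rewrite D1; exists 1; rewrite rmorph1.
rewrite coefE mulr_sumr; apply: polar_sum => u _.
have [uk|] := ltnP u k.
  have ku : (k - u)%N = (k - u).-1.+1 by lia.
  have -> : eps ^- k * (eps ^+ u * rat_inj iota ((char_poly D)`_u t.+1)) =
      ratC (iota ((char_poly D)`_u t.+1)) * eps ^- (k - u).-1.+1.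
    have epsu0 : (eps : ratfun K) ^+ u != 0.
      exact: expf_neq0 eps0.
    have kE : (eps : ratfun K) ^+ k = eps ^+ (k - u) * eps ^+ u.
      by rewrite -exprD subnK// ltnW.
    by rewrite -ku kE invfM -mulrA (mulKf epsu0) mulrC.
  exact: polar_monom.
rewrite leq_eqVlt ltnNge -ltnS ltn_ord orbF => /eqP <-.
have -> : (char_poly D)`_k = 1.
  by have /monicP := char_poly_monic D; rewrite lead_coefE size_char_poly.
by rewrite fps_coef1 rmorph0 !mulr0; apply: polar0.
Qed.

Lemma win_log0 : win_log 0%N = 0.
Proof. by rewrite /win_log /= big_geq. Qed.

(** Exact in [t], since the window matrix and [Dc] belong to the same truncated operator. With
    [win_log = z + w] split into polar and regular parts, [exp w], the unit parts of the indicial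
    polynomials and the cofactor [U] make up one regular factor [V]. *)
Lemma exp_polar_window :
  fpsC (eps ^+ k) * fps_exp (fps_map (@polar_part K) win_log) = lift (char_poly Dc).
Proof.
have charK := ratfun_unit_nat iota charF; have gR := graded_reg0 K.
pose z := fps_map (@polar_part K) win_log; pose w := win_log - z.
have z0 : z 0%N = 0 by rewrite -[LHS]/(polar_part (win_log 0%N)) win_log0 raddf0.
have w0 : w 0%N = 0 by rewrite fps_coefB win_log0 z0 subrr.
have zP : fps_in (@polar_coef K) z.
  case=> [|n]; first by rewrite z0; exists 0; rewrite rmorph0.
  by have [] := polar_partP (win_log n.+1).
have wR : fps_in (fun=> @reg0 K) w by move=> n; have [] := polar_partP (win_log n).
have [U [UR AU]] := det_window charF iota Qd exps_le B_large.
have expE : fps_exp win_log = \det (1 + epsW).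
  by rewrite fps_exp_tr_log// => i j; rewrite mxE.
have wzE : fps_exp win_log = fps_exp z * fps_exp w.
  by rewrite -(fps_expD charK z0 w0) /w addrC subrK.
set q := \prod_i rpoly iota (indicial_unit s r (@idx B i)).
pose V := fps_exp w * (fpsC q * U).
have VR : fps_in (fun=> @reg0 K) V.
  apply: (gradedM gR); last apply: (gradedM gR) => //.
    apply: (graded_exp gR) => // m [|n]; last exact: reg00.
    by rewrite -(rmorph_nat (@ratC K)) -fmorphV; apply: reg0_ratC.
  case=> [|n]; last exact: reg00.
  by apply: reg0_prod => i _; apply: reg0_rpoly.
have zV : fpsC (eps ^+ k) * (fps_exp z * V) = lift (char_poly Dc).
  rewrite -AU det_win_mx (prod_indicial charF iota exps_le B_large) -expE wzE rmorphM /= -/q /V.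
  by rewrite -!mulrA; congr (_ * _); rewrite [RHS]mulrCA; congr (_ * _); rewrite mulrCA.
have mnil : map_mx (@cst_coef F) Dc ^+ (\max_a (tnth (exp_tuple charF s r) a).2).+1 = 0.
  apply: monodromy_nilpotent => [i c v|i v|a].
  - exact: qcut_scl.
  - exact: dlog_qcut.
  by rewrite ltnS leq_bigmax.
have [chiP chi0] := char_poly_cut_polar mnil.
have zE := exp_polar_unique charK z0 zP VR chiP chi0.
have epsK (f : fps (ratfun K)) : fpsC (eps ^- k) * (fpsC (eps ^+ k) * f) = f.
  by rewrite mulrA -rmorphM (mulVf epsk0) rmorph1 mul1r.
rewrite -/z zE; last by rewrite -zV epsK.
by rewrite mulrCA epsK.
Qed.

End ExpPolar.

(** * The coefficient of [x^eps] *)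

Section EpsSide.
Variables (F : fieldType) (K : fieldType) (iota : {rmorphism F -> K}) (r : seq F).
Variables (Qd : nat -> seq (laurent F)) (N b : nat).
Hypothesis bandQ : forall i, (i <= N)%N -> band b (Qd i).
Local Notation rpoly := (rpoly iota).
Local Notation E := (ratfun K).

Lemma theta_eps_inj c (v : E) : theta_eps (rat_inj iota c * v) = rat_inj iota c * theta_eps v.
Proof. exact: mulrCA. Qed.

Lemma pact_eps p (v : E) : pact (rat_inj iota) (@theta_eps K) p v = rpoly p * v.
Proof.
elim/poly_ind: p v => [|p c IHp] v; first by rewrite pact0 rmorph0 mul0r.
by rewrite pact_cons IHp rmorphD rmorphM /= rpolyX rpolyC mulrDl mulrA.
Qed.

Definition eps_indicial (d : int) : E := \prod_(c <- r) (eps + d%:~R - rat_inj iota c).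

Definition pow_op m : fps (laurent E) := iter m (opPinvQ iota r Qd) 1.

Lemma pow_op0 j d : pow_op 0 j d = ((j == 0%N) && (d == 0))%:R.
Proof.
rewrite [pow_op 0 j](fps_coef1 _ j); case: j => [|j] /=; last by [].
by case: (d == 0).
Qed.

Lemma pow_opS m j d : pow_op m.+1 j d = (eps_indicial d)^-1 *
  \sum_(1 <= i < j.+1) diffop (rat_inj iota) (@theta_eps K) (Qd i) (pow_op m (j - i)%N) d.
Proof. by rewrite -laurent_coef_sum. Qed.

Lemma diffop_eps_coef (q : seq (laurent F)) (f : laurent E) d lo W :
  (forall m : int, (m < lo) || (lo + W%:Z <= m) ->
     f m = 0 \/ forall j, q`_j (d - m + j%:Z) = 0) ->
  diffop (rat_inj iota) (@theta_eps K) q f d =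
  \sum_(i < W) rpoly (op_entry q d (lo + i%:Z)) * f (lo + i%:Z).
Proof.
move=> out; rewrite (@diffop_coef _ _ _ _ theta_eps_inj _ _ _ lo W)//.
by apply: eq_bigr => i _; rewrite pact_eps.
Qed.

Lemma pow_op_support m j d : (j <= N)%N -> d < - (j * b)%N%:Z -> pow_op m j d = 0.
Proof.
elim: m j d => [|m IHm] j d jN dj.
  by rewrite pow_op0; case: eqP => //= j0; case: eqP => // d0; lia.
rewrite pow_opS big_nat_cond big1 ?mulr0// => i; rewrite andbT => i_bnd.
rewrite (@diffop_eps_coef _ _ _ 0 0) ?big_ord0// => m' _.
have [m'd|dm'] := leP m' (d + b%:Z); first by left; apply: IHm; [lia|nia].
by right=> j'; apply: (bandQ (i := i)); lia.
Qed.

Lemma shift_rpoly_reg0 c p : reg0 (shift c (rpoly p)).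
Proof. by rewrite /rpoly /= shift_tofrac; apply: reg0_tofrac. Qed.

Lemma shift_eps_indicial c d : shift c (eps_indicial d) =
  FracField.tofrac (\prod_(c' <- r) ('X + (c + d%:~R - iota c')%:P)).
Proof.
rewrite /eps_indicial !rmorph_prod /=; apply: eq_bigr => c' _.
rewrite rmorphB rmorphD /= shift_eps shift_ratC rmorph_int tofracD.
by rewrite -[tofrac _%:P]/(ratC _) rmorphB rmorphD /= rmorph_int -!addrA.
Qed.

(** A pole at [c] arises only when [P^-1] is applied at some [x^(eps + e)] with [c + e] among the
    roots. At order [j] in [t] the relevant [e] are at least [- j b], and at most [(N - j) b]
    because the remaining orders must bring the exponent back down; hence [|e| <= N b]. *)
Lemma pow_op_reg0 c m j d : (j <= N)%N -> d <= ((N - j) * b)%N%:Z ->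
  (forall e : int, (`|e| <= N * b)%N -> forall c', c' \in r -> c + e%:~R != iota c') ->
  reg0 (shift c (pow_op m j d)).
Proof.
move=> jN dj cr; elim: m j d jN dj => [|m IHm] j d jN dj.
  by rewrite pow_op0 rmorph_nat -tofrac1 -tofracMn; apply: reg0_tofrac.
have [dlt|dge] := ltP d (- (j * b)%N%:Z).
  by rewrite pow_op_support// rmorph0; apply: reg00.
rewrite pow_opS rmorphM fmorphV /=; apply: reg0M.
  rewrite shift_eps_indicial; apply: reg0_inv; rewrite horner_prod.
  rewrite prodf_seq_neq0; apply/allP => c' rc'; rewrite hornerD hornerX hornerC add0r.
  by rewrite subr_eq0 cr//; nia.
rewrite rmorph_sum big_nat_cond; apply: reg0_sum => i; rewrite andbT => i_bnd.
(* The previous power is zero below [lo], and exponents above [d + b] cannot be lowered to [d]. *)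
have [lo [Wd out]] : exists (lo : int) (Wd : nat), lo + Wd%:Z = d + b%:Z + 1 /\ lo <= - (j * b)%N%:Z.
  exists (- (j * b)%N%:Z), (absz (d + b%:Z + 1 + (j * b)%N%:Z)); lia.
rewrite (@diffop_eps_coef _ _ _ lo Wd); last first.
  move=> m' /orP[m'lo|m'hi].
    by left; apply: pow_op_support; [lia|nia].
  by right=> j'; apply: (bandQ (i := i)); lia.
rewrite rmorph_sum; apply: reg0_sum => x _; rewrite rmorphM; apply: reg0M.
  exact: shift_rpoly_reg0.
by apply: IHm; [lia|have := ltn_ord x; nia].
Qed.

End EpsSide.

(** * Window entries as translates of the coefficient of [x^eps] *)

Section WindowEps.
Variables (F : fieldType) (charF : [pchar F] =i pred0) (s : F) (r : seq F).
Variables (K : closedFieldType) (iota : {rmorphism F -> K}).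
Variables (Qd : nat -> seq (laurent F)) (N b M B : nat).
Local Notation W := B.*2.+1.
Hypothesis bandQ : forall i, (i <= N)%N -> band b (Qd i).
Hypothesis exps_le : forall n, (0 < exp_mult s r n)%N -> (`|n| <= M)%N.
Hypothesis B_large : (M + (N * b).*2 <= B)%N.
Local Notation rpoly := (rpoly iota).
Local Notation idx := (@idx B).
Local Notation entry := (@win_entry F s r Qd N B).
Local Notation epsW := (@eps_mx F s r K iota Qd N B).
Local Notation v := (pow_op iota r Qd).
Local Notation sh i := (shift (iota (s + (idx i)%:~R))).

Lemma win_entry_band t i j : (0 < t)%N -> idx i < idx j - b%:Z -> entry t i j = 0.
Proof.
case: t => // t _ ij; rewrite /win_entry; case: ifP => // tN.
by rewrite /log_entry (op_entry0 (bandQ tN))// comp_poly0.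
Qed.

Lemma epsWX_coefS m j i n : (epsW ^+ m.+1) i n j =
  \sum_(1 <= t < j.+1) \sum_x (rpoly (indicial s r (idx i)))^-1 * rpoly (entry t i x) *
    (epsW ^+ m) x n (j - t)%N.
Proof.
rewrite exprS mxE fps_coef_sum [RHS]exchange_big; apply: eq_bigr => x _.
rewrite fps_coefM big_ord_recl [X in X * _](_ : _ = 0); last by rewrite mxE.
rewrite mul0r add0r big_add1 big_mkord; apply: eq_bigr => t _.
by rewrite mxE.
Qed.

Lemma epsWX_support m j i n : idx i < idx n - (j * b)%N%:Z -> (epsW ^+ m) i n j = 0.
Proof.
elim: m j i => [|m IHm] j i ilt.
  rewrite mxE fps_coef_nat; case: eqP => [E|]; last by rewrite mul0rn.
  by rewrite E in ilt; lia.
rewrite epsWX_coefS big_nat_cond big1// => t; rewrite andbT => t_bnd.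
rewrite big1// => x _; have [xi|ix] := leP (idx x) (idx i + b%:Z).
  by rewrite IHm ?mulr0//; nia.
by rewrite win_entry_band ?rmorph0 ?mulr0 ?mul0r//; lia.
Qed.

(** A path of order [j] in [t] from [n] to [i] visits only exponents between [idx n - j b] and
    [idx i + j b], and a pole at [eps = 0] needs a division at a position of positive
    multiplicity. *)
Lemma epsWX_reg0 m j i n :
  (forall e, (0 < exp_mult s r e)%N ->
     idx n - (j * b)%N%:Z <= e -> e <= idx i + (j * b)%N%:Z -> False) ->
  reg0 ((epsW ^+ m) i n j).
Proof.
elim: m j i => [|m IHm] j i noexp.
  by rewrite mxE fps_coef_nat -tofrac1 -!tofracMn; apply: reg0_tofrac.
rewrite epsWX_coefS big_nat_cond; apply: reg0_sum => t; rewrite andbT => t_bnd.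
apply: reg0_sum => x _.
have [xlt|xge] := ltP (idx x) (idx n - ((j - t) * b)%N%:Z).
  by rewrite epsWX_support// mulr0; apply: reg00.
have [ix|xi] := ltP (idx i) (idx x - b%:Z).
  by rewrite win_entry_band ?rmorph0 ?mulr0 ?mul0r//; [exact: reg00|lia].
apply: reg0M; first apply: reg0M; last 1 first.
- apply: IHm => e e0 en ex; apply: (noexp e) => //; nia.
- apply: reg0_rpolyV; rewrite indicialE.
  have -> : exp_mult s r (idx i) = 0%N.
    by apply/eqP; rewrite -leqn0 leqNgt; apply/negP => /noexp; apply; nia.
  by rewrite expr0 mul1r indicial_unit0.
- exact: reg0_rpoly.
Qed.

Lemma shift_rpoly (c : F) p : shift (iota c) (rpoly p) = rpoly (p \Po ('X + c%:P)).
Proof.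
rewrite /rpoly /= shift_tofrac map_comp_poly rmorphD /= map_polyX map_polyC.
by [].
Qed.

Lemma shift_indicial i n : sh n (eps_indicial iota r (idx i - idx n)) = rpoly (indicial s r (idx i)).
Proof.
rewrite shift_eps_indicial /rpoly /= /indicial; congr (tofrac _); rewrite rmorph_prod.
apply: eq_bigr => c _; rewrite [RHS]rmorphD /= map_polyX map_polyC; congr (_ + _%:P).
rewrite -[(idx i - idx n)%:~R](rmorph_int iota) -rmorphD -rmorphB; congr (iota (_ - _)).
by rewrite -addrA; congr (s + _); rewrite -rmorphD [idx n + _]addrC subrK.
Qed.

(** After translation by [s + idx n] both sides obey the same recursion. The bounds keep all paths
    in the window: from [n] they do not fall below [- B], and from above [B] they do not come down
    to [i]. *)
Lemma pow_op_window m j i n : (j <= N)%N -> idx i <= B%:Z - (j * b)%N%:Z ->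
  - B%:Z <= idx n - (j * b)%N%:Z ->
  sh n (v m j (idx i - idx n)) = (epsW ^+ m) i n j.
Proof.
elim: m j i => [|m IHm] j i jN iB nB.
  rewrite pow_op0 subr_eq0 (inj_eq (@idx_inj _)) rmorph_nat mxE fps_coef_nat.
  by case: (j == 0%N); rewrite ?mulr1n ?mulr0n.
rewrite pow_opS rmorphM fmorphV /= shift_indicial epsWX_coefS.
rewrite rmorph_sum mulr_sumr; apply: eq_big_nat => t t_bnd.
rewrite (@diffop_eps_coef _ _ _ _ _ _ (- B%:Z - idx n) W); last first.
  move=> m' /orP[m'lo|m'hi].
    by left; apply: (pow_op_support _ _ bandQ); [lia|nia].
  by right=> j'; apply: (bandQ (i := t)); [lia|nia].
rewrite rmorph_sum mulr_sumr; apply: eq_bigr => x _.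
have xE : - B%:Z - idx n + x%:Z = idx x - idx n by rewrite /idx; lia.
rewrite xE rmorphM /= shift_rpoly mulrA.
have -> : op_entry (Qd t) (idx i - idx n) (idx x - idx n) \Po ('X + (s + (idx n)%:~R)%:P) =
    entry t i x.
  case: t t_bnd => // t t_bnd; rewrite /win_entry ifT; last by lia.
  rewrite /log_entry /op_entry -!comp_polyA; congr (symbol _ _ \Po _); last first.
    by rewrite opprB addrA subrK.
  rewrite !comp_polyD !comp_polyX !comp_polyC -!addrA -!polyCD; congr ('X + _%:P).
  rewrite -addrA; congr (s + _); rewrite -rmorphD /=; congr (_%:~R).
  by rewrite /idx; lia.
(* Beyond this bound, one application of [Q] cannot lower position [x] to row [i]; below it the
   induction hypothesis applies. *)
have [xB|xB] := leP (idx x) (B%:Z - ((j - t) * b)%N%:Z).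
  by rewrite IHm//; [lia|nia].
by rewrite win_entry_band ?rmorph0 ?mulr0 ?mul0r//; [lia|nia].
Qed.

Let c_ m : ratfun K := (-1) ^+ m.-1 / m%:R.

Let shift_c c m : shift c (c_ m) = c_ m.
Proof. by rewrite /c_ rmorphM fmorphV rmorph_nat rmorphXn rmorphN1. Qed.

Let reg0_c m : reg0 (c_ m).
Proof.
suff -> : c_ m = ratC ((-1) ^+ m.-1 / m%:R) by apply: reg0_ratC.
by rewrite /c_ rmorphM fmorphV rmorph_nat rmorphXn rmorphN1.
Qed.

Lemma coef_log_xepsE j : coef_log_xeps iota r Qd j = \sum_(1 <= m < j.+1) c_ m * v m j 0.
Proof.
rewrite /coef_log_xeps /= laurent_coef_sum; apply: eq_bigr => m _.
by rewrite laurent_coefCM.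
Qed.

Lemma coef_log_xeps_reg0 c j : (j <= N)%N ->
  (forall e : int, (`|e| <= N * b)%N -> forall c', c' \in r -> c + e%:~R != iota c') ->
  reg0 (shift c (coef_log_xeps iota r Qd j)).
Proof.
move=> jN cr; rewrite coef_log_xepsE rmorph_sum; apply: reg0_sum => m _.
rewrite rmorphM /= shift_c; apply: reg0M => //.
exact: (pow_op_reg0 bandQ).
Qed.

(** On the core the entries are translates of the coefficient of [x^eps]. Any other diagonal
    position is more than [N b] away from every exponent, so its entry is regular. *)
Lemma win_log_polar j : (j <= N)%N ->
  polar_part (win_log s r iota Qd N B j) =
  \sum_(i | (`|idx i| <= B - N * b)%N) polar_part (sh i (coef_log_xeps iota r Qd j)).
Proof.
move=> jN.
have -> : win_log s r iota Qd N B j = \sum_i \sum_(1 <= m < j.+1) c_ m * (epsW ^+ m) i i j.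
  rewrite exchange_big /=; apply: eq_bigr => m _.
  by rewrite fps_coef_sum mulr_sumr.
rewrite raddf_sum (bigID (fun i => `|idx i| <= B - N * b)%N)/= [X in _ + X]big1 ?addr0.
  apply: eq_bigr => i iB; congr polar_part.
  rewrite -[X in shift _ X]/(coef_log_xeps iota r Qd j) coef_log_xepsE rmorph_sum.
  apply: eq_bigr => m _; rewrite rmorphM /= shift_c -(pow_op_window _ jN) ?subrr//; nia.
move=> i iB; apply: polar_part_reg0; apply: reg0_sum => m _; apply: reg0M => //.
apply: epsWX_reg0 => e /exps_le eM ei ie; have := idx_le i; nia.
Qed.

End WindowEps.

(** [f] and [be] are two bases of the same space over [Lam]. Freeness of [f] makes [G] and [H]
    inverse to each other, so [D] is similar to the matrix [D'] of [d] in the basis [f], whose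
    coordinate vectors are generalized eigenvectors. *)
Lemma char_poly_gen_eig_basis (Lam : fieldType) (Om : comNzRingType)
    (phi : {rmorphism Lam -> Om}) (d : {additive Om -> Om}) n (be f : 'rV[Om]_n)
    (G H D : 'M[Lam]_n) (lam : 'I_n -> Lam) m :
  (forall c h, d (phi c * h) = phi c * d h) ->
  (forall c : 'cV[Lam]_n, f *m map_mx phi c = 0 -> c = 0) ->
  be = f *m map_mx phi G -> f = be *m map_mx phi H ->
  map_mx d be = be *m map_mx phi D ->
  (forall j, iter m (fun h => d h - phi (lam j) * h) (f 0 j) = 0) ->
  char_poly D = \prod_j ('X - (lam j)%:P).
Proof.
case: n be f G H D lam => [|n] be f G H D lam d_phi f_free beE fE dbe lamP.
  by rewrite /char_poly det_mx00 big_ord0.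
have f_inj (A B : 'M[Lam]_n.+1) : f *m map_mx phi A = f *m map_mx phi B -> A = B.
  move=> AB; apply/eqP; rewrite -subr_eq0; apply/eqP/matrixP => i j.
  have := f_free ((A - B) *m delta_mx j 0).
  rewrite map_mxM mulmxA map_mxB mulmxBr AB subrr mul0mx -colE.
  by move=> /(_ erefl) /colP/(_ i); rewrite !mxE.
have GH : G *m H = 1%:M.
  by apply: f_inj; rewrite map_mxM mulmxA -beE -fE map_mx1 mulmx1.
have HG : H *m G = 1%:M by apply: mulmx1C.
pose D' := G *m D *m H.
have d_mul p (v : 'rV[Om]_n.+1) (A : 'M[Lam]_(n.+1, p)) :
    map_mx d (v *m map_mx phi A) = map_mx d v *m map_mx phi A.
  apply/matrixP => i j; rewrite !mxE raddf_sum; apply: eq_bigr => k _.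
  by rewrite !mxE mulrC d_phi mulrC.
have df : map_mx d f = f *m map_mx phi D'.
  by rewrite {1}fE d_mul dbe {1}beE /D' !map_mxM !mulmxA.
have iterE j m' (c : 'cV[Lam]_n.+1) :
    iter m' (fun h => d h - phi (lam j) * h) ((f *m map_mx phi c) 0 0) =
    (f *m map_mx phi ((D' - (lam j)%:M) ^+ m' *m c)) 0 0.
  elim: m' => [|m' IHm] /=; first by rewrite expr0 mul1mx.
  have -> : (D' - (lam j)%:M) ^+ m'.+1 *m c = (D' - (lam j)%:M) *m ((D' - (lam j)%:M) ^+ m' *m c).
    by rewrite exprS mulmxA.
  rewrite IHm.
  set w := _ *m c; rewrite mulmxBl map_mxB mulmxBr [RHS]mxE; congr (_ + _).
    by rewrite [in RHS]map_mxM [in RHS]mulmxA -df -d_mul [RHS]mxE.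
  by rewrite [RHS]mxE mul_scalar_mx map_mxZ -scalemxAr [in RHS]mxE.
have -> : char_poly D = char_poly D'.
  rewrite /char_poly; have -> : char_poly_mx D' = map_mx polyC G *m char_poly_mx D *m map_mx polyC H.
    rewrite /char_poly_mx mulmxBr mulmxBl /D' !map_mxM; congr (_ - _).
    by rewrite mul_mx_scalar -scalemxAl -map_mxM GH map_mx1 scalemx1.
  rewrite !det_mulmx mulrAC -det_mulmx -map_mxM GH map_mx1 det1 mul1r.
  by [].
apply: (@char_poly_gen_eig _ _ _ _ m) => j.
apply: f_free; apply/matrixP => i i'; rewrite !ord1 -iterE.
have -> : (f *m map_mx phi (delta_mx j (0 : 'I_1))) 0 0 = f 0 j.
  rewrite mxE (bigD1 j)//= !mxE !eqxx rmorph1 mulr1 big1 ?addr0// => k kj.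
  by rewrite !mxE (negPf kj) rmorph0 mulr0.
by rewrite lamP mxE.
Qed.

(** * Exponents *)

Section SolutionBasis.
Variables (F : fieldType) (charF : [pchar F] =i pred0) (s : F) (r : seq F).
Variable Qd : nat -> seq (laurent F).
Local Notation V := (laurent {poly F}).
Local Notation k := (class_size r s).
Local Notation qf := (@qfull F s Qd).
Local Notation index_of := (tnth (exp_tuple charF s r)).

Definition basis_sol (a : 'I_k) : fps V := Fps (@log_sol F charF s r qf a).

Definition log_const : fps F -> fps V := fps_map (@laurentC _ \o polyC).

Definition log_size_bounded (v : V) := exists d, forall n, (size (v n) <= d)%N.

Lemma log_size_bounded_qop q v : log_size_bounded v -> log_size_bounded (qop_log s q v).
Proof.
move=> [d vd]; exists d => n; have [b qb] := band_exists q.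
have [lo vlo] := laurent_bounded v.
rewrite (@qop_log_coef _ _ _ _ _ lo (absz (n + b%:Z - lo)%R).+1).
  apply: leq_trans (size_sum _ _ _) _; apply/bigmax_leqP => i _.
  by apply: leq_trans (size_dact _ _) _.
by move=> m /orP[/vlo|mhi]; [left|right=> j; apply: qb; lia].
Qed.

(** Needed for membership in [solution]: differential operators do not raise the degree in [log x],
    and inverting [P] raises it by at most a multiplicity, hence by at most [size r]. *)
Lemma log_size_bounded_sol a j : log_size_bounded (@log_sol F charF s r qf a j).
Proof.
have [m] := ubnP j; elim: m j => // m IHm [|j] jm.
  exists (size ((index_of a).2`!%:R^-1 *: 'X^((index_of a).2) : {poly F})) => n.
  by rewrite log_sol0 /=; case: eqP => // _; rewrite size_poly0.
have [d vd] : log_size_bounded (\sum_(1 <= i < j.+2) qf i (@log_sol F charF s r qf a (j.+1 - i)%N)).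
  rewrite big_nat_cond; elim/big_rec: _ => [|i v /andP[i_bnd _] [d vd]].
    by exists 0%N => n; rewrite size_poly0.
  have [d' vd'] : log_size_bounded (qf i (@log_sol F charF s r qf a (j.+1 - i)%N)).
    by apply: log_size_bounded_qop; apply: IHm; lia.
  exists (maxn d d') => n; apply: leq_trans (size_polyD _ _) _.
  by rewrite geq_max !leq_max vd vd' orbT.
exists (d + size r)%N => n; rewrite log_solS laurent_coefN size_polyN.
have [_ _ sz] := inv_atP charF s r n ((\sum_(1 <= i < j.+2) qf i (@log_sol F charF s r qf a (j.+1 - i)%N)) n).
by apply: leq_trans sz _; apply: leq_add; [exact: vd|exact: count_size].
Qed.

Lemma solution_basis_sol a : solution r Qd s (basis_sol a).
Proof.
split; first by move=> n; apply: log_size_bounded_sol.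
apply: (fpsP _ _).1 => j; exact: (formal_op_log_sol charF (s := s) (r := r) qf a j).
Qed.

Let log_constE (c : fps F) a j : (log_const c * basis_sol a) j =
  \sum_(i < j.+1) scl (c i) (@log_sol F charF s r qf a (j - i)%N).
Proof. by rewrite fps_coefM; apply: eq_bigr => i _; rewrite sclE. Qed.

Lemma solution_span f : solution r Qd s f ->
  exists c : 'I_k -> fps F, f = \sum_a log_const (c a) * basis_sol a.
Proof.
move=> [_ /fpsP f0]; exists (fun a => Fps (fun i => coef_log (index_of a) (f i))).
apply: (fpsP _ _).1 => j; rewrite fps_coef_sum.
have := log_sol_span charF (s := s) (r := r) (Q := qf) (fun i => @qop_log_scl _ s (Qd i)) f0 j.
move=> ->; apply: eq_bigr => a _; rewrite log_constE.
by apply: eq_bigr => i _.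
Qed.

Lemma dlog_basis_sol b : fps_map (@dlog F) (basis_sol b) =
  \sum_a log_const (@log_monodromy F charF s r qf a b) * basis_sol a.
Proof.
apply: (fpsP _ _).1 => j; rewrite fps_coef_sum.
rewrite -[LHS]/(dlog (@log_sol F charF s r qf b j)) dlog_sol.
- by apply: eq_bigr => a _; rewrite log_constE.
- by move=> i c v; apply: qop_log_scl.
- by move=> i v; apply: dlog_qop.
Qed.

End SolutionBasis.

Section LogDerivation.
Variable K : fieldType.
Hypothesis charK : forall n, n.+1%:R != 0 :> K.
Local Notation VK := (laurent {poly K}).

Definition log_deriv : fps VK -> fps VK := fps_map (laurent_map (@deriv K)).
HB.instance Definition _ := GRing.Additive.on log_deriv.

Lemma deriv_xpow (lam : fps K) : lam 0%N = 0 ->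
  fps_map (@deriv K) (xpow lam) = fps_map (@polyC K) lam * xpow lam.
Proof.
move=> lam0.
have -> : fps_map (@polyC K) lam = fps_map (@deriv K) (fps_map (fun c => c *: 'X) lam).
  by apply: (fpsP _ _).1 => n /=; rewrite derivZ derivX alg_polyC.
apply: (@fps_exp_derivation _ _ (fps_map (@deriv K))).
- by move=> n; rewrite poly_unitE -polyC_natr size_polyC charK coefC /= unitfE charK.
- move=> x y; apply: (fpsP _ _).1 => n.
  rewrite -[LHS]/(((x * y) n)^`()) fps_coefD !fps_coefM raddf_sum -big_split.
  by apply: eq_bigr => i _ /=; rewrite derivM.
- by move=> N g gN n nN /=; rewrite gN// raddf0.
- by rewrite /= lam0 scale0r.
Qed.

Definition xpow_log (lam : fps K) : fps VK := fps_map (@laurentC _) (xpow lam).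
Definition log_constK (lam : fps K) : fps VK := fps_map (@laurentC _ \o polyC) lam.

Lemma log_deriv_xpow (lam : fps K) (g : fps VK) : lam 0%N = 0 ->
  log_deriv (xpow_log lam * g) - log_constK lam * (xpow_log lam * g) =
  xpow_log lam * log_deriv g.
Proof.
move=> lam0; suff -> : log_deriv (xpow_log lam * g) =
    log_constK lam * (xpow_log lam * g) + xpow_log lam * log_deriv g.
  by rewrite addrAC subrr add0r.
have -> : log_constK lam * (xpow_log lam * g) =
    fps_map (@laurentC _) (fps_map (@deriv K) (xpow lam)) * g.
  by rewrite deriv_xpow// rmorphM mulrA.
apply: (fpsP _ _).1 => n.
rewrite -[LHS]/(laurent_map (@deriv K) ((xpow_log lam * g) n)) fps_coefD !fps_coefM.
rewrite raddf_sum -big_split; apply: eq_bigr => i _; apply/laurentP => m.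
rewrite laurent_coefD -[LHS]/((((xpow_log lam i) * g (n - i)%N) m)^`()).
by rewrite !laurent_coefCM derivM.
Qed.

(** Conjugation by [x^lambda] turns [D_log - lambda] into [D_log], which is nilpotent on bounded
    degree in [log x]; hence each [x^lambda g] is a generalized eigenvector. *)
Lemma iter_log_deriv_xpow (lam : fps K) (g : fps VK) m : lam 0%N = 0 ->
  iter m (fun h => log_deriv h - log_constK lam * h) (xpow_log lam * g) =
  xpow_log lam * iter m log_deriv g.
Proof. by move=> lam0; elim: m => //= m ->; apply: log_deriv_xpow. Qed.

Lemma iter_log_deriv0 (g : fps VK) m : (forall a n, size (g a n) <= m)%N ->
  iter m log_deriv g = 0.
Proof.
move=> gm; apply: (fpsP _ _).1 => a; apply/laurentP => n.
have -> : iter m log_deriv g a n = (g a n)^`(m).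
  by elim: m {gm} => //= m ->.
by rewrite derivn_poly0.
Qed.

End LogDerivation.

Section ClassExponents.
Variables (F : fieldType) (charF : [pchar F] =i pred0) (s : F) (r : seq F).
Variables (K : fieldType) (iota : {rmorphism F -> K}) (L : nat) (L_gt0 : (0 < L)%N).
Variable Qd : nat -> seq (laurent F).
Local Notation k := (class_size r s).
Local Notation D := (@log_monodromy F charF s r (@qfull F s Qd)).
Local Notation Om := (laurent (laurent {poly K})).

Definition bc : fps (laurent {poly F}) -> Om :=
  @laurent_of_fps _ \o (ramify_rm L_gt0 \o fps_map (laurent_map (map_poly iota))).
HB.instance Definition _ := GRing.RMorphism.on bc.

Definition ram : fps F -> fps K := ramify_rm L_gt0 \o fps_map iota.
HB.instance Definition _ := GRing.RMorphism.on ram.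

Definition scal_rm : laurent K -> Om := laurent_map (@laurentC _ \o polyC).
HB.instance Definition _ := GRing.RMorphism.on scal_rm.

Definition dlogK : Om -> Om := laurent_map (laurent_map (@deriv K)).
HB.instance Definition _ := GRing.Additive.on dlogK.

Lemma dlogK_scal c h : dlogK (scal_rm c * h) = scal_rm c * dlogK h.
Proof.
apply: (@laurent_map_injM K _ (@laurentC _ \o polyC) (laurent_map (@deriv K))) => {}c v.
apply/laurentP => n; rewrite -[LHS]/(((laurentC c%:P * v) n)^`()) !laurent_coefCM.
exact: deriv_polyCM.
Qed.

Lemma dlogK_fps (u : fps (laurent {poly K})) :
  dlogK (laurent_of_fps u) = laurent_of_fps (log_deriv u).
Proof. by apply/laurentP => -[n|n] //=; rewrite raddf0. Qed.

Lemma scal_rm_fps (c : fps K) : scal_rm (laurent_of_fps c) = laurent_of_fps (log_constK c).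
Proof. by apply/laurentP => -[n|n] //=; rewrite !raddf0. Qed.

Lemma bc_log_const c : bc (log_const c) = scal_rm (laurent_of_fps (ram c)).
Proof.
rewrite scal_rm_fps; congr (laurent_of_fps _); apply: (fpsP _ _).1 => n /=.
case: ifP => _; last by rewrite !raddf0.
by rewrite laurent_mapC /= map_polyC.
Qed.

Lemma bc_dlog u : dlogK (bc u) = bc (fps_map (@dlog F) u).
Proof.
rewrite dlogK_fps; congr (laurent_of_fps _); apply: (fpsP _ _).1 => n /=.
case: ifP => _; last by rewrite raddf0.
by apply/laurentP => m /=; rewrite deriv_map.
Qed.

(** The images of the [basis_sol] and the [x^lambda g] generate the same space over [K((u))]: one
    transition matrix comes from [is_basis], the other from [solution_span]. *)
Lemma char_poly_monodromy (lambda : 'I_k -> fps K) :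
  class_exponents iota L r Qd s lambda ->
  map_poly ram (char_poly D) = \prod_j ('X - (lambda j)%:P).
Proof.
have charK n : n.+1%:R != 0 :> K by rewrite -(rmorph_nat iota) fmorph_eq0 (pcharf0P F).1.
move=> [lam0 [g [gk [f_free f_gen]]]].
pose fj j : Om := laurent_of_fps (xpow_log (lambda j) * g j).
pose f : 'rV[Om]_k := \row_j fj j.
pose ea a := @basis_sol F charF s r Qd a.
pose be : 'rV[Om]_k := \row_a bc (ea a).
pose toL := @laurent_of_fps K \o ram.
have bc_comb (c : 'I_k -> fps F) : bc (\sum_a log_const (c a) * ea a) =
    \sum_a scal_rm (toL (c a)) * bc (ea a).
  by rewrite rmorph_sum; apply: eq_bigr => a _; rewrite rmorphM -bc_log_const.
have /choice[G GE] a : exists c : 'I_k -> laurent K, bc (ea a) = \sum_j scal_rm (c j) * fj j.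
  apply/f_gen; exists 1%N, (fun=> 1), (fun=> ea a); split.
    by move=> _; apply: solution_basis_sol.
  by rewrite big_ord1 /scal -/scal_rm rmorph1 mul1r.
have /choice[H HE] j : exists c : 'I_k -> laurent K, fj j = \sum_a scal_rm (c a) * bc (ea a).
  have : ext_scalars iota L (solution r Qd s) (fj j).
    apply/f_gen; exists (fun i => (i == j)%:R); rewrite (bigD1 j)//= eqxx /scal rmorph1 mul1r.
    by rewrite big1 ?addr0// => i /negPf ->; rewrite rmorph0 mul0r.
  move=> [n [c [u [uM fE]]]].
  have /choice[c' c'E] i : exists c' : 'I_k -> fps F, u i = \sum_a log_const (c' a) * ea a.
    exact: solution_span (uM i).
  exists (fun a => \sum_i c i * toL (c' i a)); rewrite fE.
  under [RHS]eq_bigr do rewrite rmorph_sum mulr_suml.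
  rewrite exchange_big; apply: eq_bigr => i _.
  rewrite -[LHS]/(scal_rm (c i) * bc (u i)) c'E bc_comb mulr_sumr.
  by apply: eq_bigr => a _; rewrite rmorphM mulrA.
(* The comparison of bases needs the field [K((u))], in which [K[[u]]] embeds. *)
apply: (@map_inj_poly _ _ (@laurent_of_fps K)); [exact: laurent_of_fps_inj|exact: raddf0|].
rewrite -map_poly_comp -/toL map_char_poly rmorph_prod.
rewrite (eq_bigr (fun j => 'X - (laurent_of_fps (lambda j))%:P)); last first.
  by move=> j _; rewrite rmorphB /= map_polyX map_polyC.
apply: (@char_poly_gen_eig_basis (laurent K) Om scal_rm dlogK k be f
  (\matrix_(j, a) G a j) (\matrix_(a, j) H j a) _ _ k dlogK_scal).
- move=> c fc; apply/matrixP => j j'; rewrite ord1 mxE.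
  apply: (f_free (fun j => c j 0)); have := congr1 (fun v : 'rV_1 => v 0 0) fc.
  rewrite !mxE => fc0; rewrite -[RHS]fc0; apply: eq_bigr => i _.
  by rewrite !mxE [RHS]mulrC.
- apply/matrixP => i a; rewrite ord1 !mxE GE; apply: eq_bigr => j _.
  by rewrite !mxE mulrC.
- apply/matrixP => i j; rewrite ord1 !mxE HE; apply: eq_bigr => a _.
  by rewrite !mxE mulrC.
- apply/matrixP => i b; rewrite ord1 !mxE [LHS]bc_dlog dlog_basis_sol bc_comb.
  by apply: eq_bigr => a _; rewrite !mxE mulrC.
move=> j; rewrite mxE /fj.
have -> m : iter m (fun h => dlogK h - scal_rm (laurent_of_fps (lambda j)) * h)
    (laurent_of_fps (xpow_log (lambda j) * g j)) =
    laurent_of_fps (iter m (fun h => log_deriv h - log_constK (lambda j) * h) (xpow_log (lambda j) * g j)).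
  elim: m => //= m ->.
  by rewrite dlogK_fps scal_rm_fps -rmorphM -raddfB.
by rewrite iter_log_deriv_xpow// iter_log_deriv0 ?mulr0 ?raddf0//.
Qed.

End ClassExponents.

Section Congruence.
Variables (R : comNzRingType) (N : nat).
Implicit Types f g : fps R.

Definition fps_cong f g := forall n, (n <= N)%N -> f n = g n.

Lemma fps_congM f f' g g' : fps_cong f f' -> fps_cong g g' -> fps_cong (f * g) (f' * g').
Proof.
move=> ff' gg' n nN; rewrite !fps_coefM; apply: eq_bigr => i _.
by rewrite ff' ?gg'//; have := ltn_ord i; lia.
Qed.

Lemma fps_congMl f g g' : fps_cong g g' -> fps_cong (f * g) (f * g').
Proof. by apply: fps_congM. Qed.

Lemma fps_cong_prod (I : Type) (r : seq I) (P : pred I) (f g : I -> fps R) :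
  (forall i, fps_cong (f i) (g i)) ->
  fps_cong (\prod_(i <- r | P i) f i) (\prod_(i <- r | P i) g i).
Proof. by move=> fg; elim/big_ind2: _ => // *; apply: fps_congM. Qed.

Lemma fps_cong_det n (A B : 'M[fps R]_n) : (forall i j, fps_cong (A i j) (B i j)) ->
  fps_cong (\det A) (\det B).
Proof.
move=> AB m mN; rewrite !fps_coef_sum; apply: eq_bigr => s _.
by apply: fps_congM mN => //; apply: fps_cong_prod.
Qed.

End Congruence.

(** * Assembly over the classes modulo the integers *)

Section Assembly.
Variables (F : fieldType) (charF : [pchar F] =i pred0).
Variables (K : closedFieldType) (iota : {rmorphism F -> K}).
Variables (r : seq F) (Qd : nat -> seq (laurent F)) (l : nat) (s : 'I_l -> F).
Hypothesis hs : smallest_reps r s.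
Local Notation D i := (@log_monodromy F charF (s i) r (@qfull F (s i) Qd)).
Local Notation lift := (lift_eps iota).

Lemma sum_class_size : (\sum_i class_size r (s i) = size r)%N.
Proof.
have [_ s_inj s_surj] := hs; rewrite -sum1_size.
under eq_bigr do rewrite /class_size -sum1_count big_mkcond.
rewrite exchange_big; apply: eq_big_seq => c rc /=.
have [i [m cE]] := s_surj c rc; rewrite (bigD1 i)//= big1 => [|j ji].
  by rewrite ifT//; apply/asboolP; exists m%:Z; rewrite cE addrC addKr.
rewrite ifF//; apply/negP => /asboolP[m' m'E]; case/eqP: ji; apply: s_inj.
exists (m%:Z - m'); rewrite rmorphB /= -m'E cE -pmulrn.
by rewrite opprB addrCA opprD [- s i - _]addrC addNKr.
Qed.

Lemma fps_cong_char_poly N n (A B : 'M[fps F]_n) : (forall i j, fps_cong N (A i j) (B i j)) ->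
  fps_cong N (lift (char_poly A)) (lift (char_poly B)).
Proof.
move=> AB; rewrite /char_poly -2!det_map_mx; apply: fps_cong_det => i j m mN.
have E (M : 'M[fps F]_n) : map_mx lift (char_poly_mx M) i j =
    lift ('X *+ (i == j)) - fps_map (rat_inj iota) (M i j).
  by rewrite !mxE rmorphB /= lift_epsC.
by rewrite !E !fps_coefB /= AB.
Qed.

(** The coefficient of [t^N] is fixed first, and the band, the bound on exponents and the window are
    chosen for that [N]. Modulo [t^(N + 1)] both sides agree with the product of the exact
    identities for the truncated operators. *)
Lemma exp_Teps :
  fpsC eps ^+ size r * fps_exp (fps_map (@Teps K) (coef_log_xeps iota r Qd)) =
  \prod_i lift (char_poly (D i)).
Proof.
have [_ s_inj s_surj] := hs.
have charK := ratfun_unit_nat iota charF.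
apply: (fpsP _ _).1 => N.
have [b bandQ] : exists b, forall i, (i <= N)%N -> band b (Qd i).
  elim: N => [|n [b bQ]].
    by have [b bQ] := band_exists (Qd 0%N); exists b => -[|i].
  have [b' b'Q] := band_exists (Qd n.+1); exists (maxn b b') => i.
  rewrite leq_eqVlt => /orP[/eqP ->|/bQ]; first exact: band_widen (leq_maxr _ _) b'Q.
  by apply: band_widen; apply: leq_maxl.
pose M := \max_i \max_(n <- exps (s i) r) `|n|%N.
have exps_le i n : (0 < exp_mult (s i) r n)%N -> (`|n| <= M)%N.
  rewrite -mem_exps// => ne; rewrite /M (bigD1 i)//= leq_max.
  by rewrite (bigD1_seq n) ?undup_uniq//= leq_maxl.
(* One [N * b] surrounds the exponents by all positions whose translates may have a pole; the other
   keeps paths from these positions inside the window. *)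
pose B := (M + (N * b).*2)%N.
have B_large : (M + (N * b).*2 <= B)%N by [].
pose core := [seq i <- enum 'I_(B.*2.+1) | (`|@idx B i| <= B - N * b)%N].
(* The possible poles up to order [N]. They are distinct because the [s i] are incongruent modulo
   the integers and the characteristic is zero. *)
pose C := [seq iota (s i + (idx n)%:~R) | i <- enum 'I_l, n <- core].
have uC : uniq C.
  apply: allpairs_uniq; [exact: enum_uniq|exact/filter_uniq/enum_uniq|].
  move=> [i n] [j m] _ _ /=.
  move=> /fmorph_inj ij; have ijE : i = j.
    apply: s_inj; exists (idx m - idx n); rewrite rmorphB /=.
    by apply/eqP; rewrite subr_eq addrAC -subr_eq opprK ij addrC.
  by move: ij; rewrite ijE => /addrI/(intr_inj0 charF)/idx_inj ->.
(* A pole at [c] forces [c + e = s_i + m] with [|e| <= N b] and [|m| <= M], whence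
   [|m - e| <= M + N b = B - N b]. *)
have regC j c : (j <= N)%N -> c \notin C -> reg0 (shift c (coef_log_xeps iota r Qd j)).
  move=> jN cC; apply: (coef_log_xeps_reg0 bandQ) => // e eN c' rc'.
  apply: contra cC => /eqP cE; have [i [m c'E]] := s_surj c' rc'.
  have mM : (`|m%:Z| <= M)%N by apply: (exps_le i); rewrite -has_count has_pred1 -pmulrn -c'E.
  have [n nE] : exists n, @idx B n = m%:Z - e by apply: idx_surj; lia.
  apply/allpairsP; exists (i, n) => /=; split; rewrite ?mem_enum//.
    by rewrite mem_filter mem_enum andbT nE; lia.
  rewrite nE rmorphB /= addrA -pmulrn -c'E rmorphB /= rmorph_int.
  by rewrite -cE addrK.
pose z i := fps_map (@polar_part K) (win_log (s i) r iota Qd N B).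
have zE j : (j <= N)%N -> fps_map (@Teps K) (coef_log_xeps iota r Qd) j = (\sum_i z i) j.
  move=> jN; rewrite fps_coef_sum /= (Teps_local uC); last by move=> c; apply: regC.
  rewrite big_allpairs_dep big_enum /=; apply: eq_bigr => i _.
  rewrite (win_log_polar iota bandQ (exps_le i) B_large jN) /core big_filter big_enum_cond /=.
  by apply: eq_bigl => n.
have z0 i : z i 0%N = 0 by rewrite /z /= big_geq// raddf0.
have expE : fps_cong N (fps_exp (fps_map (@Teps K) (coef_log_xeps iota r Qd)))
    (fps_exp (\sum_i z i)).
  by move=> n nN; apply: (@eq_fps_exp _ N) nN; exact: zE.
rewrite (fps_congMl _ expE (leqnn N)) (fps_exp_sum charK _ z0).
rewrite -sum_class_size -prodrXr -big_split /=.
apply: (@fps_cong_prod _ N) (leqnn N) => i n nN.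
have wE := exp_polar_window charF iota Qd (exps_le i) B_large.
have -> : fpsC eps ^+ class_size r (s i) * fps_exp (z i) =
    lift (char_poly (@log_monodromy F charF (s i) r (@qcut F (s i) Qd N B))).
  by rewrite -wE rmorphXn.
apply: (@fps_cong_char_poly N) nN => a a' j jN.
by rewrite -(cut_monodromy charF bandQ (exps_le i) B_large).
Qed.

End Assembly.

Lemma ramify_lift_eps (F K : fieldType) (iota : {rmorphism F -> K}) (L : nat)
    (L_gt0 : (0 < L)%N) (p : {poly fps F}) :
  fps_ramify L (lift_eps iota p) =
  (map_poly (fps_map ratC) (map_poly (ram iota L_gt0) p)).[fpsC eps].
Proof.
rewrite -[LHS]/(ramify_rm L_gt0 _); elim/poly_ind: p => [|p c IHp].
  by rewrite !rmorph0 horner0.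
rewrite !rmorphD !rmorphM /= lift_epsX lift_epsC !map_polyC !map_polyX hornerD hornerM IHp.
rewrite hornerX hornerC [ramify_rm L_gt0 (fpsC _)]fps_ramifyC//; congr (_ + _).
by apply: (fpsP _ _).1 => n /=; case: ifP; rewrite ?rmorph0.
Qed.

Lemma size_prod_char_poly (R : comNzRingType) l (n : 'I_l -> nat) (D : forall i, 'M[R]_(n i)) :
  \prod_i char_poly (D i) \is monic /\ size (\prod_i char_poly (D i)) = (\sum_i n i).+1.
Proof.
elim/big_ind2: _ => [|p x q y [pm sp] [qm sq]|i _].
- by rewrite monic1 size_poly1.
- by rewrite monicMl// qm size_Mmonic ?monic_neq0// sp sq addSn addnS.
- by rewrite char_poly_monic size_char_poly.
Qed.

Theorem theorem3p2 (F : fieldType) (charF : [pchar F] =i pred0)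
    (K : closedFieldType) (iota : {rmorphism F -> K})
    (algK : forall z : K, algebraicOver iota z)
    (k : nat) (r : k.-tuple F) (Q : nat -> seq (laurent F))
    (l : nat) (s : 'I_l -> F) (hs : smallest_reps r s)
    (L : nat) (L_gt0 : (0 < L)%N)
    (lambda : forall i : 'I_l, 'I_(class_size r (s i)) -> fps K)
    (hlambda : forall i : 'I_l,
       class_exponents iota L r Q (s i) (lambda i)) :
  let lhs : fps (ratfun K) :=
    fpsC eps ^+ k * fps_exp (fps_map (@Teps K) (coef_log_xeps iota r Q)) in
  fps_ramify L lhs
    = \prod_(i < l) \prod_(j < class_size r (s i))
        (fpsC eps - fps_map ratC (lambda i j)) /\
  exists p : {poly fps F},
    [/\ p \is monic, size p = k.+1 &
        lhs = (map_poly (fps_map (rat_inj iota)) p).[fpsC eps]].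
Proof.
pose D i := @log_monodromy F charF (s i) r (@qfull F (s i) Q).
move=> lhs.
have lhsE : lhs = \prod_i lift_eps iota (char_poly (D i)).
  by rewrite -exp_Teps// size_tuple.
split.
  rewrite lhsE -[LHS]/(ramify_rm L_gt0 _) rmorph_prod; apply: eq_bigr => i _.
  rewrite [LHS]ramify_lift_eps (char_poly_monodromy charF _ (hlambda i)) rmorph_prod horner_prod.
  by apply: eq_bigr => j _; rewrite rmorphB /= map_polyX map_polyC hornerXsubC.
(* The monodromy matrices have entries in [F[[t]]], so this witness is defined over [F] and without
   ramification. *)
exists (\prod_i char_poly (D i)).
have [mon sz] := size_prod_char_poly D.
split=> //; first by rewrite sz (sum_class_size hs) size_tuple.
by rewrite lhsE rmorph_prod horner_prod.
Qed.
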